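(* Let $\Gamma$ be a finite simple graph and let $p$ be a prime. Then $$\nu_p(\mathrm{Aut}^0(A_\Gamma))=\nu_p(\mathrm{Out}^0(A_\Gamma))=\sum_{[v]\in\mathrm{V}(\Gamma)/\sim}\ \sum_{k\geq0}\left\lfloor\frac{|[v]|}{p^k(p-1)}\right\rfloor$$ and $$\mathrm{rank}_{\mathbb{Z}_p}(\mathrm{Aut}^0(A_\Gamma))=\mathrm{rank}_{\mathbb{Z}_p}(\mathrm{Out}^0(A_\Gamma))=\sum_{[v]\in\mathrm{V}(\Gamma)/\sim}\left\lfloor\frac{|[v]|}{p-1}\right\rfloor.$$
   Context: For a finite simple graph $\Gamma$, $A_\Gamma=\langle \mathrm{V}(\Gamma)\mid vw=wv \text{ for all }\{v,w\}\in\mathrm{E}(\Gamma)\rangle$ is the right-angled Artin group. $\mathrm{lk}(v)$ (resp. $\mathrm{st}(v)$) is the full subgraph spanned by the neighbours of $v$ (resp. by $v$ and its neighbours). Write $v\leq w$ if $\mathrm{lk}(v)\subseteq\mathrm{st}(w)$ (a preorder), and $v\sim w$ if $v\leq w$ and $w\leq v$; $[v]$ is the $\sim$-class of $v$ and $|[v]|$ its cardinality. The pure automorphism group $\mathrm{Aut}^0(A_\Gamma)$ is the subgroup of $\mathrm{Aut}(A_\Gamma)$ generated by: inversions (sending one vertex $v$ to $v^{-1}$ and fixing the other vertices); transvections $\lambda_{v,w}$ for $v\geq w$, $v\neq w$ (sending $w$ to $vw$ and fixing the other vertices); and partial conjugations $\gamma_{v,C}$, for $C$ a connected component of $\Gamma-\mathrm{st}(v)$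 (sending each vertex $w\in C$ to $vwv^{-1}$ and fixing the other vertices). It contains $\mathrm{Inn}(A_\Gamma)$, and $\mathrm{Out}^0(A_\Gamma)=\mathrm{Aut}^0(A_\Gamma)/\mathrm{Inn}(A_\Gamma)$. For a group $G$ and a prime $p$: $\nu_p(G)=\max\{t\mid G\text{ has a subgroup of order }p^t\}$ and $\mathrm{rank}_{\mathbb{Z}_p}(G)=\max\{t\mid \mathbb{Z}_p^t\text{ embeds in }G\}$, where $\mathbb{Z}_p$ is the cyclic group of order $p$. *)

(* Defs.v *)
From HB Require Import structures.
From mathcomp Require Import all_boot ssralg zmodp.
From mathcomp Require Import boolp classical_sets functions cardinality fsbigop.

Set Implicit Arguments.
Unset Strict Implicit.
Unset Printing Implicit Defensive.

Local Open Scope group_scope.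
Local Open Scope quotient_scope.

(** * Groups given by generators and relations *)

Section Presentation.
Variable X : choiceType.

(* The letter (x, false) stands for x and (x, true) for its inverse. *)
Definition word := seq (X * bool).

Definition letter_inv (a : X * bool) : X * bool := (a.1, ~~ a.2).
Definition word_inv (u : word) : word := rev (map letter_inv u).

Variable R : word -> word -> Prop.

Inductive pres_cong : word -> word -> Prop :=
| PresRel u v of R u v : pres_cong u v
| PresInv a : pres_cong [:: a; letter_inv a] [::]
| PresRefl u : pres_cong u u
| PresSym u v of pres_cong u v : pres_cong v u
| PresTrans u v w of pres_cong u v & pres_cong v w : pres_cong u w
| PresCat u u' v v' of pres_cong u u' & pres_cong v v' :
    pres_cong (u ++ v) (u' ++ v').

Definition pres_rel : rel word := fun u v => `[< pres_cong u v >].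

Lemma pres_rel_refl : reflexive pres_rel.
Proof. by move=> u; apply/asboolP/PresRefl. Qed.

Lemma pres_rel_sym : symmetric pres_rel.
Proof. by move=> u v; apply/asboolP/asboolP; apply: PresSym. Qed.

Lemma pres_rel_trans : transitive pres_rel.
Proof.
by move=> v u w /asboolP uv /asboolP vw; apply/asboolP/(PresTrans uv).
Qed.

Canonical pres_equiv := EquivRel pres_rel pres_rel_refl pres_rel_sym pres_rel_trans.

Definition presented : Type := {eq_quot pres_equiv}.
HB.instance Definition _ := Choice.on presented.
HB.instance Definition _ := EqQuotient.on presented.

Lemma letter_invK : involutive letter_inv.
Proof. by case=> x b; rewrite /letter_inv /= negbK. Qed.

Lemma word_invK : involutive word_inv.
Proof. by move=> u; rewrite /word_inv map_rev revK (mapK letter_invK). Qed.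

Lemma pres_catV u : pres_cong (u ++ word_inv u) [::].
Proof.
elim: u => [|a u IHu]; first exact: PresRefl.
have -> : (a :: u) ++ word_inv (a :: u)
    = [:: a] ++ ((u ++ word_inv u) ++ [:: letter_inv a]).
  by rewrite /word_inv /= rev_cons -cats1 catA.
apply: PresTrans (PresInv a).
by apply: PresCat (PresRefl _) _; apply: PresCat IHu (PresRefl _).
Qed.

Lemma pres_Vcat u : pres_cong (word_inv u ++ u) [::].
Proof. by have := pres_catV (word_inv u); rewrite word_invK. Qed.

Lemma pres_congV u v : pres_cong u v -> pres_cong (word_inv u) (word_inv v).
Proof.
move=> uv.
have h1 : pres_cong (word_inv u ++ (v ++ word_inv v)) (word_inv u).
  by rewrite -[X in pres_cong _ X]cats0; apply: PresCat (PresRefl _) (pres_catV v).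
apply: PresTrans (PresSym h1) _; rewrite catA -[X in pres_cong _ X]cat0s.
apply: PresCat (PresRefl _); apply: PresTrans (pres_Vcat u).
exact: PresCat (PresRefl _) (PresSym uv).
Qed.

Definition pres_one : presented := \pi_presented [::].
Definition pres_mul (x y : presented) : presented :=
  \pi_presented (repr x ++ repr y).
Definition pres_inv (x : presented) : presented := \pi_presented (word_inv (repr x)).

Lemma pres_piP u v : \pi_presented u = \pi_presented v <-> pres_cong u v.
Proof. by split=> [/eqmodP/asboolP|?] //; apply/eqmodP/asboolP. Qed.

Lemma pres_reprP u : pres_cong (repr (\pi_presented u)) u.
Proof. by apply/pres_piP; rewrite reprK. Qed.

Lemma pres_mulE u v :
  pres_mul (\pi_presented u) (\pi_presented v) = \pi_presented (u ++ v).
Proof. exact/pres_piP/PresCat/pres_reprP/pres_reprP. Qed.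

Lemma pres_invE u : pres_inv (\pi_presented u) = \pi_presented (word_inv u).
Proof. exact/pres_piP/pres_congV/pres_reprP. Qed.

Lemma pres_mulA : associative pres_mul.
Proof.
move=> a b c; elim/quotW: a => u; elim/quotW: b => v; elim/quotW: c => w.
by rewrite (pres_mulE v w) (pres_mulE u v) (pres_mulE u) (pres_mulE _ w) catA.
Qed.

Lemma pres_mul1 : left_id pres_one pres_mul.
Proof. by move=> a; elim/quotW: a => u; rewrite pres_mulE. Qed.

Lemma pres_mulr1 : right_id pres_one pres_mul.
Proof. by move=> a; elim/quotW: a => u; rewrite pres_mulE cats0. Qed.

Lemma pres_mulV : left_inverse pres_one pres_inv pres_mul.
Proof.
move=> a; elim/quotW: a => u; rewrite pres_invE pres_mulE.
by apply/pres_piP/pres_Vcat.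
Qed.

Lemma pres_mulrV : right_inverse pres_one pres_inv pres_mul.
Proof.
move=> a; elim/quotW: a => u; rewrite pres_invE pres_mulE.
by apply/pres_piP/pres_catV.
Qed.

HB.instance Definition _ :=
  isGroup.Build presented pres_mulA pres_mul1 pres_mulr1 pres_mulV pres_mulrV.

Definition pres_gen (x : X) : presented := \pi_presented [:: (x, false)].

End Presentation.

(** * Automorphism groups *)

Section Automorphisms.
Variable G : groupType.

Definition is_aut : pred (G -> G) :=
  fun f => `[< bijective f /\ {morph f : x y / x * y} >].

Definition aut := {f : G -> G | is_aut f}.
HB.instance Definition _ := Choice.on aut.

Definition aut_fun (f : aut) : G -> G := val f.
Coercion aut_fun : aut >-> Funclass.

Lemma autM (f : aut) : {morph f : x y / x * y}.
Proof. by have /asboolP[] := valP f. Qed.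

Lemma aut_bij (f : aut) : bijective f.
Proof. by have /asboolP[] := valP f. Qed.

Lemma autP (f g : aut) : f =1 g -> f = g.
Proof. by move=> fg; apply/val_inj/funext. Qed.

Lemma is_aut_id : is_aut idfun.
Proof. by apply/asboolP; split=> //; exists idfun. Qed.

Lemma is_aut_comp (f g : aut) : is_aut (f \o g).
Proof.
apply/asboolP; split; first exact: bij_comp (aut_bij f) (aut_bij g).
by move=> x y /=; rewrite !autM.
Qed.

Lemma aut_inv_ex (f : aut) : exists g : G -> G, cancel f g /\ cancel g f.
Proof. by have [g fK gK] := aut_bij f; exists g. Qed.

Definition aut_inv_fun (f : aut) : G -> G := projT1 (cid (aut_inv_ex f)).

Lemma aut_inv_funK (f : aut) : cancel f (aut_inv_fun f).
Proof. by rewrite /aut_inv_fun; case: (cid _) => g []. Qed.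

Lemma aut_inv_funVK (f : aut) : cancel (aut_inv_fun f) f.
Proof. by rewrite /aut_inv_fun; case: (cid _) => g []. Qed.

Lemma is_aut_inv (f : aut) : is_aut (aut_inv_fun f).
Proof.
apply/asboolP; split; first by exists f; [exact: aut_inv_funVK | exact: aut_inv_funK].
exact: (can2_gmulfM (f := HB.pack_for {multiplicative G -> G} (f : G -> G)
  (isMultiplicative.Build G G f (@autM f))) (@aut_inv_funK f) (@aut_inv_funVK f)).
Qed.

Definition aut_one : aut := Sub idfun is_aut_id.
Definition aut_mul (f g : aut) : aut := Sub (f \o g) (is_aut_comp f g).
Definition aut_inv (f : aut) : aut := Sub (aut_inv_fun f) (is_aut_inv f).

Lemma aut_mulA : associative aut_mul. Proof. by move=> f g h; apply: autP. Qed.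
Lemma aut_mul1 : left_id aut_one aut_mul. Proof. by move=> f; apply: autP. Qed.
Lemma aut_mulr1 : right_id aut_one aut_mul. Proof. by move=> f; apply: autP. Qed.

Lemma aut_mulV : left_inverse aut_one aut_inv aut_mul.
Proof. by move=> f; apply: autP => x; apply: aut_inv_funK. Qed.

Lemma aut_mulrV : right_inverse aut_one aut_inv aut_mul.
Proof. by move=> f; apply: autP => x; apply: aut_inv_funVK. Qed.

HB.instance Definition _ :=
  isGroup.Build aut aut_mulA aut_mul1 aut_mulr1 aut_mulV aut_mulrV.

Definition inner (f : aut) : Prop := exists g : G, forall x, f x = g * x * g^-1.

End Automorphisms.

(** * Subgroup generated by a set, as a group *)

Section Generated.
Variables (G : groupType) (S : set G).

Definition gen : pred G := fun x =>
  `[< forall H : {pred G}, group_closed H -> (forall s, S s -> s \in H) -> x \in H >].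

Lemma gen_closed : group_closed gen.
Proof.
split=> [|x y /asboolP xS /asboolP yS]; apply/asboolP => H clH SH.
  by case: clH.
by case: (clH) => _; apply; [exact: xS | exact: yS].
Qed.

Definition genType := {x : G | gen x}.
HB.instance Definition _ := SubChoice.on genType.
HB.instance Definition _ := SubChoice_isSubGroup.Build G gen genType gen_closed.

End Generated.

(** * Quotient by a normal subgroup *)

Record normal_subgroup (G : groupType) := NormalSubgroup {
  nsub :> {pred G};
  nsub_closed : group_closed nsub;
  nsub_normal : forall x y, x \in nsub -> x ^ y \in nsub
}.

Section Quotient.
Variables (G : groupType) (N : normal_subgroup G).

Definition coset_rel : rel G := fun x y => x^-1 * y \in N.

Lemma coset_rel_refl : reflexive coset_rel.
Proof. by move=> x; rewrite /coset_rel mulVg; case: (nsub_closed N). Qed.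

Lemma nsubV x : x \in N -> x^-1 \in N.
Proof. exact: (group_closedV (nsub_closed N)). Qed.

Lemma nsubM x y : x \in N -> y \in N -> x * y \in N.
Proof. by move=> ? ?; apply: (group_closedM (nsub_closed N)). Qed.

Lemma coset_rel_sym : symmetric coset_rel.
Proof.
move=> x y; rewrite /coset_rel; apply/idP/idP => /nsubV.
  by rewrite invgM invgK.
by rewrite invgM invgK.
Qed.

Lemma coset_rel_trans : transitive coset_rel.
Proof.
move=> y x z xy yz; rewrite /coset_rel; have := nsubM xy yz.
by rewrite mulgA mulgK.
Qed.

Canonical coset_equiv :=
  EquivRel coset_rel coset_rel_refl coset_rel_sym coset_rel_trans.

Definition quotg : Type := {eq_quot coset_equiv}.
HB.instance Definition _ := Choice.on quotg.
HB.instance Definition _ := EqQuotient.on quotg.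

Definition quotg_one : quotg := \pi_quotg 1.
Definition quotg_mul (x y : quotg) : quotg := \pi_quotg (repr x * repr y).
Definition quotg_inv (x : quotg) : quotg := \pi_quotg ((repr x)^-1).

Lemma quotg_piP x y : \pi_quotg x = \pi_quotg y <-> x^-1 * y \in N.
Proof. by split=> [/eqmodP|?] //; apply/eqmodP. Qed.

Lemma quotg_reprP x : (repr (\pi_quotg x))^-1 * x \in N.
Proof. by apply/quotg_piP; rewrite reprK. Qed.

Lemma quotg_mulE x y : quotg_mul (\pi_quotg x) (\pi_quotg y) = \pi_quotg (x * y).
Proof.
apply/quotg_piP; set x' := repr _; set y' := repr _.
have -> : (x' * y')^-1 * (x * y) = (x'^-1 * x) ^ y' * (y'^-1 * y).
  by rewrite conjgE invgM !mulgA mulgK.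
by apply: nsubM; [apply: nsub_normal|]; exact: quotg_reprP.
Qed.

Lemma quotg_invE x : quotg_inv (\pi_quotg x) = \pi_quotg (x^-1).
Proof.
apply/quotg_piP; set x' := repr _; rewrite invgK.
have -> : x' * x^-1 = ((x'^-1 * x)^-1) ^ (x'^-1).
  by rewrite conjgE !invgK invgM invgK -!mulgA mulgV mulg1.
by apply/nsub_normal/nsubV/quotg_reprP.
Qed.

Lemma quotg_mulA : associative quotg_mul.
Proof.
move=> a b c; elim/quotW: a => x; elim/quotW: b => y; elim/quotW: c => z.
by rewrite (quotg_mulE y z) (quotg_mulE x y) (quotg_mulE x) (quotg_mulE _ z) mulgA.
Qed.

Lemma quotg_mul1 : left_id quotg_one quotg_mul.
Proof. by move=> a; elim/quotW: a => x; rewrite quotg_mulE mul1g. Qed.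

Lemma quotg_mulr1 : right_id quotg_one quotg_mul.
Proof. by move=> a; elim/quotW: a => x; rewrite quotg_mulE mulg1. Qed.

Lemma quotg_mulV : left_inverse quotg_one quotg_inv quotg_mul.
Proof. by move=> a; elim/quotW: a => x; rewrite quotg_invE quotg_mulE mulVg. Qed.

Lemma quotg_mulrV : right_inverse quotg_one quotg_inv quotg_mul.
Proof. by move=> a; elim/quotW: a => x; rewrite quotg_invE quotg_mulE mulgV. Qed.

HB.instance Definition _ :=
  isGroup.Build quotg quotg_mulA quotg_mul1 quotg_mulr1 quotg_mulV quotg_mulrV.

End Quotient.

(** * Right-angled Artin groups *)

Section RAAG.
Variables (V : finType) (E : rel V).

Definition lk (v : V) : {set V} := [set w | E v w].
Definition st (v : V) : {set V} := v |: lk v.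

(* v <= w in the domination preorder. *)
Definition vle (v w : V) : bool := lk v \subset st w.
Definition vsim : rel V := fun v w => vle v w && vle w v.
Definition vclasses : {set {set V}} := equivalence_partition vsim [set: V].

Definition raag_relation (u u' : word V) : Prop := exists v w : V,
  [/\ E v w, u = [:: (v, false); (w, false)] & u' = [:: (w, false); (v, false)]].

Definition raag : Type := presented raag_relation.
HB.instance Definition _ := Group.on raag.

Definition vtx (v : V) : raag := pres_gen raag_relation v.

Definition inversion (f : aut raag) : Prop := exists v : V,
  f (vtx v) = (vtx v)^-1 /\ forall u, u != v -> f (vtx u) = vtx u.

(* The vertex w is multiplied on the left by v, for w <= v. An automorphism is
   determined by its values on the vertices, so there is at most one such f. *)
Definition transvection (f : aut raag) : Prop := exists v w : V,
  [/\ vle w v, v != w, f (vtx w) = vtx v * vtx w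
    & forall u, u != w -> f (vtx u) = vtx u].

(* Adjacency in the graph obtained by deleting st v. *)
Definition del_st (v : V) : rel V :=
  fun x y => [&& x \notin st v, y \notin st v & E x y].

Definition component_del_st (v : V) (C : {set V}) : Prop :=
  exists2 x, x \notin st v & C = [set y | connect (del_st v) x y].

Definition partial_conjugation (f : aut raag) : Prop :=
  exists (v : V) (C : {set V}),
  [/\ component_del_st v C,
      forall w, w \in C -> f (vtx w) = vtx v * vtx w * (vtx v)^-1
    & forall w, w \notin C -> f (vtx w) = vtx w].

Definition pure_generator (f : aut raag) : Prop :=
  [\/ inversion f, transvection f | partial_conjugation f].

Definition Aut0 : groupType := genType pure_generator.

Definition inner0 : {pred Aut0} := fun f => `[< inner (val f) >].

Lemma inner0_closed : group_closed inner0.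
Proof.
split=> [|f g /asboolP[a fa] /asboolP[b gb]]; apply/asboolP.
  by exists 1 => x; rewrite invg1 mul1g mulg1.
exists (a * b^-1) => x.
rewrite gmulfF /= [LHS]fa -!mulgA; congr (_ * _).
rewrite invgM invgK !mulgA; congr (_ * _).
have gK := aut_inv_funVK (val g) x; rewrite gb in gK.
by rewrite -[in RHS]gK -!mulgA mulKg mulVg mulg1.
Qed.

Lemma inner0_normal (f g : Aut0) : f \in inner0 -> f ^ g \in inner0.
Proof.
move=> /asboolP[a fa]; apply/asboolP; set h := aut_inv_fun (val g).
exists (h a) => x.
have hM : {morph h : y z / y * z} by exact: (autM (aut_inv (val g))).
have hV y : h y^-1 = (h y)^-1.
  have h1 : h 1 = 1 by apply: (mulIg (h 1)); rewrite -hM !mul1g.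
  by apply: (mulIg (h y)); rewrite -hM !mulVg.
have -> : (val (f ^ g) : aut raag) x = h ((val f : aut raag) ((val g : aut raag) x)).
  by rewrite conjgE !valM gmulfV.
by rewrite fa !hM hV; congr (_ * _ * _); apply: aut_inv_funK.
Qed.

(* Every inner automorphism is pure, so this is all of Inn. *)
Definition Inn : normal_subgroup Aut0 := NormalSubgroup inner0_closed inner0_normal.

Definition Out0 : groupType := quotg Inn.

End RAAG.

(** * Finite p-subgroups and elementary abelian p-subgroups *)

Definition is_max (P : nat -> Prop) (n : nat) : Prop :=
  P n /\ forall t, P t -> (t <= n)%N.

Definition has_subgroup_of_order (G : groupType) (n : nat) : Prop :=
  exists H : {pred G}, group_closed H /\ ([set` H] #= `I_n)%card%classic.

(* The ring 'Z_p has order p as soon as 1 < p. *)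
Definition Zp_power_embeds (p t : nat) (G : groupType) : Prop :=
  exists f : {ffun 'I_t -> 'Z_p} -> G,
    injective f /\ {morph f : x y / (x + y)%R >-> x * y}.

Definition is_nu (p : nat) (G : groupType) (n : nat) : Prop :=
  is_max (fun t => has_subgroup_of_order G (p ^ t)%N) n.

Definition is_rank (p : nat) (G : groupType) (n : nat) : Prop :=
  is_max (fun t => Zp_power_embeds p t G) n.

(* Main.v *)
From HB Require Import structures.
From mathcomp Require Import all_boot all_order all_algebra all_fingroup.
From mathcomp Require Import all_solvable all_field all_character.
Require Import Defs.
From mathcomp Require Import all_boot ssralg zmodp.
From mathcomp Require Import ring.
From mathcomp Require Import boolp classical_sets functions cardinality fsbigop.

Set Implicit Arguments.
Unset Strict Implicit.
Unset Printing Implicit Defensive.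

Import GRing.Theory Num.Theory.

(** The group A = [raag E] has first homology Z^V, and a pure automorphism acts on
    it by a matrix that is triangular for the domination preorder, with one
    diagonal block in GL(n_C, Z) for each class C of n_C vertices. Inner
    automorphisms act trivially, so the blocks are representations of Aut0 and of
    Out0 alike, and both groups are squeezed between the same two bounds.

    Upper bound. An element of order p with trivial blocks is trivial
    ([Aut0_torsion], [Out0_torsion]), so the blocks are jointly faithful on finite
    p-subgroups. For a finite p-group of integral matrices the trace of an element
    takes only the values n - p j with 0 <= j <= n / (p - 1); Schur's argument turns
    this into the divisibility [schur_bound], whose right-hand side is given by
    Legendre's formula [sum_floor]. For elementary abelian groups, the nontrivial
    linear constituents of an integral representation are permuted freely by
    Gal(Q(zeta_p)/Q), which gives [abelem_bound].

    Absence of torsion. Let f have trivial blocks and let f^p be conjugation by a.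
    Then f is unipotent on homology and a power of it is trivial there, so f itself
    acts trivially ([unipotent_power]). Embed A by the Magnus map [mu] into the units of
    the ring of power series in partially commuting variables, where roots of series
    with constant term 1 exist and are unique, and let b be the p-th root of mu a.
    Comparing leading terms, f is conjugation by b ([conj_by_root]). If a = 1, then b = 1
    and f is the identity. In general b has to be found in mu A, after removing the
    vertices adjacent to all others, which are central. First, the coefficients of b
    are integers, because b conjugates variables to integral series
    ([sint_normalizer]). Then b conjugates a vertex x to an element of A, and such an
    element is conjugate to x already in A ([conj_vertex]); dividing, one may suppose that
    b commutes with x. So b only involves the star of x, where it splits as a power of x
    times a series over fewer vertices ([normalizer_root]). Integrality is what makes the
    exponent of x an integer.

    Lower bound. A class of n_C vertices contains m_C = n_C / (p - 1) disjoint blocks of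
    p - 1 vertices. The symmetric group on p points acts on the free group on a block
    by z_i |-> z_(s 0)^-1 z_(s i), where z_0 = 1, and these maps extend to pure automorphisms
    of A. Together with the permutations of the blocks inside a class, the rotations of
    the blocks generate a finite group of order p^(sum m_C) times the product of the m_C!
    ([card_wreath]) that is faithful on homology, hence embeds into Aut0 and into Out0
    ([wreath_embeds]). Its Sylow p-subgroup has the required order, and the rotations form an
    elementary abelian group of the required rank. *)

(** * Traces: words up to commutation of adjacent letters *)

Section Traces.
Local Open Scope quotient_scope.
Variables (V : finType) (E : rel V).

Definition adj (u v : V) : bool := (u != v) && E u v.

(** A trace is recorded by its projections to the pairs of letters that do not
    commute; this makes cancellation immediate. *)
Definition proj (w : seq V) : {ffun V * V -> seq V} :=
  [ffun uv => if adj uv.1 uv.2 then [::] else filter (pred2 uv.1 uv.2) w].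

Definition trel : rel (seq V) := fun w w' => proj w == proj w'.

Lemma trel_refl : reflexive trel. Proof. by move=> w; apply: eqxx. Qed.
Lemma trel_sym : symmetric trel. Proof. by move=> w w'; apply: eq_sym. Qed.
Lemma trel_trans : transitive trel.
Proof. by move=> w u v /eqP uw /eqP wv; rewrite /trel uw wv. Qed.

Canonical trel_equiv := EquivRel trel trel_refl trel_sym trel_trans.

Definition trace : Type := {eq_quot trel_equiv}.
HB.instance Definition _ := Choice.on trace.
HB.instance Definition _ := EqQuotient.on trace.

Definition tr (w : seq V) : trace := \pi_trace w.

Lemma trP w w' : tr w = tr w' <-> proj w = proj w'.
Proof. by split=> [/eqmodP/eqP|e] //; apply/eqmodP/eqP. Qed.

Lemma trK (t : trace) : tr (repr t) = t. Proof. exact: reprK. Qed.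

Lemma proj_cat w w' uv : proj (w ++ w') uv = proj w uv ++ proj w' uv.
Proof. by rewrite !ffunE; case: ifP => // _; rewrite filter_cat. Qed.

Lemma tr_cat u u' v v' : tr u = tr u' -> tr v = tr v' -> tr (u ++ v) = tr (u' ++ v').
Proof.
by move=> /trP eu /trP ev; apply/trP/ffunP => z; rewrite !proj_cat eu ev.
Qed.

Lemma tr_catI u v v' : tr (u ++ v) = tr (u ++ v') <-> tr v = tr v'.
Proof.
split=> [|e]; last exact: tr_cat.
move=> /trP e; apply/trP/ffunP => z; have := congr1 (fun f : {ffun _} => f z) e.
by rewrite !proj_cat => /(congr1 (drop (size (proj u z)))); rewrite !drop_size_cat.
Qed.

Lemma tr_Icat u v v' : tr (v ++ u) = tr (v' ++ u) <-> tr v = tr v'.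
Proof.
split=> [|e]; last exact: tr_cat.
move=> /trP e; apply/trP/ffunP => z; have := congr1 (fun f : {ffun _} => f z) e.
rewrite !proj_cat => ez; have es : size (proj v z) = size (proj v' z).
  by apply: (@addIn (size (proj u z))); rewrite -!size_cat ez.
by have /eqP := ez; rewrite eqseq_cat // => /andP[/eqP].
Qed.

Lemma tr_count w w' x : tr w = tr w' -> count_mem x w = count_mem x w'.
Proof.
move=> /trP/(congr1 (fun f : {ffun _} => f (x, x))); rewrite !ffunE /= /adj eqxx /=.
move=> /(congr1 size); rewrite !size_filter.
have e s : count (pred2 x x) s = count_mem x s by apply: eq_count => y /=; rewrite orbb.
by rewrite !e.
Qed.

Lemma tr_perm w w' : tr w = tr w' -> perm_eq w w'.
Proof. by move=> e; apply/allP => x _; rewrite /= (tr_count x e). Qed.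

Lemma tr_mem w w' : tr w = tr w' -> w =i w'.
Proof. by move=> /tr_perm/perm_mem. Qed.

Lemma tr_size w w' : tr w = tr w' -> size w = size w'.
Proof. by move=> /tr_perm/perm_size. Qed.

Definition tlen (t : trace) : nat := size (repr t).
Lemma tlenE w : tlen (tr w) = size w.
Proof. by apply: tr_size; rewrite trK. Qed.

Definition tsupp (t : trace) : {set V} := [set x in repr t]%SET.
Lemma tsuppE w x : (x \in tsupp (tr w)) = (x \in w).
Proof. by rewrite inE; apply: tr_mem; rewrite trK. Qed.

Definition tmul (s t : trace) : trace := tr (repr s ++ repr t).
Lemma tmulE u v : tmul (tr u) (tr v) = tr (u ++ v).
Proof. by apply: tr_cat; rewrite trK. Qed.

Lemma trace_ind (P : trace -> Prop) : (forall w, P (tr w)) -> forall t, P t.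
Proof. by move=> h t; rewrite -(trK t). Qed.

Lemma tmulA : associative tmul.
Proof.
by elim/trace_ind => u; elim/trace_ind => v; elim/trace_ind => w; rewrite !tmulE catA.
Qed.

Lemma tmul1t t : tmul (tr [::]) t = t.
Proof. by elim/trace_ind: t => u; rewrite tmulE. Qed.

Lemma tmult1 t : tmul t (tr [::]) = t.
Proof. by elim/trace_ind: t => u; rewrite tmulE cats0. Qed.

Lemma tmulI t : injective (tmul t).
Proof.
elim/trace_ind: t => u; elim/trace_ind => v; elim/trace_ind => w.
by rewrite !tmulE => /tr_catI.
Qed.

Lemma tImul t : injective (tmul^~ t).
Proof.
elim/trace_ind: t => u; elim/trace_ind => v; elim/trace_ind => w.
by rewrite !tmulE => /tr_Icat.
Qed.

Lemma tlenM s t : tlen (tmul s t) = (tlen s + tlen t)%N.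
Proof.
by elim/trace_ind: s => u; elim/trace_ind: t => v; rewrite tmulE !tlenE size_cat.
Qed.

Lemma tlen_eq0 t : (tlen t == 0%N) = (t == tr [::]).
Proof.
elim/trace_ind: t => u; rewrite tlenE; apply/idP/eqP => [/nilP->|] //.
by move=> /tr_size /= ->.
Qed.

Lemma tsuppM s t : tsupp (tmul s t) = (tsupp s :|: tsupp t)%SET.
Proof.
apply/setP => x; elim/trace_ind: s => u; elim/trace_ind: t => v.
by rewrite tmulE finset.in_setU !tsuppE mem_cat.
Qed.

Definition adjall (x : V) (w : seq V) : bool := all (adj x) w.

Lemma adjall_notin x w : adjall x w -> x \notin w.
Proof. by move=> /allP h; apply/negP => /h; rewrite /adj eqxx. Qed.

Hypothesis Esym : symmetric E.

Lemma adjC u v : adj u v = adj v u.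
Proof. by rewrite /adj eq_sym Esym. Qed.

Lemma tr_swap x w : adjall x w -> tr (x :: w) = tr (w ++ [:: x]).
Proof.
move=> /allP h; apply/trP/ffunP => -[a b]; rewrite !ffunE /=; case: ifP => // nab.
rewrite filter_cat /=; case: ifP => [/orP xab|]; last by rewrite cats0.
suff -> : filter (pred2 a b) w = [::] by [].
apply/eqP; rewrite -[_ == _]negbK -has_filter; apply/hasPn => y yw /=.
have := h y yw; have := nab; rewrite /adj; case: xab => /eqP->.
  move=> nab' /andP[ay Eay]; rewrite negb_or eq_sym ay /=; apply: contraFN nab' => /eqP<-.
  by rewrite ay.
move=> nab' /andP[ay Eay]; rewrite negb_or andbC eq_sym ay /=; apply: contraFN nab' => /eqP<-.
by rewrite eq_sym ay Esym.
Qed.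

Lemma tr_move a x b : adjall x a -> tr (a ++ x :: b) = tr (x :: a ++ b).
Proof.
move=> /tr_swap e; rewrite -cat1s catA -[x :: a ++ b]/((x :: a) ++ b).
by apply: tr_cat => //; rewrite e.
Qed.

(** In the projections to the pairs x, y with y not adjacent to x, the letter x
    comes first. *)
Lemma tr_consP x w w' : tr w = tr (x :: w') ->
  exists a b, [/\ w = a ++ x :: b, adjall x a & tr (a ++ b) = tr w'].
Proof.
move=> e; have xw : x \in w by rewrite (tr_mem e) mem_head.
have [a [b xa]] : exists a b, x \notin a /\ w = a ++ x :: b.
  exists (take (index x w) w), (drop (index x w).+1 w); split.
    by rewrite in_take_leq ?index_size // ltnn.
  by rewrite -{2}(nth_index x xw) -drop_nth ?index_mem // cat_take_drop.
case: xa => xa ew; have ha : adjall x a.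
  apply/allP => y ya; rewrite -[adj x y]negbK; apply/negP => nxy.
  move/trP: e => /(congr1 (fun f : {ffun _} => f (x, y))); rewrite !ffunE /= (negPf nxy) eqxx /=.
  rewrite ew filter_cat; case fa: [seq i <- a | pred2 x y i] => [|c l].
    have /eqP := fa; rewrite -[_ == _]negbK -has_filter => /hasPn/(_ y ya).
    by rewrite /= eqxx orbT.
  move=> [ec _]; have : c \in [seq i <- a | pred2 x y i] by rewrite fa mem_head.
  by rewrite mem_filter ec (negPf xa) andbF.
exists a, b; split=> //; apply/(tr_catI [:: x]); rewrite -e ew.
by rewrite [RHS]tr_move.
Qed.

Lemma cat_split (T : Type) (a b c d : seq T) : a ++ b = c ++ d ->
  (exists e, a = c ++ e /\ d = e ++ b) \/ (exists e, c = a ++ e /\ b = e ++ d).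
Proof.
elim: a c => [|x a IH] [|y c] /= e.
- by left; exists [::].
- by right; exists (y :: c).
- by left; exists (x :: a).
case: e => -> /IH[[e [-> ->]]|[e [-> ->]]]; [left|right]; by exists e.
Qed.

(** By induction on a: a letter removed from the front is put back in w. *)
Lemma tr_square w a z b : tr w = tr (a ++ z :: z :: b) ->
  exists w1 w2 w3, w = w1 ++ z :: w2 ++ z :: w3 /\ adjall z w2.
Proof.
elim: a w => [|c a IH] w /=.
  move=> /tr_consP[a1 [b1 [-> ha1 /tr_consP[a2 [b2 [e ha2 _]]]]]].
  have [[[|y f] [ea eb]]|[f [ea eb]]] := cat_split e.
  - by exists a1, [::], b2; rewrite -[b1]/([::] ++ b1) -eb.
  - case: eb ea => <- _ ea; have /negP[] := adjall_notin ha1.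
    by rewrite ea mem_cat mem_head orbT.
  - exists a1, f, b2; rewrite eb; split=> //.
    by move: ha2; rewrite ea /adjall all_cat => /andP[].
(* the letter c is put back at the boundary of a1 and b1 *)
move=> /tr_consP[a1 [b1 [-> ha1 /IH[w1 [w2 [w3 [e hw2]]]]]]].
have [[[|y f] [ea eb]]|[f [ea eb]]] := cat_split e.
- exists (a1 ++ [:: c]), w2, w3; split=> //.
  by rewrite -catA /= -[b1]/([::] ++ b1) -eb ea cats0.
- case: eb ea => <- eb ea.
  have zc : adj z c by rewrite adjC; move: ha1; rewrite ea /adjall all_cat /= => /and3P[].
  have [[[|y' g] [ef eg]]|[g [ef eg]]] := cat_split (esym eb).
  + move: ef eg; rewrite cats0 /= => ef <-.
    exists w1, (f ++ [:: c]), w3; rewrite ea -!catA /=; split=> //.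
    by rewrite /adjall all_cat -/(adjall z f) ef hw2 /= zc.
  + case: eg ef => <- eg ef.
    by exists w1, w2, (g ++ c :: b1); rewrite ea ef -!catA /= -?catA.
  + exists w1, (f ++ c :: g), w3; rewrite ea eg -!catA /= -?catA; split=> //.
    by move: hw2; rewrite ef /adjall !all_cat /= zc.
- by exists (a1 ++ c :: f), w2, w3; rewrite eb -!catA /=.
Qed.

Definition traces_le (n : nat) : seq trace :=
  undup (flatten [seq [seq tr (tval t) | t <- enum {: k.-tuple V}] | k <- iota 0 n.+1]).

Lemma traces_le_uniq n : uniq (traces_le n). Proof. exact: undup_uniq. Qed.

Lemma mem_traces_le n t : (t \in traces_le n) = (tlen t <= n)%N.
Proof.
rewrite mem_undup; apply/flatten_mapP/idP => [[k]|le].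
  by rewrite mem_iota ltnS => /andP[_ le] /mapP[s _ ->]; rewrite tlenE size_tuple.
exists (tlen t); first by rewrite mem_iota ltnS.
by apply/mapP; exists (in_tuple (repr t)); rewrite ?mem_enum // trK.
Qed.

End Traces.

(** * Power series over traces *)

Section Series.
Local Open Scope ring_scope.
Variables (V : finType) (E : rel V).
Local Notation trace := (trace E).
Local Notation tl := (traces_le E).
Local Notation tr := (@tr V E).

(** Rational coefficients, so that p-th roots exist. *)
Definition series : Type := trace -> rat.
HB.instance Definition _ := gen_eqMixin series.
HB.instance Definition _ := gen_choiceMixin series.

Definition szero : series := fun=> 0.
Definition sopp (c : series) : series := fun m => - c m.
Definition sadd (c d : series) : series := fun m => c m + d m.

Fact saddA : associative sadd. Proof. by move=> a b c; apply: funext => m; apply: addrA. Qed.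
Fact saddC : commutative sadd. Proof. by move=> a b; apply: funext => m; apply: addrC. Qed.
Fact sadd0 : left_id szero sadd. Proof. by move=> a; apply: funext => m; apply: add0r. Qed.
Fact saddN : left_inverse szero sopp sadd.
Proof. by move=> a; apply: funext => m; apply: addNr. Qed.

HB.instance Definition _ := GRing.isZmodule.Build series saddA saddC sadd0 saddN.

Definition sone : series := fun m => (m == tr [::])%:R.
Definition smul (c d : series) : series := fun m =>
  \sum_(a <- tl (tlen m)) \sum_(b <- tl (tlen m)) if tmul a b == m then c a * d b else 0.

Lemma sum_traces_le n k (F : trace -> rat) : (k <= n)%N ->
  (forall a, (k < tlen a)%N -> F a = 0) ->
  \sum_(a <- tl n) F a = \sum_(a <- tl k) F a.
Proof.
move=> kn F0; rewrite (bigID (fun a => tlen a <= k)%N) /= [X in _ + X]big1 ?addr0; last first.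
  by move=> a; rewrite -ltnNge => /F0.
rewrite -big_filter; apply: perm_big; apply: uniq_perm.
- by rewrite filter_uniq ?traces_le_uniq.
- exact: traces_le_uniq.
move=> a; rewrite mem_filter !mem_traces_le; case: leqP => //= h.
by rewrite (leq_trans h kn).
Qed.

Lemma sum_traces1 n x (F : trace -> rat) : (tlen x <= n)%N ->
  \sum_(a <- tl n) (if a == x then F a else 0) = F x.
Proof.
move=> xn; rewrite (bigD1_seq x) /= ?mem_traces_le ?traces_le_uniq // eqxx.
by rewrite big1 ?addr0 // => a /negPf->.
Qed.

Lemma smulE n c d m : (tlen m <= n)%N ->
  smul c d m = \sum_(a <- tl n) \sum_(b <- tl n) if tmul a b == m then c a * d b else 0.
Proof.
move=> mn; rewrite (sum_traces_le mn) => [|a ma]; last first.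
  by apply: big1 => b _; case: eqP => // e; move: ma; rewrite -e tlenM ltnNge leq_addr.
apply: eq_bigr => a _; rewrite [RHS](sum_traces_le mn) // => b mb.
by case: eqP => // e; move: mb; rewrite -e tlenM ltnNge leq_addl.
Qed.

Fact smulA : associative smul.
Proof.
move=> c d e; apply: funext => m; set n := tlen m.
transitivity (\sum_(a <- tl n) \sum_(b <- tl n) \sum_(g <- tl n)
    if tmul a (tmul b g) == m then c a * (d b * e g) else 0).
  rewrite (smulE (n := n)) //; apply: eq_bigr => a _.
  transitivity (\sum_(h <- tl n) \sum_(b <- tl n) \sum_(g <- tl n)
      if h == tmul b g then (if tmul a h == m then c a * (d b * e g) else 0) else 0).
    apply: eq_big_seq => h; rewrite mem_traces_le => hn; case: eqP => hm; last first.
      by rewrite big1 // => b _; rewrite big1 // => g _; rewrite if_same.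
    rewrite (smulE _ _ hn) mulr_sumr; apply: eq_bigr => b _.
    rewrite mulr_sumr; apply: eq_bigr => g _; rewrite eq_sym.
    by case: eqP => _; rewrite ?mulr0.
  rewrite exchange_big; apply: eq_bigr => b _.
  rewrite exchange_big; apply: eq_bigr => g _.
  have [le|lt] := leqP (tlen (tmul b g)) n; first exact: sum_traces1.
  rewrite big1_seq => [|h /=]; last first.
    by rewrite mem_traces_le => hn; case: eqP => // eh; move: hn; rewrite eh leqNgt lt.
  case: eqP => // em; move: lt; rewrite /n -em !tlenM ltnNge; case/negP.
  by rewrite leq_addl.
symmetry; rewrite (smulE (n := n)) //.
transitivity (\sum_(h <- tl n) \sum_(g <- tl n) \sum_(a <- tl n) \sum_(b <- tl n)
    if h == tmul a b then (if tmul h g == m then c a * (d b * e g) else 0) else 0).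
  apply: eq_big_seq => h; rewrite mem_traces_le => hn; apply: eq_bigr => g _.
  case: eqP => hm; last first.
    by rewrite big1 // => b _; rewrite big1 // => ? _; rewrite if_same.
  rewrite (smulE _ _ hn) mulr_suml; apply: eq_bigr => a _.
  rewrite mulr_suml; apply: eq_bigr => b _; rewrite eq_sym.
  by case: eqP => _; rewrite ?mul0r // mulrA.
rewrite exchange_big /=; under eq_bigr => g _ do rewrite exchange_big /=.
rewrite exchange_big /=; apply: eq_bigr => a _.
under eq_bigr => g _ do rewrite exchange_big /=.
rewrite exchange_big /=; apply: eq_bigr => b _; apply: eq_bigr => g _.
have [le|lt] := leqP (tlen (tmul a b)) n; first by rewrite sum_traces1 // tmulA.
rewrite big1_seq => [|h /=]; last first.
  by rewrite mem_traces_le => hn; case: eqP => // eh; move: hn; rewrite eh leqNgt lt.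
case: eqP => // em; move: lt; rewrite /n -em tmulA tlenM ltnNge; case/negP.
exact: leq_addr.
Qed.

Fact smul1 : left_id sone smul.
Proof.
move=> c; apply: funext => m; rewrite /smul (bigD1_seq (tr [::])) /=; last first.
- exact: traces_le_uniq.
- by rewrite mem_traces_le tlenE.
rewrite [X in _ + X]big1 ?addr0 => [|a na].
  under eq_bigr => b _ do rewrite tmul1t /sone eqxx mul1r.
  exact: sum_traces1.
by apply: big1 => b _; rewrite /sone (negPf na) mul0r if_same.
Qed.

Fact smulr1 : right_id sone smul.
Proof.
move=> c; apply: funext => m; rewrite /smul exchange_big (bigD1_seq (tr [::])) /=; last first.
- exact: traces_le_uniq.
- by rewrite mem_traces_le tlenE.
rewrite [X in _ + X]big1 ?addr0 => [|a na].
  under eq_bigr => b _ do rewrite tmult1 /sone eqxx mulr1.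
  exact: sum_traces1.
by apply: big1 => b _; rewrite /sone (negPf na) mulr0 if_same.
Qed.

Fact smulDl : left_distributive smul sadd.
Proof.
move=> c d e; apply: funext => m; rewrite /smul /sadd -big_split; apply: eq_bigr => a _ /=.
by rewrite -big_split; apply: eq_bigr => b _ /=; case: ifP; rewrite ?addr0 ?mulrDl.
Qed.

Fact smulDr : right_distributive smul sadd.
Proof.
move=> c d e; apply: funext => m; rewrite /smul /sadd -big_split; apply: eq_bigr => a _ /=.
by rewrite -big_split; apply: eq_bigr => b _ /=; case: ifP; rewrite ?addr0 ?mulrDr.
Qed.

HB.instance Definition _ :=
  GRing.Zmodule_isPzRing.Build series smulA smul1 smulr1 smulDl smulDr.

Lemma serD (c d : series) m : (c + d) m = c m + d m. Proof. by []. Qed.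
Lemma serN (c : series) m : (- c) m = - c m. Proof. by []. Qed.
Lemma serB (c d : series) m : (c - d) m = c m - d m. Proof. by []. Qed.
Lemma ser1 m : (1 : series) m = (m == tr [::])%:R. Proof. by []. Qed.
Lemma serMn (c : series) n m : (c *+ n) m = c m *+ n.
Proof. by elim: n => // n IH; rewrite !mulrS serD IH. Qed.
Lemma serM n (c d : series) m : (tlen m <= n)%N ->
  (c * d) m = \sum_(a <- tl n) \sum_(b <- tl n) if tmul a b == m then c a * d b else 0.
Proof. exact: smulE. Qed.

Lemma serP (c d : series) : (forall m, c m = d m) -> c = d.
Proof. by move=> h; apply: funext. Qed.

Lemma series_closed (P : rat -> Prop) (c d : series) m : P 0 ->
  (forall x y, P x -> P y -> P (x + y)) ->
  (forall a b, tmul a b = m -> P (c a * d b)) -> P ((c * d) m).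
Proof.
move=> P0 PD h; rewrite (serM _ _ (leqnn _)).
apply: (big_ind P) => // a _; apply: (big_ind P) => // b _.
by case: eqP => // /h.
Qed.

Lemma serM_eq0 (c d : series) m :
  (forall a b, tmul a b = m -> c a * d b = 0) -> (c * d) m = 0.
Proof. by apply: (series_closed (P := fun x => x = 0)) => // x y -> ->; rewrite addr0. Qed.

Definition svar (x : V) : series := fun m => (m == tr [:: x])%:R.

Lemma svarE x m : svar x m = (m == tr [:: x])%:R. Proof. by []. Qed.

Lemma svarM x c t : (svar x * c) (tmul (tr [:: x]) t) = c t.
Proof.
set m := tmul _ _; rewrite (serM _ _ (leqnn (tlen m))) (bigD1_seq (tr [:: x])) /=; last first.
- exact: traces_le_uniq.
- by rewrite mem_traces_le /m tlenM leq_addr.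
rewrite [X in _ + X]big1 ?addr0 => [|a na]; last first.
  by apply: big1 => b _; rewrite /svar (negPf na) mul0r if_same.
under eq_bigr => b _ do rewrite (inj_eq (@tmulI _ _ _)) /svar eqxx mul1r.
by rewrite sum_traces1 // /m tlenM leq_addl.
Qed.

Lemma Msvar x c t : (c * svar x) (tmul t (tr [:: x])) = c t.
Proof.
set m := tmul _ _; rewrite (serM _ _ (leqnn (tlen m))) exchange_big.
rewrite (bigD1_seq (tr [:: x])) /=; last first.
- exact: traces_le_uniq.
- by rewrite mem_traces_le /m tlenM leq_addl.
rewrite [X in _ + X]big1 ?addr0 => [|a na]; last first.
  by apply: big1 => b _; rewrite /svar (negPf na) mulr0 if_same.
under eq_bigr => b _ do rewrite (inj_eq (@tImul _ _ _)) /svar eqxx mulr1.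
by rewrite sum_traces1 // /m tlenM leq_addr.
Qed.

Lemma svarM0 x c m : (forall t, m <> tmul (tr [:: x]) t) -> (svar x * c) m = 0.
Proof.
move=> h; apply: serM_eq0 => a b e; rewrite /svar; case: eqP => [ea|]; last by rewrite mul0r.
by case: (h b); rewrite -e ea.
Qed.

Hypothesis Esym : symmetric E.

Lemma svarC x y : E x y -> svar x * svar y = svar y * svar x.
Proof.
have [-> //|nxy] := eqVneq x y; move=> Exy.
have e : tr [:: x; y] = tr [:: y; x].
  by apply: (tr_swap Esym); rewrite /adjall /= /adj nxy Exy.
apply: serP => m; apply/eqP/idP.
have [->|nm] := eqVneq m (tr [:: x; y]).
  by rewrite -{1}(tmulE E [:: x] [:: y]) svarM e -(tmulE E [:: y] [:: x]) svarM /svar !eqxx.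
rewrite !serM_eq0 // => a b eab; rewrite /svar.
  have [ea|] := eqVneq a (tr [:: y]); last by rewrite mul0r.
  have [eb|] := eqVneq b (tr [:: x]); last by rewrite mulr0.
  by move: nm; rewrite -eab ea eb tmulE e eqxx.
have [ea|] := eqVneq a (tr [:: x]); last by rewrite mul0r.
have [eb|] := eqVneq b (tr [:: y]); last by rewrite mulr0.
by move: nm; rewrite -eab ea eb tmulE eqxx.
Qed.

(** ** The length filtration *)

Definition Fil (k : nat) (c : series) : Prop := forall m, (tlen m < k)%N -> c m = 0.

Lemma FilW k l c : (k <= l)%N -> Fil l c -> Fil k c.
Proof. by move=> kl h m /leq_trans/(_ kl)/h. Qed.
Lemma Fil_zero k : Fil k 0. Proof. by []. Qed.
Lemma FilD k c d : Fil k c -> Fil k d -> Fil k (c + d).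
Proof. by move=> hc hd m lm; rewrite serD hc ?hd ?addr0. Qed.
Lemma FilN k c : Fil k c -> Fil k (- c).
Proof. by move=> hc m lm; rewrite serN hc ?oppr0. Qed.
Lemma FilB k c d : Fil k c -> Fil k d -> Fil k (c - d).
Proof. by move=> hc hd; apply: FilD => //; apply: FilN. Qed.
Lemma FilMn k c n : Fil k c -> Fil k (c *+ n).
Proof. by move=> h; elim: n => // n IH; rewrite mulrS; apply: FilD. Qed.
Lemma FilMnI k c n : (0 < n)%N -> Fil k (c *+ n) -> Fil k c.
Proof.
move=> n0 h m /h; rewrite serMn -mulr_natr => /eqP.
by rewrite mulf_eq0 Num.Theory.pnatr_eq0 eqn0Ngt n0 orbF => /eqP.
Qed.

Lemma FilM k l c d : Fil k c -> Fil l d -> Fil (k + l) (c * d).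
Proof.
move=> hc hd m lm; apply: serM_eq0 => a b e.
have [la|ka] := ltnP (tlen a) k; first by rewrite hc ?mul0r.
rewrite (hd b) ?mulr0 //; move: lm; rewrite -e tlenM => lm.
by rewrite -(ltn_add2l k); apply: leq_ltn_trans lm; rewrite leq_add2r.
Qed.

Lemma FilMl k c d : Fil k d -> Fil k (c * d).
Proof. by move=> h; rewrite -[k]add0n; apply: FilM. Qed.
Lemma FilMr k c d : Fil k c -> Fil k (c * d).
Proof. by move=> h; rewrite -[k]addn0; apply: FilM. Qed.

Lemma Fil_eq0 c : (forall k, Fil k c) -> c = 0.
Proof. by move=> h; apply: serP => m; apply: (h (tlen m).+1). Qed.

Lemma Fil_svar x : Fil 1 (svar x).
Proof. by move=> m; rewrite /svar; case: eqP => // ->; rewrite tlenE. Qed.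

(** The series with constant coefficient 1. *)
Definition unip (c : series) : Prop := Fil 1 (c - 1).

Lemma unip1 : unip 1. Proof. by rewrite /unip subrr. Qed.
Lemma unipM c d : unip c -> unip d -> unip (c * d).
Proof.
move=> hc hd; rewrite /unip; have -> : c * d - 1 = (c - 1) * d + (d - 1).
  by rewrite mulrBl mul1r addrA subrK.
by apply: FilD => //; apply: FilMr.
Qed.
Lemma unipX c n : unip c -> unip (c ^+ n).
Proof.
by move=> h; elim: n => [|n IH]; rewrite ?expr0 ?exprS; [apply: unip1 | apply: unipM].
Qed.

Lemma unip_Fil c d k : unip c -> Fil k d -> Fil k.+1 (c * d - d).
Proof. by move=> h hd; rewrite -{2}[d]mul1r -mulrBl -add1n; apply: FilM. Qed.
Lemma Fil_unip c d k : unip c -> Fil k d -> Fil k.+1 (d * c - d).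
Proof. by move=> h hd; rewrite -{2}[d]mulr1 -mulrBr -addn1; apply: FilM. Qed.

(** Coefficientwise limits of sequences whose steps have increasing length. *)
Lemma series_limit (s : nat -> series) : (forall j, Fil j.+1 (s j.+1 - s j)) ->
  exists l, forall j, Fil j.+1 (l - s j).
Proof.
move=> h; exists (fun m => s (tlen m) m) => j m; rewrite ltnS => lm; rewrite serB.
apply/eqP; rewrite subr_eq0; apply/eqP.
elim: j lm => [|j IH]; first by rewrite leqn0 => /eqP->.
rewrite leq_eqVlt => /orP[/eqP->//|lm]; rewrite (IH lm).
by have /eqP := h j m lm; rewrite serB subr_eq0 => /eqP.
Qed.

(** The geometric series. *)
Lemma svar_inv_ex x : exists c, [/\ (1 + svar x) * c = 1, c * (1 + svar x) = 1 & unip c].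
Proof.
have [s [s0 sS]] : exists s : nat -> series,
    s 0%N = 1 /\ forall j, s j.+1 = 1 - svar x * s j.
  by exists (fun j => iter j (fun c => 1 - svar x * c) 1).
have sC j : s j * svar x = svar x * s j.
  elim: j => [|j IH]; first by rewrite s0 mul1r mulr1.
  by rewrite sS mulrBl mulrBr mul1r mulr1 -mulrA IH.
have ds j : Fil j.+1 (s j.+1 - s j).
  elim: j => [|j IH].
    by rewrite sS s0 mulr1 addrAC subrr add0r; apply/FilN/Fil_svar.
  have -> : s j.+2 - s j.+1 = - (svar x * (s j.+1 - s j)).
    by rewrite (sS j.+1) mulrBr {2}(sS j); apply: serP => m; rewrite !(serD, serN); ring.
  by apply: FilN; rewrite -add1n; apply: FilM; first exact: Fil_svar.
have [c hc] := series_limit ds; exists c.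
have eq1 : c = 1 - svar x * c.
  apply/eqP; rewrite -subr_eq0; apply/eqP/Fil_eq0 => k; apply: (FilW (leqW (leqnSn k))).
  have -> : c - (1 - svar x * c) = (c - s k.+1) + svar x * (c - s k).
    by rewrite sS mulrBr; apply: serP => m; rewrite !(serD, serN); ring.
  by apply: FilD; [exact: hc | rewrite -add1n; apply: FilM; [exact: Fil_svar|exact: hc]].
have cC : c * svar x = svar x * c.
  apply/eqP; rewrite -subr_eq0; apply/eqP/Fil_eq0 => k; apply: (@FilW k k.+1) => //.
  have -> : c * svar x - svar x * c = (c - s k) * svar x - svar x * (c - s k).
    by rewrite mulrBl mulrBr sC opprB addrA subrK.
  by apply: FilB; [apply: FilMr|apply: FilMl]; exact: hc.
split.
- by rewrite mulrDl mul1r {1}eq1 subrK.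
- by rewrite mulrDr mulr1 cC {1}eq1 subrK.
- by rewrite /unip {1}eq1 addrAC subrr add0r; apply/FilN/FilMr/Fil_svar.
Qed.

Definition svar_inv x : series := projT1 (cid (svar_inv_ex x)).

Lemma svar_mulV x : (1 + svar x) * svar_inv x = 1.
Proof. by rewrite /svar_inv; case: (cid _) => c []. Qed.
Lemma svar_Vmul x : svar_inv x * (1 + svar x) = 1.
Proof. by rewrite /svar_inv; case: (cid _) => c []. Qed.
Lemma unip_svar_inv x : unip (svar_inv x).
Proof. by rewrite /svar_inv; case: (cid _) => c []. Qed.
Lemma unip_svar x : unip (1 + svar x).
Proof. by rewrite /unip addrAC subrr add0r; apply: Fil_svar. Qed.
Lemma svar_invE x : svar_inv x = 1 - svar x * svar_inv x.
Proof. by rewrite -{1}(svar_mulV x) mulrDl mul1r addrK. Qed.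
End Series.

(** * Roots, supports and integrality of series *)

Section SeriesTheory.
Local Open Scope ring_scope.
Variables (V : finType) (E : rel V).
Local Notation series := (series E).
Local Notation tr := (@tr V E).
Local Notation svar := (@svar V E).
Local Notation svar_inv := (@svar_inv V E).
Implicit Types (c d e : series).

(** ** Roots *)

Lemma unip_add k c e : (0 < k)%N -> unip c -> Fil k e -> unip (c + e).
Proof.
move=> k0 uc he; rewrite /unip addrAC; apply: FilD => //.
exact: FilW k0 he.
Qed.

Lemma pow_add k c e n : (0 < k)%N -> unip c -> Fil k e ->
  Fil k.+1 ((c + e) ^+ n - c ^+ n - e *+ n).
Proof.
move=> k0 uc he; have uce := unip_add k0 uc he.
elim: n => [|n IH]; first by rewrite !expr0 mulr0n subrr subr0; apply: Fil_zero.
have -> : (c + e) ^+ n.+1 - c ^+ n.+1 - e *+ n.+1 =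
    (c + e) * ((c + e) ^+ n - c ^+ n - e *+ n) +
    ((e * c ^+ n - e) + ((c + e) * (e *+ n) - e *+ n)).
  rewrite !exprS mulrSr (mulrDr _ _ (- (e *+ n))) mulrN (mulrDr _ _ (- c ^+ n)) mulrN.
  rewrite (mulrDl _ _ (c ^+ n)); apply: serP => m; rewrite !(serD, serN); ring.
apply: FilD; first exact: FilMl.
apply: FilD; first by apply: Fil_unip => //; apply: unipX.
by apply: unip_Fil => //; apply: FilMn.
Qed.

Lemma root_unique n c d : (0 < n)%N -> unip c -> unip d -> c ^+ n = d ^+ n -> c = d.
Proof.
move=> n0 uc ud ecd; apply/eqP; rewrite eq_sym -subr_eq0; apply/eqP/Fil_eq0; case=> [//|k].
elim: k => [|k IH].
  have -> : d - c = (d - 1) - (c - 1) by apply: serP => m; rewrite !(serD, serN); ring.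
  exact: FilB.
have := pow_add n (ltn0Sn k) uc IH; rewrite [c + _]addrC subrK ecd subrr sub0r.
by move=> /FilN; rewrite opprK; apply: FilMnI.
Qed.

Definition sscale (q : rat) c : series := fun m => q * c m.

(** Newton iteration. *)
Lemma root_ex n (a : series) : (0 < n)%N -> unip a -> exists2 c, unip c & c ^+ n = a.
Proof.
move=> n0 ua.
have [s [s0 sS]] : exists s : nat -> series,
    s 0%N = 1 /\ forall j, s j.+1 = s j + sscale n%:R^-1 (a - s j ^+ n).
  by exists (fun j => iter j (fun c => c + sscale n%:R^-1 (a - c ^+ n)) 1).
have nq : (n%:R : rat) != 0 by rewrite pnatr_eq0 -lt0n.
have h j : unip (s j) /\ Fil j.+1 (a - s j ^+ n).
  elim: j => [|j [us hj]]; first by rewrite s0 expr1n; split; [apply: unip1|].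
  set e := sscale n%:R^-1 (a - s j ^+ n).
  have he : Fil j.+1 e by move=> m lm; rewrite /e /sscale hj ?mulr0.
  have en : e *+ n = a - s j ^+ n.
    by apply: serP => m; rewrite serMn /e /sscale -mulrnAl -[n%:R^-1 *+ n]mulr_natr mulVf // mul1r.
  rewrite sS -/e; split; first exact: unip_add he.
  have := FilN (pow_add n (ltn0Sn j) us he); rewrite en.
  set z := (s j + e) ^+ n.
  by have -> : - (z - s j ^+ n - (a - s j ^+ n)) = a - z;
     [apply: serP => m; rewrite !(serD, serN); ring|].
have [c hc] : exists c, forall j, Fil j.+1 (c - s j).
  apply: series_limit => j; rewrite sS [_ + sscale _ _]addrC addrK => m lm.
  by rewrite /sscale (h j).2 ?mulr0.
have uc : unip c.
  by rewrite /unip; have := hc 0%N; rewrite s0.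
exists c => //; apply/eqP; rewrite -subr_eq0; apply/eqP/Fil_eq0 => k.
apply: (FilW (leqnSn k)).
have -> : c ^+ n - a = (c ^+ n - s k ^+ n - (c - s k) *+ n) + ((c - s k) *+ n - (a - s k ^+ n)).
  by apply: serP => m; rewrite !(serD, serN); ring.
apply: FilD; last by apply: FilB; [apply/FilMn/hc | apply: (h k).2].
have := pow_add n (ltn0Sn k) (h k).1 (hc k); rewrite [s k + _]addrC subrK.
exact: FilW.
Qed.

(** ** Coefficients of length at most one *)

Lemma unip0 c : unip c -> c (tr [::]) = 1.
Proof.
move=> uc; have /eqP := uc (tr [::]) (ltac:(by rewrite tlenE)).
by rewrite serB ser1 eqxx subr_eq0 => /eqP.
Qed.

Lemma unipM_coef1 c d x : unip c -> unip d ->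
  (c * d) (tr [:: x]) = c (tr [:: x]) + d (tr [:: x]).
Proof.
move=> uc ud; have e : c * d = (c - 1) * (d - 1) + (c + (d - 1)).
  rewrite mulrBl mul1r mulrBr mulr1; apply: serP => m; rewrite !(serD, serN); ring.
have n1 : tr [:: x] != tr [::] by apply/eqP => /tr_size.
by rewrite e !serD (FilM uc ud) ?tlenE // add0r serN ser1 (negPf n1) subr0.
Qed.

Lemma unipX_coef1 c n x : unip c -> (c ^+ n) (tr [:: x]) = c (tr [:: x]) *+ n.
Proof.
move=> uc; elim: n => [|n IH].
  by rewrite expr0 ser1; case: eqP => // /tr_size.
by rewrite exprS unipM_coef1 ?IH ?mulrS //; apply: unipX.
Qed.

(** ** Restriction to a set of letters *)

Definition restr (S : {set V}) c : series :=
  fun m => if tsupp m \subset S then c m else 0.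

Lemma restrD S c d : restr S (c + d) = restr S c + restr S d.
Proof. by apply: serP => m; rewrite !serD /restr; case: ifP; rewrite ?addr0. Qed.
Lemma restrN S c : restr S (- c) = - restr S c.
Proof. by apply: serP => m; rewrite !serN /restr; case: ifP; rewrite ?oppr0. Qed.
Lemma restr1 S : restr S 1 = 1.
Proof.
apply: serP => m; rewrite /restr ser1; case: eqP => [->|]; last by rewrite if_same.
have -> // : tsupp (tr [::]) \subset S; by apply/fintype.subsetP => x; rewrite tsuppE.
Qed.
Lemma restrM S c d : restr S (c * d) = restr S c * restr S d.
Proof.
apply: serP => m; rewrite {1}/restr; case: ifP => mS; last first.
  symmetry; apply: serM_eq0 => a b e; rewrite /restr; move: mS; rewrite -e tsuppM finset.subUset.
  by case: (_ \subset S) => /=; rewrite ?mul0r // => ->; rewrite mulr0.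
rewrite !(serM _ _ (leqnn _)); apply: eq_bigr => a _; apply: eq_bigr => b _.
case: eqP => // e; move: mS; rewrite -e tsuppM finset.subUset => /andP[aS bS].
by rewrite /restr aS bS.
Qed.
Lemma restrX S c n : restr S (c ^+ n) = restr S c ^+ n.
Proof. by elim: n => [|n IH]; rewrite ?expr0 ?restr1 // !exprS restrM IH. Qed.
Lemma restr_unip S c : unip c -> unip (restr S c).
Proof.
move=> h; rewrite /unip -(restr1 S) -restrN -restrD => m lm.
by rewrite /restr h ?if_same.
Qed.
Lemma restr_svar S x : restr S (svar x) = if x \in S then svar x else 0.
Proof.
apply: serP => m; rewrite /restr; case: (eqVneq m (tr [:: x])) => [->|nm].
  rewrite /svar eqxx (_ : tsupp (tr [:: x]) = [set x]%SET) ?finset.sub1set.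
    by case: (x \in S); rewrite //= eqxx.
  by apply/setP => y; rewrite tsuppE finset.in_set1 mem_seq1.
by rewrite /svar (negPf nm) if_same; case: ifP; rewrite ?(negPf nm).
Qed.
Lemma restr_svar_inv S x : restr S (svar_inv x) = if x \in S then svar_inv x else 1.
Proof.
have := congr1 (restr S) (svar_Vmul E x); rewrite restrM restrD !restr1 restr_svar.
case: ifP => _; last by rewrite addr0 mulr1.
by move=> /(congr1 (fun c => c * svar_inv x)); rewrite -mulrA svar_mulV mulr1 mul1r.
Qed.
Lemma restr_restr S T c : restr S (restr T c) = restr (S :&: T)%SET c.
Proof.
by apply: serP => m; rewrite /restr finset.subsetI; do 2 case: (_ \subset _).
Qed.

Definition star (x : V) : {set V} := (x |: [set u | adj E x u])%SET.

Hypothesis Esym : symmetric E.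

(** The coefficients of c are invariant when an x is moved from the left end of a
    trace to the right end, and vanish where this is impossible. *)
Lemma svar_centralizer x c : c * svar x = svar x * c -> restr (star x) c = c.
Proof.
move=> cC; have rot w : c (tr (x :: w)) = c (tr (w ++ [:: x])).
  have := congr1 (fun d : series => d (tr (x :: w ++ [:: x]))) cC.
  rewrite -[x :: w ++ _]/((x :: w) ++ [:: x]) -tmulE Msvar => ->.
  by rewrite tmulE -[_ ++ _]/([:: x] ++ (w ++ [:: x])) -tmulE svarM.
have rotn j w : c (tr (nseq j x ++ w)) = c (tr (w ++ nseq j x)).
  elim: j w => [|j IH] w; first by rewrite cats0.
  by rewrite /= rot -catA IH -catA.
have main j w : (forall w', tr w <> tr (x :: w')) -> c (tr (nseq j x ++ w)) <> 0 ->
    adjall E x w.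
  move=> nw; rewrite rotn => nz; have := congr1 (fun d : series => d (tr ((w ++ nseq j x) ++ [:: x]))) cC.
  rewrite -tmulE Msvar tmulE => e.
  have [t et] : exists t, tr ((w ++ nseq j x) ++ [:: x]) = tmul (tr [:: x]) t.
    apply: contrapT => h; case: nz; rewrite e svarM0 // => t et; apply: h; by exists t.
  move: et; rewrite -(trK t) tmulE => /(tr_consP Esym)[a [b [eab ha _]]].
  have [[f [ea _]]|[f [ew ef]]] := cat_split (esym (etrans (catA _ _ _) eab)).
    by move: ha; rewrite ea /adjall all_cat => /andP[].
  case: f ew ef => [|y f] ew; first by rewrite ew cats0.
  by move=> [yx _]; case: (nw (a ++ f)); rewrite ew -yx (tr_move Esym).
have split w : exists j w', tr w = tr (nseq j x ++ w') /\ forall w'', tr w' <> tr (x :: w'').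
  have [n] := ubnP (size w); elim: n w => // n IH w; rewrite ltnS => wn.
  have [[w1 e1]|h] := pselect (exists w', tr w = tr (x :: w')); last first.
    by exists 0%N, w; split=> // w' e; apply: h; exists w'.
  have [|j [w' [e h]]] := IH w1; first by have /= e2 := tr_size e1; move: wn; rewrite e2.
  by exists j.+1, w'; split=> //; rewrite e1; exact: (@tr_cat _ _ [:: x] [:: x] w1 _ (erefl _) e).
apply: serP => m; rewrite /restr; case: ifP => // /negP nS; symmetry.
apply: contrapT => nz; apply: nS; move: nz; rewrite -(trK m).
have [j [w [-> /main h]]] := split (repr m) => /h /allP hw.
apply/fintype.subsetP => y; rewrite tsuppE mem_cat mem_nseq !inE => /orP[/andP[_ ->]//|/hw ->].
by rewrite orbT.
Qed.

(** ** Integrality *)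

Definition sint c : Prop := forall m, c m \is a Num.int.

Lemma sintM c d : sint c -> sint d -> sint (c * d).
Proof.
move=> hc hd m; apply: (series_closed (P := fun q => q \is a Num.int)) => // [x y|a b _].
  exact: rpredD.
by apply: rpredM.
Qed.
Lemma sintB c d : sint c -> sint d -> sint (c - d).
Proof. by move=> hc hd m; rewrite serB; apply: rpredB. Qed.
Lemma sintD c d : sint c -> sint d -> sint (c + d).
Proof. by move=> hc hd m; rewrite serD; apply: rpredD. Qed.
Lemma sint1 : sint 1. Proof. by move=> m; rewrite ser1; apply: rpred_nat. Qed.
Lemma sint_svar x : sint (svar x). Proof. by move=> m; apply: rpred_nat. Qed.
Lemma sint_svar_inv x : sint (svar_inv x).
Proof.
move=> m; have [n] := ubnP (tlen m); elim: n m => // n IH m; rewrite ltnS => mn.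
rewrite svar_invE serB; apply: rpredB; first exact: sint1.
apply: (series_closed (P := fun q => q \is a Num.int)) => // [y z|a b e]; first exact: rpredD.
rewrite {1}svarE; case: eqP => [ea|]; last by rewrite mul0r.
by rewrite mul1r IH //; apply: leq_trans mn; rewrite -e ea tlenM tlenE.
Qed.

(** Let m be a trace of minimal length with nonintegral coefficient. Modulo integers,
    c behaves at m as if it commuted with each x in S, so x can be moved through m
    from the right end to the left end. Hence the letters of m are adjacent to all other
    vertices of S. *)
Lemma sint_normalizer (S : {set V}) c :
  (forall u, u \in S -> exists2 w, w \in S & (w != u) && ~~ adj E u w) ->
  restr S c = c -> unip c ->
  (forall x, x \in S -> exists y, [/\ sint y, Fil 2 (y - 1 - svar x)
    & y * c = c * (1 + svar x)]) ->
  sint c.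
Proof.
move=> noncone cS uc hconj m; have [n] := ubnP (tlen m); elim: n m => // n IH m.
rewrite ltnS leq_eqVlt => /orP[/eqP mn|/IH//].
case: (eqVneq n 0%N) => [n0|n0].
  move: mn; rewrite n0 => /eqP; rewrite tlen_eq0 => /eqP ->; by rewrite unip0.
apply: contrapT => nint.
have mS : tsupp m \subset S.
  apply: contrapT => nS; apply: nint; rewrite -cS /restr; case: ifP => [/nS//|_].
  exact: rpred0.
have key x : x \in S -> exists t, tmul m (tr [:: x]) = tmul (tr [:: x]) t.
  move=> /hconj[y [yint y2 yc]]; apply: contrapT => h; apply: nint.
  rewrite -(Msvar x c m); have -> : c * svar x = svar x * c + (y - 1 - svar x) * c.
    rewrite !mulrBl mul1r yc mulrDr mulr1; apply: serP => k; rewrite !(serD, serN); ring.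
  rewrite serD svarM0 ?add0r => [|t e]; last by apply: h; exists t.
  apply: (series_closed (P := fun q => q \is a Num.int)) => // [a b|a b e]; first exact: rpredD.
  have [lt|le] := ltnP (tlen a) 2; first by rewrite y2 ?mul0r.
  apply: rpredM; first by apply: sintB; [apply: sintB => //; apply: sint1 | apply: sint_svar].
  apply: IH; have := congr1 (@tlen _ E) e; rewrite !tlenM tlenE mn addn1 => e'.
  by rewrite -(ltn_add2l 2) -[(2 + n)%N]/(n.+1.+1) -e' ltnS leq_add2r.
move: mn mS key nint; rewrite -(trK m); move: (repr m) => w; rewrite tlenE => wn wS key _.
have key' x : x \in S -> exists a b, [/\ w ++ [:: x] = a ++ x :: b & adjall E x a].
  move=> /key[t]; rewrite -(trK t) !tmulE => /(tr_consP Esym)[a [b [e ha _]]].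
  by exists a, b.
have adjw x y : x \in S -> y \in w -> x != y -> adj E x y \/
    exists a b, [/\ w = a ++ x :: b, adjall E x a & y \in b].
  move=> xS yw xy; have [a [b [e ha]]] := key' x xS.
  have [[f [ew ef]]|[f [ea eb]]] := cat_split e; last first.
    by left; move/allP: ha; apply; rewrite ea mem_cat yw.
  case: f ew ef => [|z f] ew; first by left; move/allP: ha; apply; rewrite -[a]cats0 -ew.
  move=> [zx _]; move: yw; rewrite ew mem_cat => /orP[ya|]; first by left; apply: (allP ha).
  rewrite -zx inE eq_sym (negPf xy) /= => yf; right.
  by exists a, f; split=> //; rewrite ew zx.
have [u uw] : exists u, u \in w by case: (w) wn n0 => [<-//|u s _ _]; exists u; apply: mem_head.
have uS : u \in S by apply: (fintype.subsetP wS); rewrite tsuppE.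
have [v vS /andP[vu /negP[]]] := noncone u uS.
have inS z : z \in w -> z \in S by move=> zw; apply: (fintype.subsetP wS); rewrite tsuppE.
have [a1|[a [b [ew ha ub]]]] := adjw v u vS uw vu; first by rewrite adjC.
have vw : v \in w by rewrite ew mem_cat mem_head orbT.
have [//|[a' [b' [ew' ha' vb']]]] : adj E u v \/ _ := adjw u v uS vw (ltac:(by rewrite eq_sym)).
(* v precedes u in w, and u precedes v: one of the two prefixes contains the other letter *)
have [[f [ea eb]]|[f [ea eb]]] := cat_split (etrans (esym ew) ew').
  case: f ea eb => [|z f] ea; first by move=> [uv _]; move: vu; rewrite uv eqxx.
  move=> [uz _]; have := ha; rewrite ea /adjall all_cat /= -uz => /and3P[_ + _].
  by rewrite adjC.
case: f ea eb => [|z f] ea; first by move=> [uv _]; move: vu; rewrite uv eqxx.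
by move=> [vz _]; have := ha'; rewrite ea /adjall all_cat /= -vz => /and3P[_ + _].
Qed.

End SeriesTheory.

(** * Homomorphisms out of a right-angled Artin group *)

Section GroupMorph.
Local Open Scope group_scope.
Variables (G H : groupType) (f : G -> H).
Hypothesis fM : {morph f : x y / x * y}.

Lemma hom_one : f 1 = 1.
Proof. by apply: (mulIg (f 1)); rewrite -fM !mul1g. Qed.
Lemma hom_inv x : f x^-1 = (f x)^-1.
Proof. by apply: (mulIg (f x)); rewrite -fM !mulVg hom_one. Qed.
End GroupMorph.

Section Lift.
Local Open Scope quotient_scope.
Variables (V : finType) (E : rel V).
Local Notation A := (raag E).
Local Notation vtx := (vtx E).

Definition rpi (w : word V) : A := \pi_(presented (raag_relation E)) w.

Section MonoidTarget.
Variables (M : Type) (idx : M) (op : Monoid.law idx) (h : V * bool -> M).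

Definition lift (g : A) : M := \big[op/idx]_(a <- repr g) h a.

Hypothesis hV : forall a, op (h a) (h (letter_inv a)) = idx.
Hypothesis hE : forall v w, E v w ->
  op (h (v, false)) (h (w, false)) = op (h (w, false)) (h (v, false)).

Lemma lift_cong u v : pres_cong (raag_relation E) u v ->
  \big[op/idx]_(a <- u) h a = \big[op/idx]_(a <- v) h a.
Proof.
elim=> {u v} //.
- move=> u v [x [y [Exy -> ->]]]; rewrite !big_cons !big_nil !Monoid.mulm1.
  exact: hE.
- by move=> a; rewrite !big_cons !big_nil Monoid.mulm1 hV.
- by move=> u v w _ -> _ ->.
- by move=> u u' v v' _ eu _ ev; rewrite !big_cat eu ev.
Qed.

Lemma lift_pi w : lift (rpi w) = \big[op/idx]_(a <- w) h a.
Proof. exact/lift_cong/pres_reprP. Qed.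

End MonoidTarget.

Local Open Scope group_scope.

Lemma rpiK (g : A) : rpi (repr g) = g. Proof. exact: reprK. Qed.

Lemma rpiM u v : rpi (u ++ v) = rpi u * rpi v.
Proof. by symmetry; apply: pres_mulE. Qed.

Lemma vtxE v : vtx v = rpi [:: (v, false)]. Proof. by []. Qed.
Lemma vtxVE v : (vtx v)^-1 = rpi [:: (v, true)]. Proof. exact: pres_invE. Qed.

Lemma raag_ind (P : A -> Prop) : P 1 -> (forall v g, P g -> P (vtx v * g)) ->
  (forall v g, P g -> P ((vtx v)^-1 * g)) -> forall g, P g.
Proof.
move=> P1 Pv PV g; rewrite -(rpiK g); elim: (repr g) => // -[v b] w IH.
by rewrite -cat1s rpiM; case: b; rewrite -?vtxVE -?vtxE; [apply: PV | apply: Pv].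
Qed.

Lemma vtxC v w : E v w -> vtx v * vtx w = vtx w * vtx v.
Proof. by move=> Evw; rewrite !vtxE -!rpiM; apply/pres_piP/PresRel; exists v, w. Qed.

Lemma raag_hom_eq (G : groupType) (f f' : A -> G) :
  {morph f : x y / x * y} -> {morph f' : x y / x * y} ->
  (forall v, f (vtx v) = f' (vtx v)) -> f =1 f'.
Proof.
move=> fM fM' e; apply: raag_ind => [|v g IH|v g IH].
- by rewrite !hom_one.
- by rewrite fM fM' e IH.
- by rewrite fM fM' !hom_inv // e IH.
Qed.

Section GroupTarget.
Variables (G : groupType) (k : V -> G).

Definition ext : A -> G :=
  lift *%g (fun a : V * bool => if a.2 then (k a.1)^-1 else k a.1).

Hypothesis kE : forall v w, E v w -> k v * k w = k w * k v.

Let kV (a : V * bool) (h := fun a : V * bool => if a.2 then (k a.1)^-1 else k a.1) :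
  h a * h (letter_inv a) = 1.
Proof. by case: a => v [] /=; rewrite /h /= ?mulgV ?mulVg. Qed.

Lemma extM : {morph ext : x y / x * y}.
Proof.
move=> x y; rewrite -(rpiK x) -(rpiK y) -rpiM /ext !lift_pi ?big_cat //; exact: kE.
Qed.

Lemma ext_vtx v : ext (vtx v) = k v.
Proof. by rewrite vtxE /ext lift_pi ?big_seq1 //; exact: kE. Qed.

End GroupTarget.

(** ** Exponent sums *)

Definition eps (u : V) : A -> int := lift +%R
  (fun a : V * bool => if a.1 == u then (if a.2 then -1 else 1)%R else 0%R).

Lemma eps_pi u w : eps u (rpi w) =
  (\sum_(a <- w) if a.1 == u then (if a.2 then -1 else 1) else 0)%R.
Proof.
apply: lift_pi => [[v b]|v w' _]; last exact: addrC.
by case: b; rewrite /letter_inv /=; case: eqP => _ //; rewrite ?addr0 // ?subrr ?addNr.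
Qed.

Lemma epsM u x y : eps u (x * y) = (eps u x + eps u y)%R.
Proof. by rewrite -(rpiK x) -(rpiK y) -rpiM !eps_pi big_cat. Qed.
Lemma eps1 u : eps u 1 = 0%R.
Proof. by rewrite -[1]/(rpi [::]) eps_pi big_nil. Qed.
Lemma epsV u x : eps u x^-1 = (- eps u x)%R.
Proof. by apply/eqP; rewrite -addr_eq0 -epsM mulVg eps1. Qed.
Lemma eps_vtx u v : eps u (vtx v) = (v == u)%:R%R.
Proof. by rewrite vtxE eps_pi big_seq1 /=; case: eqP. Qed.

(** ** Retractions to special subgroups *)

Definition kill (S : {set V}) : A -> A := ext (fun v => if v \in S then vtx v else 1).

Let killE (S : {set V}) v w (k := fun v => if v \in S then vtx v else 1) :
  E v w -> k v * k w = k w * k v.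
Proof.
by move=> Evw; rewrite /k; do 2 case: ifP => _; rewrite ?mulg1 ?mul1g // vtxC.
Qed.

Lemma killM S : {morph kill S : x y / x * y}.
Proof. exact: extM (killE S). Qed.
Lemma kill_vtx S v : kill S (vtx v) = if v \in S then vtx v else 1.
Proof. exact: ext_vtx (killE S) v. Qed.
Lemma kill1 S : kill S 1 = 1. Proof. exact: hom_one (@killM S). Qed.
Lemma killV S x : kill S x^-1 = (kill S x)^-1. Proof. exact: hom_inv (@killM S) x. Qed.

Lemma kill_kill S T x : kill S (kill T x) = kill (S :&: T)%SET x.
Proof.
move: x; apply: raag_hom_eq => [x y|x y|v]; rewrite ?killM // !kill_vtx finset.in_setI.
by case: (v \in T); rewrite ?andbT ?andbF ?kill_vtx // kill1.
Qed.

Lemma kill_sub (S T : {set V}) x : S \subset T -> kill S x = x -> kill T x = x.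
Proof. by move=> /finset.setIidPr ST <-; rewrite kill_kill ST. Qed.

Lemma kill_all x : kill [set: V]%SET x = x.
Proof. by move: x; apply: raag_hom_eq => [x y|x y|v]; rewrite ?killM // kill_vtx finset.in_setT. Qed.

(** ** Syllables *)

Definition zpow (G : groupType) (x : G) (e : int) : G :=
  match e with Posz n => x ^+ n | Negz n => x^-1 ^+ n.+1 end.

Lemma zpowS (G : groupType) (x : G) e : zpow x (e + 1)%R = x * zpow x e.
Proof.
case: e => [n|[|n]]; first by rewrite -PoszD addn1 /= expgS.
  by rewrite /= expg1 mulgV.
have -> : (Negz n.+1 + 1 = Negz n)%R by rewrite !NegzE -[X in (- (Posz X))%R]addn1 PoszD opprD subrK.
by rewrite /= [in RHS]expgS mulVKg.
Qed.

Lemma zpowB1 (G : groupType) (x : G) e : zpow x (e - 1)%R = x^-1 * zpow x e.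
Proof. by rewrite -{2}[e](subrK 1%R) zpowS mulKg. Qed.

Lemma zpowD (G : groupType) (x : G) a b : zpow x (a + b)%R = zpow x a * zpow x b.
Proof.
elim/int_rec: a => [|n IH|n IH].
- by rewrite add0r mul1g.
- by rewrite -[n.+1]addn1 PoszD addrAC zpowS IH mulgA -zpowS.
- by rewrite -[n.+1]addn1 PoszD opprD addrAC zpowB1 IH mulgA -zpowB1.
Qed.

Lemma zpow_commute (G : groupType) (x y : G) e : commute y x -> commute y (zpow x e).
Proof. by case: e => n yx /=; apply: commuteX => //; apply: commuteV. Qed.

Definition syl (s : V * int) : A := zpow (vtx s.1) s.2.
Definition sprod (l : seq (V * int)) : A := \prod_(s <- l) syl s.

Lemma sprod_cons s l : sprod (s :: l) = syl s * sprod l.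
Proof. by rewrite /sprod big_cons. Qed.
Lemma sprod_cat l l' : sprod (l ++ l') = sprod l * sprod l'.
Proof. by rewrite /sprod big_cat. Qed.

Lemma sprod_ex g : exists l, sprod l = g.
Proof.
elim/raag_ind: g => [|v g [l <-]|v g [l <-]].
- by exists [::]; rewrite /sprod big_nil.
- by exists ((v, Posz 1) :: l); rewrite sprod_cons /syl /= expg1.
- by exists ((v, Negz 0) :: l); rewrite sprod_cons /syl /= expg1.
Qed.

Lemma unzip1_split (T U : Type) (l : seq (T * U)) a b : unzip1 l = a ++ b ->
  exists l1 l2, [/\ l = l1 ++ l2, unzip1 l1 = a & unzip1 l2 = b].
Proof.
move=> e; exists (take (size a) l), (drop (size a) l); rewrite cat_take_drop; split=> //.
  by rewrite /unzip1 map_take -/(unzip1 l) e take_size_cat.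
by rewrite /unzip1 map_drop -/(unzip1 l) e drop_size_cat.
Qed.

Lemma unzip1_split2 (T U : Type) (l : seq (T * U)) a z b : unzip1 l = a ++ z :: b ->
  exists l1 e l2, [/\ l = l1 ++ (z, e) :: l2, unzip1 l1 = a & unzip1 l2 = b].
Proof.
move=> /unzip1_split[l1 [[|[z' e] l2] [-> e1 //= [<- e2]]]].
by exists l1, e, l2.
Qed.

Hypothesis Esym : symmetric E.

Lemma adjall_commute z e (l : seq (V * int)) :
  adjall E z (unzip1 l) -> commute (syl (z, e)) (sprod l).
Proof.
elim: l => [|[v a] l IH] /=; first by move=> _; rewrite /sprod big_nil; apply: commute1.
move=> /andP[zv /IH hl]; rewrite sprod_cons; apply: commuteM => //.
rewrite /syl /=; apply: zpow_commute; apply: commute_sym; apply: zpow_commute.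
by apply: vtxC; move: zv; rewrite adjC // => /andP[].
Qed.

Lemma sprod_merge z e e' l1 l2 l3 : adjall E z (unzip1 l2) ->
  sprod (l1 ++ (z, e) :: l2 ++ (z, e') :: l3) = sprod (l1 ++ (z, e + e')%R :: l2 ++ l3).
Proof.
move=> hl; rewrite !(sprod_cat, sprod_cons); congr (_ * _); rewrite /syl /= zpowD.
by rewrite -!mulgA; congr (_ * _); rewrite !mulgA; congr (_ * _); rewrite (adjall_commute e' hl).
Qed.

Definition sqfree (m : trace E) : Prop := forall a z b, m <> tr E (a ++ z :: z :: b).

Lemma sqfreeN w : ~ sqfree (tr E w) ->
  exists w1 z w2 w3, w = w1 ++ z :: w2 ++ z :: w3 /\ adjall E z w2.
Proof.
move=> h; apply: contrapT => h'; apply: h => a z b /(tr_square Esym)[w1 [w2 [w3 hw]]].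
by apply: h'; exists w1, z, w2, w3.
Qed.

(** Merge two syllables or drop one as long as possible. *)
Lemma sprod_reduced g : exists l,
  [/\ sprod l = g, all (fun s => s.2 != 0%R) l & sqfree (tr E (unzip1 l))].
Proof.
have [l0] := sprod_ex g; have [n] := ubnP (size l0); elim: n l0 => // n IH l.
rewrite ltnS => ln lg; have [nz|] := boolP (all (fun s => s.2 != 0%R) l); last first.
  rewrite -has_predC => /hasP[[v e] lv /= /negPn/eqP e0]; move: lv ln lg; rewrite {}e0.
  case/splitPr => l1 l2 ln lg.
  apply: (IH (l1 ++ l2)); first by move: ln; rewrite !size_cat /= addnS.
  by rewrite -lg !sprod_cat sprod_cons /syl /= mul1g.
have [sq|] := pselect (sqfree (tr E (unzip1 l))); first by exists l.
move=> /sqfreeN[w1 [z [w2 [w3 [ew hw]]]]].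
have [l1 [e [l2' [el _ e2]]]] := unzip1_split2 ew.
have [l2 [e' [l3 [el2 e2' _]]]] := unzip1_split2 e2.
apply: (IH (l1 ++ (z, (e + e')%R) :: l2 ++ l3)).
  by move: ln; rewrite el el2 !size_cat /= !size_cat /= !addnS.
by rewrite -lg el el2 sprod_merge // e2'.
Qed.

End Lift.

(** * The Magnus embedding *)

Section Magnus.
Local Open Scope ring_scope.
Variables (V : finType) (E : rel V).
Hypothesis Esym : symmetric E.
Local Notation A := (raag E).
Local Notation vtx := (vtx E).
Local Notation series := (series E).
Local Notation svar := (@svar V E).
Local Notation svar_inv := (@svar_inv V E).
Local Notation tr := (@tr V E).

Definition mu : A -> series := lift *%R
  (fun a : V * bool => if a.2 then svar_inv a.1 else 1 + svar a.1).

Lemma mu_pi w : mu (rpi E w) = \prod_(a <- w) if a.2 then svar_inv a.1 else 1 + svar a.1.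
Proof.
apply: lift_pi => [[v []] /=|v v' Evv' /=]; first exact: svar_Vmul.
  exact: svar_mulV.
by rewrite !mulrDl !mulrDr !mul1r !mulr1 (svarC Esym Evv') addrACA.
Qed.

Lemma muM x y : mu (x * y)%g = mu x * mu y.
Proof. by rewrite -(rpiK x) -(rpiK y) -rpiM !mu_pi big_cat. Qed.
Lemma mu1 : mu 1%g = 1.
Proof. by rewrite -[1%g]/(rpi E [::]) mu_pi big_nil. Qed.
Lemma mu_vtx v : mu (vtx v) = 1 + svar v.
Proof. by rewrite vtxE mu_pi big_seq1. Qed.
Lemma mu_vtxV v : mu (vtx v)^-1%g = svar_inv v.
Proof. by rewrite vtxVE mu_pi big_seq1. Qed.
Lemma mu_mulV x : mu x * mu x^-1%g = 1.
Proof. by rewrite -muM mulgV mu1. Qed.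
Lemma mu_Vmul x : mu x^-1%g * mu x = 1.
Proof. by rewrite -muM mulVg mu1. Qed.

Lemma mu_ind (P : series -> Prop) : P 1 -> (forall c d, P c -> P d -> P (c * d)) ->
  (forall v, P (1 + svar v)) -> (forall v, P (svar_inv v)) -> forall g, P (mu g).
Proof.
move=> P1 PM Pv PV; elim/raag_ind => [|v g IH|v g IH]; first by rewrite mu1.
  by rewrite muM mu_vtx; apply: PM.
by rewrite muM mu_vtxV; apply: PM.
Qed.

Lemma unip_mu g : unip (mu g).
Proof.
apply: mu_ind; [exact: unip1|exact: unipM|exact: unip_svar|exact: unip_svar_inv].
Qed.

Lemma sint_mu g : sint (mu g).
Proof.
apply: mu_ind; [exact: sint1|exact: sintM| |exact: sint_svar_inv].
by move=> v; apply: sintD; [exact: sint1|exact: sint_svar].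
Qed.

Lemma restr_mu S g : restr S (mu g) = mu (kill S g).
Proof.
elim/raag_ind: g => [|v g IH|v g IH]; first by rewrite kill1 mu1 restr1.
  rewrite muM restrM IH killM muM; congr (_ * _); rewrite mu_vtx restrD restr1 restr_svar kill_vtx.
  by case: ifP; rewrite ?mu_vtx // addr0 mu1.
rewrite muM restrM IH killM muM; congr (_ * _); rewrite mu_vtxV restr_svar_inv killV kill_vtx.
by case: ifP; rewrite ?mu_vtxV // invg1 mu1.
Qed.

Lemma mu_coef1 g u : mu g (tr [:: u]) = (eps u g)%:~R.
Proof.
have n0 : (tr [:: u] == tr [::]) = false by apply/eqP => /tr_size.
have n1 v : (tr [:: u] == tr [:: v]) = (v == u).
  by apply/eqP/eqP => [/tr_mem/(_ u)|-> //]; rewrite !inE eqxx eq_sym => /esym/eqP.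
have vt v : mu (vtx v) (tr [:: u]) = (v == u)%:R.
  by rewrite mu_vtx serD ser1 svarE n1 n0 add0r.
elim/raag_ind: g => [|v g IH|v g IH].
- by rewrite mu1 eps1 ser1 n0.
- rewrite muM unipM_coef1 ?epsM ?rmorphD ?IH //=; try exact: unip_mu.
  by rewrite vt eps_vtx; case: eqP.
- rewrite muM unipM_coef1 ?epsM ?rmorphD ?IH //=; try exact: unip_mu.
  congr (_ + _); have := congr1 (fun c : series => c (tr [:: u])) (mu_Vmul (vtx v)).
  rewrite unipM_coef1 ?vt; try exact: unip_mu.
  rewrite ser1 n0 => /eqP; rewrite addr_eq0 => /eqP ->.
  by rewrite epsV eps_vtx rmorphN; case: eqP.
Qed.

(** ** Coefficients at squarefree traces *)

Lemma serMz (c : series) n m : (c *~ n) m = n%:~R * c m.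
Proof.
case: n => n; first by rewrite -[c *~ n]/(c *+ n) serMn -mulr_natl.
rewrite -[c *~ _]/(- (c *+ n.+1)) serN serMn.
by rewrite -[_%:~R]/(- (1 *+ n.+1) : rat) mulNr mulr_natl.
Qed.

(** Modulo squares of variables, the image of v ^ e is 1 + e v. *)
Lemma mu_syl v e :
  exists r, mu (syl E (v, e)) = 1 + svar v *~ e + svar v * svar v * r.
Proof.
set x := svar v; set y := x * x; set i := svar_inv v.
have yz n : x * (x *~ n) = y * (1 *~ n) by rewrite !mulrzAr mulr1.
have xy r : x * (y * r) = y * (x * r) by rewrite /y !mulrA.
have ie : i = 1 - x + y * i.
  by rewrite {1}/i svar_invE -/x -/i {1}/i svar_invE -/x -/i mulrBr mulr1 mulrA opprB addrA addrAC.
rewrite /syl /=; elim/int_rec: e => [|n [r IH]|n [r IH]].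
- by exists 0; rewrite /= mu1 mulr0z mulr0 !addr0.
- exists (r + 1 *~ n + x * r).
  rewrite -[n.+1]addn1 PoszD zpowS muM mu_vtx IH -/x -/y.
  rewrite mulrzDr mulr1z !mulrDl !mulrDr !mul1r !mulr1 yz xy.
  by apply: serP => m; rewrite !serD; ring.
- move: IH; set c := mu _ => IH; have [d ed] : exists d, d = i * c by exists (i * c).
  exists (r - 1 *~ (- Posz n) - x * r + d).
  rewrite -[n.+1]addn1 PoszD opprD zpowB1 muM mu_vtxV -/i -/c -/x.
  have -> : i * c = c - x * c + y * d by rewrite {1}ie mulrDl mulrBl mul1r ed mulrA.
  rewrite [x * c](_ : _ = x + y * (1 *~ (- Posz n)) + y * (x * r)); last first.
    by rewrite IH !mulrDr mulr1 -yz -xy.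
  rewrite {1}IH -/x -/y [x *~ (_ + _)]mulrzDr mulrN1z mulrDr !mulrBr.
  by apply: serP => m; rewrite !(serD, serN); ring.
Qed.

Lemma mu_syl_coef v e (c : series) m : sqfree m ->
  (mu (syl E (v, e)) * c) m = c m + e%:~R * (svar v * c) m.
Proof.
move=> sq; have [r ->] := mu_syl v e; rewrite !mulrDl mul1r !serD mulrzAl serMz.
rewrite [X in _ + X](_ : _ = 0) ?addr0 // -!mulrA; apply: serM_eq0 => a b e1.
rewrite svarE; case: eqP => [ea|]; last by rewrite mul0r.
rewrite mul1r; apply: serM_eq0 => a' b' e2.
rewrite svarE; case: eqP => [ea'|]; last by rewrite mul0r.
case: (sq [::] v (repr b')); rewrite -e1 -e2 ea ea' -{1}(trK b') !tmulE //.
Qed.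

Lemma mu_sprod_high l m : sqfree m -> (size l < tlen m)%N -> mu (sprod E l) m = 0.
Proof.
elim: l m => [|[v e] l IH] m sq /= lm.
  rewrite /sprod big_nil mu1 ser1; case: eqP => // em.
  by move: lm; rewrite em tlenE.
rewrite sprod_cons muM mu_syl_coef // IH ?(ltnW lm) // add0r.
rewrite (_ : (svar v * _) m = 0) ?mulr0 //; apply: serM_eq0 => a b e1.
rewrite svarE; case: eqP => [ea|]; last by rewrite mul0r.
rewrite IH ?mulr0 //; last by move: lm; rewrite -e1 ea tlenM tlenE.
move=> a' z b' eb; apply: (sq (v :: a') z b'); rewrite -e1 ea eb tmulE //.
Qed.

Lemma mu_sprod_top l : sqfree (tr (unzip1 l)) ->
  mu (sprod E l) (tr (unzip1 l)) = \prod_(s <- l) s.2%:~R.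
Proof.
elim: l => [|[v e] l IH] sq /=.
  by rewrite /sprod !big_nil mu1 ser1 eqxx.
rewrite sprod_cons muM mu_syl_coef // mu_sprod_high ?add0r //; last by rewrite tlenE /= size_map.
rewrite big_cons -[_ :: _]/([:: v] ++ unzip1 l) -tmulE svarM IH //.
move=> a z b eb; apply: (sq (v :: a) z b); rewrite /= -[v :: unzip1 l]/([:: v] ++ unzip1 l) -tmulE eb tmulE //.
Qed.

Lemma prod_int_neq0 (l : seq (V * int)) : all (fun s => s.2 != 0) l ->
  \prod_(s <- l) (s.2%:~R : rat) != 0.
Proof.
elim: l => [|s l IH] /=; first by rewrite big_nil oner_neq0.
by move=> /andP[s0 /IH h]; rewrite big_cons mulf_neq0 // intr_eq0.
Qed.

(** A nonempty reduced product of syllables has a nonzero coefficient at the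
    trace of its vertices. *)
Lemma mu_eq1 g : mu g = 1 -> g = 1%g.
Proof.
have [[|s l] [<- nz sq]] := sprod_reduced Esym g; first by rewrite /sprod big_nil.
move=> e; have := prod_int_neq0 nz; rewrite -mu_sprod_top // e ser1.
by rewrite (_ : (tr _ == tr _) = false) ?eqxx //; apply/eqP => /tr_size.
Qed.

Lemma mu_inj : injective mu.
Proof.
move=> x y e; apply/eqP; rewrite -divg_eq1; apply/eqP/mu_eq1.
by rewrite muM e mu_mulV.
Qed.

Lemma kill_restr S g : restr S (mu g) = mu g -> kill S g = g.
Proof. by rewrite restr_mu => /mu_inj. Qed.

End Magnus.

(** * Roots of inner automorphisms acting trivially on homology *)

Section Torsion.
Local Open Scope ring_scope.
Variables (V : finType) (E : rel V).
Hypothesis Esym : symmetric E.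
Local Notation A := (raag E).
Local Notation vtx := (vtx E).
Local Notation series := (series E).
Local Notation svar := (@svar V E).
Local Notation tr := (@tr V E).
Local Notation mu := (@mu V E).
Local Notation muM := (muM Esym).
Local Notation unip_mu := (unip_mu Esym).

Section ConjugationByRoot.
Variables (f : A -> A) (a : A) (b : series) (p : nat).
Hypothesis fM : {morph f : x y / (x * y)%g}.
Hypothesis f_eps : forall u g, eps u (f g) = eps u g.
Hypothesis p_gt0 : (0 < p)%N.
Hypothesis fp : forall g, (iter p f g * a = a * g)%g.
Hypothesis ub : unip b.
Hypothesis bp : b ^+ p = mu a.

(** The failure of f to be conjugation by b. *)
Let d g : series := mu (f g) * b - b * mu g.

Let dM x y : d (x * y)%g = mu (f x) * d y + d x * mu y.
Proof.
rewrite /d fM !muM mulrBl mulrBr !mulrA; apply: serP => m; rewrite !(serD, serN); ring.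
Qed.

Let dD k x y : (forall g, Fil k (d g)) -> Fil k.+1 (d (x * y)%g - (d x + d y)).
Proof.
move=> dk; have -> : d (x * y)%g - (d x + d y) =
    (mu (f x) * d y - d y) + (d x * mu y - d x).
  by rewrite dM; apply: serP => m; rewrite !(serD, serN); ring.
apply: FilD; first by apply: unip_Fil => //; apply: unip_mu.
by apply: Fil_unip => //; apply: unip_mu.
Qed.

(** Modulo longer terms, d is additive, hence factors through the exponent sums. *)
Let d_eps k x y : (forall g, Fil k (d g)) -> (forall u, eps u x = eps u y) ->
  Fil k.+1 (d x - d y).
Proof.
move=> dk exy m mk; rewrite serB.
have dm g h : d (g * h)%g m = d g m + d h m.
  by have /eqP := dD g h dk mk; rewrite serB serD subr_eq0 => /eqP.
have d1 : d 1%g m = 0 by apply: (@addrI _ (d 1%g m)); rewrite -dm mulg1 addr0.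
suff h g : d g m = \sum_u (eps u g)%:~R * d (vtx u) m.
  by rewrite !h (eq_bigr _ (fun u _ => congr1 (fun n : int => n%:~R * _) (exy u))) subrr.
have sum1 v : \sum_u (eps u (vtx v))%:~R * d (vtx u) m = d (vtx v) m.
  rewrite (bigD1 v) //= big1 ?addr0 => [|u uv]; first by rewrite eps_vtx eqxx mul1r.
  by rewrite eps_vtx eq_sym (negPf uv) mul0r.
elim/raag_ind: g => [|v g IH|v g IH].
- by rewrite d1 big1 // => u _; rewrite eps1 mul0r.
- rewrite dm IH -(sum1 v) -big_split; apply: eq_bigr => u _.
  by rewrite /= epsM rmorphD mulrDl.
- have -> : d ((vtx v)^-1 * g)%g m = d g m - d (vtx v) m.
    by have := dm (vtx v) ((vtx v)^-1 * g)%g; rewrite mulVKg => ->; rewrite addrAC subrr add0r.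
  rewrite IH -(sum1 v) -sumrB; apply: eq_bigr => u _.
  by rewrite /= epsM epsV rmorphD rmorphN mulrDl mulNr addrC.
Qed.

Let D n g : series := mu (iter n f g) * b ^+ n - b ^+ n * mu g.

(** To leading order, the failure of f^n to be conjugation by b^n is n d; it is 0
    for n = p, so each leading term of d vanishes. *)
Lemma conj_by_root g : mu (f g) * b = b * mu g.
Proof.
apply/eqP; rewrite -subr_eq0 -/(d g); apply/eqP/Fil_eq0; case=> [//|k].
elim: k g => [|k IH] g.
  have -> : d g = (mu (f g) * b - 1) - (b * mu g - 1).
    by rewrite /d; apply: serP => m; rewrite !(serD, serN); ring.
  by apply: FilB; apply: unipM => //; apply: unip_mu.
have hD n : forall h, Fil k.+2 (D n h - d h *+ n).
  elim: n => [|n IHn] h; first by rewrite /D !expr0 mulr1 mul1r subrr subr0; apply: Fil_zero.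
  have -> : D n.+1 h - d h *+ n.+1 = (D n (f h) - d (f h) *+ n) * b +
      ((d (f h) *+ n * b - d (f h) *+ n) + ((d (f h) - d h) *+ n + (b ^+ n * d h - d h))).
    have -> : D n.+1 h = D n (f h) * b + b ^+ n * d h.
      rewrite /D /d iterSr exprSr mulrBl mulrBr !mulrA.
      by apply: serP => m; rewrite !(serD, serN); ring.
    rewrite [(D _ _ - _) * b]mulrBl [(d (f h) - d h) *+ n]mulrnBl [d h *+ n.+1]mulrS.
    by apply: serP => m; rewrite !(serD, serN); ring.
  apply: FilD; first exact: FilMr.
  apply: FilD; first by apply: Fil_unip => //; apply: FilMn.
  apply: FilD; first by apply: FilMn; apply: d_eps.
  by apply: unip_Fil => //; apply: unipX.
have := hD p g; rewrite {1}/D bp -!muM fp subrr sub0r => /FilN.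
by rewrite opprK; apply: FilMnI.
Qed.

End ConjugationByRoot.

(** The case a = 1, b = 1. *)
Lemma periodic_eq_id (f : A -> A) p : {morph f : x y / (x * y)%g} ->
  (forall u g, eps u (f g) = eps u g) -> (0 < p)%N -> iter p f =1 id -> f =1 id.
Proof.
move=> fM fe p0 fp g; apply: (mu_inj Esym).
have h : forall g, (iter p f g * 1 = 1 * g)%g by move=> g'; rewrite mulg1 mul1g fp.
have := conj_by_root fM fe p0 h (@unip1 _ E) _ g.
by rewrite expr1n (mu1 Esym) mulr1 mul1r; apply.
Qed.

(** ** Conjugates of a vertex in the Magnus ring *)

Definition sinv (c : series) : Prop := exists c', c * c' = 1 /\ c' * c = 1.

Lemma sinv_mu g : sinv (mu g).
Proof. by exists (mu g^-1%g); rewrite (mu_mulV Esym) (mu_Vmul Esym). Qed.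
Lemma sinvM c c' : sinv c -> sinv c' -> sinv (c * c').
Proof.
move=> [u [cu uc]] [v [dv vd]]; exists (v * u).
by rewrite mulrA -[c * c' * v]mulrA dv mulr1 cu mulrA -[v * u * c]mulrA uc mulr1 vd.
Qed.
Lemma sinv_restr S c : sinv c -> sinv (restr S c).
Proof. by move=> [u [cu uc]]; exists (restr S u); rewrite -!restrM cu uc restr1. Qed.
Lemma sinv_Imul c x y : sinv c -> x * c = y * c -> x = y.
Proof.
by move=> [u [cu _]] /(congr1 (fun z => z * u)); rewrite -!mulrA cu !mulr1.
Qed.
Lemma sinv_mulI c x y : sinv c -> c * x = c * y -> x = y.
Proof. by move=> [u [_ uc]] /(congr1 (fun z => u * z)); rewrite !mulrA uc !mul1r. Qed.

Lemma svar_neq0 x : svar x <> 0.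
Proof. by move=> /(congr1 (fun c : series => c (tr [:: x]))); rewrite svarE eqxx. Qed.

Lemma sqfree_coef0 (c c' : series) x m : sqfree m -> (c * (svar x * svar x) * c') m = 0.
Proof.
move=> sq; apply: serM_eq0 => a b e; rewrite [X in X * _](_ : _ = 0) ?mul0r //.
apply: serM_eq0 => a1 a2 ea; rewrite [X in _ * X](_ : _ = 0) ?mulr0 //.
apply: serM_eq0 => y z eyz; rewrite !svarE.
case: eqP => [ey|]; last by rewrite mul0r.
case: eqP => [ez|]; last by rewrite mulr0.
case: (sq (repr a1) x (repr b)).
by rewrite -e -ea -eyz ey ez -{1}(trK a1) -{1}(trK b) !tmulE -catA.
Qed.

Lemma kill_sprod (S : {set V}) l : all (fun s => s.1 \in S) l -> kill S (sprod E l) = sprod E l.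
Proof.
elim: l => [|[v e] l IH] /=; first by rewrite /sprod big_nil kill1.
move=> /andP[vS /IH h]; rewrite !sprod_cons killM h; congr (_ * _)%g.
apply: (kill_restr Esym); rewrite (restr_mu Esym); congr (mu _).
have kv : kill S (vtx v) = vtx v by rewrite kill_vtx vS.
rewrite /syl /=; elim/int_rec: e => [|n IHe|n IHe]; first by rewrite /= kill1.
  by rewrite -[n.+1]addn1 PoszD zpowS killM IHe kv.
by rewrite -[n.+1]addn1 PoszD opprD zpowB1 killM IHe killV kv.
Qed.

Lemma kill_sprod1 (S : {set V}) l : all (fun s => s.1 \notin S) l -> kill S (sprod E l) = 1%g.
Proof.
elim: l => [|[v e] l IH] /=; first by rewrite /sprod big_nil kill1.
move=> /andP[vS /IH h]; rewrite sprod_cons killM h mulg1.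
have kv : kill S (vtx v) = 1%g by rewrite kill_vtx (negPf vS).
rewrite /syl /=; elim/int_rec: e => [|n IHe|n IHe]; first by rewrite /= kill1.
  by rewrite -[n.+1]addn1 PoszD zpowS killM IHe kv mulg1.
by rewrite -[n.+1]addn1 PoszD opprD zpowB1 killM IHe killV kv invg1 mulg1.
Qed.

Lemma eps_zpow u (x : A) e : eps u (zpow x e) = eps u x * e.
Proof.
elim/int_rec: e => [|n IH|n IH]; first by rewrite /= eps1 mulr0.
  by rewrite -[n.+1]addn1 PoszD zpowS epsM IH mulrDr mulr1 addrC.
by rewrite -[n.+1]addn1 PoszD opprD zpowB1 epsM epsV IH mulrDr mulrN1 addrC.
Qed.

Lemma eps_sprod0 u l : all (fun s => s.1 != u) l -> eps u (sprod E l) = 0.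
Proof.
elim: l => [|[v e] l IH] /=; first by rewrite /sprod big_nil eps1.
move=> /andP[vu /IH h]; rewrite sprod_cons epsM h addr0 /syl /= eps_zpow eps_vtx.
by rewrite (negPf vu) mul0r.
Qed.

(** Let h have the fewest syllables among the conjugates of y. As (h - 1)^2 is
    conjugate to the square of the variable x, the coefficients of h^2 and of 2 h - 1 agree
    at squarefree traces. The trace of h h is longer than that of h, so it is not
    squarefree; by minimality h then has a syllable that commutes with all the others.
    Restricting to this letter and to the other letters shows that h = x. *)
Lemma conj_vertex x y (c : series) : unip c -> sinv c ->
  mu y * c = c * mu (vtx x) -> exists g, y = (g * vtx x * g^-1)%g.
Proof.
move=> uc0 ic0 yc0.
pose P n := exists g l, y = (g * sprod E l * g^-1)%g /\ size l = n.
have exP : exists n, `[< P n >].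
  by have [l el] := sprod_ex y; exists (size l); apply/asboolP; exists 1%g, l; rewrite el mul1g invg1 mulg1.
case: (ex_minnP exP) => K /asboolP[g [l [yE lK]]] minK.
have min l' g' : (g * sprod E l * g^-1)%g = (g' * sprod E l' * g'^-1)%g -> (size l <= size l')%N.
  by move=> e; rewrite lK; apply: minK; apply/asboolP; exists g', l'; rewrite yE.
set h := sprod E l in yE min; set d := mu g^-1%g * c.
have ud : unip d by apply: unipM => //; apply: unip_mu.
have id' : sinv d by apply: sinvM => //; apply: sinv_mu.
have hd : mu h * d = d * mu (vtx x).
  rewrite /d -mulrA -yc0 yE mulrA !mulrA -!muM; congr (mu _ * _).
  by rewrite !mulgA mulVg mul1g.
clearbody d.
have nz : all (fun s => s.2 != 0) l.
  apply/negPn/negP; rewrite -has_predC => /hasP[[v e] lv /= /negPn/eqP e0].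
  move: lv min; rewrite /h e0 => /splitPr[l1 l2] /(_ (l1 ++ l2) g).
  rewrite !sprod_cat sprod_cons /syl /= mul1g => /(_ erefl).
  by rewrite !size_cat /= addnS ltnn.
have nomerge a z b e : adjall E z b -> unzip1 l <> a ++ z :: b ++ z :: e.
  move=> zb eu; have [l1 [n [l2' [el _ e2]]]] := unzip1_split2 eu.
  have [l2 [n' [l3 [el2 e2' _]]]] := unzip1_split2 e2.
  have := min (l1 ++ (z, (n + n')%R) :: l2 ++ l3) g.
  rewrite /h el el2 sprod_merge ?e2' // => /(_ erefl).
  by rewrite !size_cat /= !size_cat /= !addnS ltnn.
have noconj a z b e : adjall E z a -> adjall E z e -> unzip1 l <> a ++ z :: b ++ z :: e.
  move=> za ze eu; have [l1 [n [l2' [el e1 e2]]]] := unzip1_split2 eu.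
  have [l2 [n' [l3 [el2 e2' e3]]]] := unzip1_split2 e2.
  pose g' := (g * syl E (z, n))%g; pose l' := l1 ++ l2 ++ l3 ++ [:: (z, (n' + n)%R)].
  have hC : (h = syl E (z, n) * sprod E (l1 ++ l2 ++ l3) * syl E (z, n'))%g.
    have c1 : commute (syl E (z, n)) (sprod E l1) by apply: adjall_commute; rewrite ?e1.
    have c3 : commute (syl E (z, n')) (sprod E l3) by apply: adjall_commute; rewrite ?e3.
    rewrite /h el el2 !sprod_cat !sprod_cons !sprod_cat !sprod_cons -!mulgA -c3.
    by rewrite !mulgA c1.
  have /min : (g * h * g^-1 = g' * sprod E l' * g'^-1)%g.
    rewrite hC /l' /g' !sprod_cat [sprod E [:: _]]/sprod big_seq1 /syl /= zpowD invgM !mulgA.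
    by rewrite mulgK.
  by rewrite /l' el el2 !size_cat /= !size_cat /= addn1 !addnS ltnn.
have sq2 m : sqfree m -> mu (h * h)%g m = mu h m *+ 2 - (1 : series) m.
  move=> sqm; have [d' [dd' _]] := id'.
  have e1 : (mu h - 1) * d = d * svar x.
    by rewrite mulrBl mul1r hd (mu_vtx Esym) mulrDr mulr1 addrAC subrr add0r.
  have e2 : mu (h * h)%g = d * (svar x * svar x) * d' + (mu h *+ 2 - 1).
    have <- : (mu h - 1) * (mu h - 1) = d * (svar x * svar x) * d'.
      transitivity ((mu h - 1) * ((mu h - 1) * (d * d'))); first by rewrite dd' mulr1.
      by rewrite [(_ - 1) * (d * d')]mulrA e1 !mulrA e1.
    rewrite muM mulrBl mul1r mulrBr mulr1 mulr2n.
    by apply: serP => k; rewrite !(serD, serN); ring.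
  by rewrite e2 serD sqfree_coef0 // add0r serB serMn.
have K0 : l <> [::].
  move=> l0; apply: (@svar_neq0 x); move: hd; rewrite /h l0 /sprod big_nil (mu1 Esym) mul1r.
  rewrite (mu_vtx Esym) mulrDr mulr1 => /eqP; rewrite -subr_eq0 opprD addrA subrr sub0r oppr_eq0.
  by move=> /eqP e; apply: (sinv_mulI id'); rewrite e mulr0.
have nsq : ~ sqfree (tr (unzip1 (l ++ l))).
  move=> sq; have := sq2 _ sq; have := mu_sprod_top Esym sq.
  rewrite sprod_cat -/h => ->; rewrite (mu_sprod_high Esym) //; last first.
    by rewrite tlenE size_map size_cat -[X in (X < _)%N]addn0 ltn_add2l lt0n size_eq0; apply/eqP.
  rewrite ser1 (_ : (tr _ == tr _) = false); last first.
    by apply/eqP => /tr_size /=; rewrite size_map size_cat; case: (l) K0.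
  rewrite mul0rn subr0 => /eqP; apply/negP; apply: prod_int_neq0.
  by rewrite all_cat nz.
have [u [z [w [el zu zw]]]] : exists u z w,
    [/\ unzip1 l = u ++ z :: w, adjall E z u & adjall E z w].
  have [w1 [z [w2 [w3 [e zw2]]]]] := sqfreeN Esym nsq.
  rewrite /unzip1 map_cat -!/(unzip1 _) in e.
  have straddle u v : unzip1 l = w1 ++ z :: u -> unzip1 l = v ++ z :: w3 -> w2 = u ++ v ->
      exists u z w, [/\ unzip1 l = u ++ z :: w, adjall E z u & adjall E z w].
    move=> eu ev ew; move: zw2; rewrite ew /adjall all_cat => /andP[zu zv].
    have [[[|z' t] [e1 e2]]|[[|z' t] [e1 e2]]] := cat_split (etrans (esym eu) ev).
    - by exists w1, z, u; split; rewrite // e1 cats0.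
    - case: e2 e1 => <- _ e1; have := noconj v z t u zv zu.
      by rewrite eu e1 -catA; case.
    - by exists v, z, u; split; rewrite // eu e1 cats0.
    - case: e2 e1 => <- _ e1; have /negP[] := adjall_notin zv.
      by rewrite e1 mem_cat mem_head orbT.
  have [[[|z' t] [e1 e2]]|[t [e1 e2]]] := cat_split e.
  - by have := nomerge [::] z w2 w3 zw2; rewrite /= e2; case.
  - case: e2 e1 => <- e2 e1.
    have [[t' [e3 e4]]|[[|z'' t'] [e3 e4]]] := cat_split e2.
    + exact: straddle e1 e4 e3.
    + by apply: (straddle t [::]) => //; rewrite ?e3 ?cats0 //= -e4.
    + case: e4 e3 => <- _ e3; have := nomerge w1 z w2 t' zw2.
      by rewrite e1 e3; case.
  - by have := nomerge t z w2 w3 zw2; rewrite e2; case.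
have [l1 [e [l2 [ell e1 e2]]]] := unzip1_split2 el.
have hE : (h = syl E (z, e) * sprod E (l1 ++ l2))%g.
  by rewrite /h ell !sprod_cat sprod_cons !mulgA (adjall_commute Esym e) // e1.
have offz : all (fun s => s.1 != z) (l1 ++ l2).
  rewrite -(all_map fst (fun v => v != z)) map_cat all_cat -!/(unzip1 _) e1 e2.
  apply/andP; split; apply/allP => v vl; apply/eqP => vz.
    by move: (adjall_notin zu); rewrite -vz vl.
  by move: (adjall_notin zw); rewrite -vz vl.
have e0 : e != 0 by move: nz; rewrite ell all_cat /= => /and3P[].
have zx : z = x.
  apply/eqP; apply: contraNT e0 => zx.
  have := congr1 (restr [set z]%SET) hd; rewrite !restrM (mu_vtx Esym) restrD restr1 restr_svar.
  rewrite finset.in_set1 eq_sym (negPf zx) addr0 mulr1 (restr_mu Esym) -{2}[restr _ d]mul1r.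
  move=> /(sinv_Imul (sinv_restr _ id')) /(mu_eq1 Esym).
  rewrite hE killM [X in (_ * X)%g]kill_sprod1 ?mulg1; last first.
    by apply: sub_all offz => s; rewrite finset.in_set1.
  have := @kill_sprod [set z]%SET [:: (z, e)]; rewrite /sprod big_seq1 /= finset.in_set1 eqxx => -> //.
  move=> /(congr1 (eps z)); rewrite /syl /= eps_zpow eps_vtx eqxx mul1r eps1.
  by move=> ->.
have eps_e : eps x h = e.
  by rewrite hE epsM eps_sprod0 ?addr0 -?zx // /syl /= eps_zpow eps_vtx eqxx mul1r.
have e_1 : e = 1.
  have := congr1 (fun c : series => c (tr [:: x])) hd.
  rewrite !unipM_coef1 //; try exact: unip_mu.
  rewrite (mu_coef1 Esym) addrC eps_e (mu_coef1 Esym) eps_vtx eqxx => /addrI /eqP.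
  by rewrite eqr_int => /eqP.
have h1 : sprod E (l1 ++ l2) = 1%g.
  have := congr1 (restr (~: [set x])%SET) hd; rewrite !restrM (mu_vtx Esym) restrD restr1 restr_svar.
  rewrite finset.in_setC finset.in_set1 eqxx addr0 mulr1 (restr_mu Esym) -{2}[restr _ d]mul1r.
  move=> /(sinv_Imul (sinv_restr _ id')) /(mu_eq1 Esym).
  rewrite hE killM kill_sprod; last first.
    by apply: sub_all offz => s; rewrite finset.in_setC finset.in_set1 zx.
  have := @kill_sprod1 (~: [set x])%SET [:: (z, e)].
  by rewrite /sprod big_seq1 /= finset.in_setC finset.in_set1 zx eqxx => -> //; rewrite mul1g.
by exists g; rewrite yE hE h1 mulg1 /syl /= zx e_1 /= expg1.
Qed.

End Torsion.

(** ** Normalizing series come from the group *)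

Section Normalizer.
Local Open Scope ring_scope.
Variables (V : finType) (E : rel V).
Hypothesis Esym : symmetric E.
Local Notation A := (raag E).
Local Notation vtx := (vtx E).
Local Notation series := (series E).
Local Notation svar := (@svar V E).
Local Notation tr := (@tr V E).
Local Notation mu := (@mu V E).
Local Notation muM := (muM Esym).
Local Notation unip_mu := (unip_mu Esym).

(** The vertices of S commute with x, so the powers of x can be collected. *)
Lemma kill_star (S : {set V}) x g : x \in S -> S \subset star E x ->
  kill S g = (zpow (vtx x) (eps x g) * kill (S :\ x)%SET g)%g.
Proof.
move=> xS Sst; have com e v : v \in (S :\ x)%SET -> commute (zpow (vtx x) e) (vtx v).
  rewrite finset.in_setD1 => /andP[vx /(fintype.subsetP Sst)].
  rewrite finset.in_setU1 (negPf vx) finset.in_set => /andP[_ Exv].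
  by apply: commute_sym; apply: zpow_commute; apply: vtxC; rewrite Esym.
have z1 : zpow (vtx x) 1 = vtx x by rewrite /= expg1.
elim/raag_ind: g => [|v g IH|v g IH].
- by rewrite !kill1 eps1 /= mulg1.
- rewrite !killM epsM IH !kill_vtx eps_vtx finset.in_setD1.
  have [->|vx] /= := eqVneq v x; first by rewrite xS zpowD z1 mul1g mulgA.
  rewrite add0r; case: ifP => vS; last by rewrite !mul1g.
  by rewrite !mulgA com // finset.in_setD1 vx.
- rewrite !killM epsM epsV IH !killV !kill_vtx eps_vtx finset.in_setD1.
  have [->|vx] /= := eqVneq v x.
    by rewrite xS invg1 mul1g [(-1 + _)]addrC zpowB1 mulgA.
  rewrite oppr0 add0r; case: ifP => vS; last by rewrite !invg1 !mul1g.
  rewrite !mulgA; congr (_ * _)%g; apply: commute_sym; apply: commuteV.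
  by apply: com; rewrite finset.in_setD1 vx.
Qed.

Definition normalizes (S : {set V}) (c : series) : Prop :=
  forall g, kill S g = g -> exists2 g', kill S g' = g' & mu g' * c = c * mu g.

Lemma sinv_root (c : series) b p : (0 < p)%N -> c ^+ p = mu b -> sinv c.
Proof.
case: p => // p _ cp.
have r : c * (c ^+ p * mu b^-1%g) = 1 by rewrite mulrA -exprS cp (mu_mulV Esym).
have l : (mu b^-1%g * c ^+ p) * c = 1 by rewrite -mulrA -exprSr cp (mu_Vmul Esym).
have gen (u v : series) : c * u = 1 -> v * c = 1 -> u * c = 1.
  move=> cu vc; transitivity ((v * c) * (u * c)); first by rewrite vc mul1r.
  by rewrite !mulrA -[v * c * u]mulrA cu mulr1 vc.
by exists (c ^+ p * mu b^-1%g); split=> //; apply: gen l.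
Qed.

(** Dividing the normalizing series by a suitable g makes it commute with
    a vertex x; it then lives over the star of x, and splits as a power of x and a
    series over the link of x, to which induction applies. *)
Lemma normalizer_root (S : {set V}) (c : series) b p : (0 < p)%N ->
  restr S c = c -> unip c -> sint c -> kill S b = b -> c ^+ p = mu b ->
  normalizes S c -> exists2 g, kill S g = g & mu g = c.
Proof.
move=> p0; have [n] := ubnP #|S|; elim: n S c b => // n IH S c b.
rewrite ltnS => Sn cS uc ic bS cp nc; have inv := sinv_root p0 cp.
have [S0|[x xS]] := finset.set_0Vmem S.
  exists 1%g; first exact: kill1.
  rewrite (mu1 Esym) -cS; apply: serP => m; rewrite /restr ser1 S0 finset.subset0.
  have -> : (tsupp m == finset.set0) = (m == tr [::]).
    rewrite -(trK m); case: (repr m) => [|y w].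
      by rewrite eqxx; apply/eqP/setP => z; rewrite tsuppE finset.in_set0.
    transitivity false; last by symmetry; apply/eqP => /tr_size.
    apply/eqP => /setP/(_ y); by rewrite tsuppE mem_head finset.in_set0.
  by case: eqP => // ->; rewrite (unip0 uc).
have kx : kill S (vtx x) = vtx x by rewrite kill_vtx xS.
have [y yS yc] := nc _ kx.
have [g yE] := conj_vertex Esym uc inv yc.
pose h := kill S g; have hS : kill S h = h by rewrite /h kill_kill finset.setIid.
have {}yE : y = (h * vtx x * h^-1)%g by rewrite -yS yE !killM killV kx.
pose c1 := mu h^-1%g * c.
have c1S : restr S c1 = c1 by rewrite restrM (restr_mu Esym) killV hS cS.
have uc1 : unip c1 by apply: unipM => //; apply: unip_mu.
have ic1 : sint c1 by apply: sintM => //; apply: (sint_mu Esym).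
have c1x : c1 * svar x = svar x * c1.
  have : c1 * mu (vtx x) = mu (vtx x) * c1.
    rewrite /c1 -mulrA -yc yE !mulrA -!muM; congr (mu _ * _).
    by rewrite !mulgA mulVg mul1g.
  by rewrite (mu_vtx Esym) mulrDr mulrDl mulr1 mul1r => /addrI.
have norm1 : normalizes S c1.
  move=> g1 g1S; have [g2 g2S e] := nc _ g1S; exists (h^-1 * g2 * h)%g.
    by rewrite !killM killV hS g2S.
  by rewrite /c1 !muM !mulrA -[_ * mu h * _]mulrA (mu_mulV Esym) mulr1 -mulrA e mulrA.
have [b1 b1S c1p] : exists2 b1, kill S b1 = b1 & c1 ^+ p = mu b1.
  suff main k : exists2 b1, kill S b1 = b1 & c1 ^+ k = mu b1 * c ^+ k.
    have [b1 b1S e] := main p; exists (b1 * b)%g; first by rewrite killM b1S bS.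
    by rewrite muM e cp.
  elim: k => [|k [b1 b1S IHk]]; first by exists 1%g; rewrite ?kill1 // !expr0 (mu1 Esym) mulr1.
  have [b2 b2S e] := nc _ b1S; exists (h^-1 * b2)%g; first by rewrite killM killV hS b2S.
  by rewrite !exprS IHk /c1 muM !mulrA -[_ * c * mu b1]mulrA -e !mulrA.
have c1E : c1 = mu h^-1%g * c by [].
clearbody c1.
(* S' is the part of S adjacent to x *)
pose S' := ((S :&: star E x) :\ x)%SET.
have xst : x \in (S :&: star E x)%SET.
  by rewrite finset.in_setI xS /star finset.in_setU1 eqxx.
have SS' : S' \subset S.
  by apply: fintype.subset_trans (finset.subsetDl _ _) _; apply: finset.subsetIl.
have S'n : (#|S'| < n)%N.
  apply: leq_trans Sn; apply: fintype.proper_card; rewrite fintype.properE SS' /=.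
  by apply/fintype.subsetPn; exists x; rewrite ?finset.setD11.
have c1st : restr (S :&: star E x)%SET c1 = c1.
  by rewrite -restr_restr (svar_centralizer Esym c1x) c1S.
have b1st : kill (S :&: star E x)%SET b1 = b1.
  by apply: (kill_restr Esym); rewrite -c1p restrX c1st.
pose s := zpow (vtx x); have [t et] : exists t, b1 = (s (eps x b1) * kill S' b1)%g /\ eps x b1 = t *+ p.
  have /intrP[t ct] := ic1 (tr [:: x]); exists t; split.
    by rewrite -{1}b1st (kill_star _ xst) // finset.subsetIr.
  apply/eqP; rewrite -(eqr_int rat) -(mu_coef1 Esym) -c1p unipX_coef1 // ct.
  by rewrite rmorphMn.
case: et => b1E ext.
have cs e : mu (s e) * c1 = c1 * mu (s e).
  have cx : mu (vtx x) * c1 = c1 * mu (vtx x).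
    by rewrite (mu_vtx Esym) mulrDr mulrDl mul1r mulr1 c1x.
  rewrite /s; elim/int_rec: e => [|k IHk|k IHk]; first by rewrite /= (mu1 Esym) mul1r mulr1.
    by rewrite -[k.+1]addn1 PoszD zpowS muM -mulrA IHk mulrA cx mulrA.
  rewrite -[k.+1]addn1 PoszD opprD zpowB1 muM -mulrA IHk !mulrA; congr (_ * _).
  transitivity (mu (vtx x)^-1%g * (c1 * mu (vtx x)) * mu (vtx x)^-1%g).
    by rewrite -!mulrA (mu_mulV Esym) mulr1.
  by rewrite -cx !mulrA (mu_Vmul Esym) mul1r.
pose c2 := mu (s (- t)) * c1.
have uc2 : unip c2 by apply: unipM => //; apply: unip_mu.
have ic2 : sint c2 by apply: sintM => //; apply: (sint_mu Esym).
have c2p : c2 ^+ p = mu (kill S' b1).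
  have ck k : c2 ^+ k = mu (s (- (t *+ k))) * c1 ^+ k.
    elim: k => [|k IHk]; first by rewrite !expr0 mulr0n oppr0 /s /= (mu1 Esym) mulr1.
    rewrite !exprS IHk /c2 mulrS opprD /s zpowD -/s muM !mulrA; congr (_ * _).
    by rewrite -!mulrA cs.
  by rewrite ck -ext c1p {2}b1E -muM mulgA /s -zpowD addNr /= mul1g.
have c2E : c2 = mu (s (- t)) * c1 by [].
clearbody c2.
have b2S' : kill S' (kill S' b1) = kill S' b1 by rewrite kill_kill finset.setIid.
have c2S' : restr S' c2 = c2.
  by apply: (root_unique p0) => //; [apply: restr_unip | rewrite -restrX c2p (restr_mu Esym) b2S'].
have inv2 := sinv_root p0 c2p.
have norm2 : normalizes S' c2.
  move=> g1 g1S'; have [g2 g2S e] := norm1 _ (kill_sub SS' g1S').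
  have e' : mu (s (- t) * g2 * s t)%g * c2 = c2 * mu g1.
    rewrite c2E !muM !mulrA -[_ * mu (s t) * _]mulrA -[mu (s t) * _]muM /s -zpowD subrr /= (mu1 Esym) mulr1.
    by rewrite -!mulrA e.
  exists (kill S' (s (- t) * g2 * s t)%g); first by rewrite kill_kill finset.setIid.
  by have := congr1 (restr S') e'; rewrite !restrM c2S' !(restr_mu Esym) g1S'.
have [d dS' dc] := IH S' c2 _ S'n c2S' uc2 ic2 b2S' c2p norm2.
exists (h * s t * d)%g.
  have kst k : kill S (s k) = s k.
    have := @kill_sprod _ _ Esym S [:: (x, k)]; rewrite /sprod big_seq1 /= xS; exact.
  by rewrite !killM hS kst (kill_sub SS' dS').
rewrite !muM dc c2E c1E !mulrA -[_ * mu (s t) * _]mulrA -[mu (s t) * _]muM /s -zpowD subrr /= (mu1 Esym) mulr1.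
by rewrite (mu_mulV Esym) mul1r.
Qed.

(** Vertices adjacent to all others are central and can be moved to the front. *)
Lemma central_part (S : {set V}) (g : A) : (forall v w, v \notin S -> w != v -> E v w) ->
  exists c, (forall x, commute c x) /\ g = (c * kill S g)%g.
Proof.
move=> cone; have cen v : v \notin S -> forall x : A, commute (vtx v) x.
  move=> vS; elim/raag_ind => [|w g' IH|w g' IH]; first exact: commute1.
    apply: commuteM => //; have [->//|wv] := eqVneq w v; exact/vtxC/cone.
  apply: commuteM => //; apply: commuteV.
  have [->//|wv] := eqVneq w v; exact/vtxC/cone.
elim/raag_ind: g => [|v g [c [cc gE]]|v g [c [cc gE]]].
- by exists 1%g; rewrite kill1 mulg1; split=> // x; apply: commute_sym; apply: commute1.
- rewrite killM kill_vtx; case: ifP => vS.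
    by exists c; split=> //; rewrite mulgA cc -mulgA -gE.
  exists (vtx v * c)%g; split; last by rewrite mul1g -mulgA -gE.
  by move=> x; apply: commute_sym; apply: commuteM; apply: commute_sym => //; apply: cen; rewrite vS.
- rewrite killM killV kill_vtx; case: ifP => vS.
    by exists c; split=> //; rewrite mulgA cc -mulgA -gE.
  exists ((vtx v)^-1 * c)%g; split; last by rewrite invg1 mul1g -mulgA -gE.
  move=> x; apply: commute_sym; apply: commuteM; last by apply: commute_sym.
  by apply: commuteV; apply: commute_sym; apply: cen; rewrite vS.
Qed.

(** The root b of a normalizes A in the Magnus ring. Replacing a by its part away
    from the central vertices makes b integral; it then is an element of A. *)
Lemma inner_of_inner_power (f : A -> A) a p : {morph f : x y / (x * y)%g} ->
  (forall u g, eps u (f g) = eps u g) -> (0 < p)%N ->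
  (forall g, iter p f g = (a * g * a^-1)%g) ->
  exists d, forall g, f g = (d * g * d^-1)%g.
Proof.
move=> fM fe p0 fp; pose S := [set v | [exists w, (w != v) && ~~ adj E v w]]%SET.
have [c [cc aE]] : exists c, (forall x : A, commute c x) /\ a = (c * kill S a)%g.
  apply: central_part => v w; rewrite finset.in_set => /existsPn/(_ w); rewrite negb_and !negbK.
  by move=> /orP[/eqP->|/andP[_ ->] //]; rewrite eqxx.
set a' := kill S a in aE; have a'S : kill S a' = a' by rewrite /a' kill_kill finset.setIid.
clearbody a'.
have fp' g : (iter p f g * a' = a' * g)%g.
  suff -> : iter p f g = (a' * g * a'^-1)%g by rewrite mulgVK.
  rewrite fp aE invgM; transitivity (c * (a' * g * a'^-1) * c^-1)%g; first by rewrite !mulgA.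
  by rewrite cc mulgK.
have [b ub bp] := root_ex p0 (unip_mu a').
have bS : restr S b = b.
  by apply: (root_unique p0) => //; [apply: restr_unip | rewrite -restrX bp (restr_mu Esym) a'S].
have conj := conj_by_root Esym fM fe p0 fp' ub bp.
have ib : sint b.
  apply: (sint_normalizer Esym _ bS ub).
    move=> u; rewrite finset.in_set => /existsP[w /andP[wu nuw]]; exists w; rewrite ?wu //.
    by rewrite finset.in_set; apply/existsP; exists u; rewrite eq_sym wu adjC.
  move=> x _; exists (mu (f (vtx x))); split; first exact: (sint_mu Esym).
    move=> m; rewrite ltnS leq_eqVlt => /orP[/eqP m1|].
      move: m1; rewrite -(trK m) tlenE; case: (repr m) => [|u [|]] // _.
      have n0 : (tr [:: u] == tr [::]) = false by apply/eqP => /tr_size.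
      have e : svar x (tr [:: u]) = (eps u (vtx x))%:~R.
        by rewrite -(mu_coef1 Esym) (mu_vtx Esym) serD ser1 n0 add0r.
      by rewrite !serB (mu_coef1 Esym) fe e ser1 n0 subr0 subrr.
    rewrite ltnS leqn0 tlen_eq0 => /eqP ->; rewrite !serB (unip0 (unip_mu _)) ser1 eqxx subrr.
    by rewrite svarE; case: eqP => // /tr_size.
  by rewrite conj (mu_vtx Esym).
have [d _ db] : exists2 g, kill [set: V]%SET g = g & mu g = b.
  apply: (normalizer_root p0 _ ub ib (kill_all a') bp).
    by apply: serP => m; rewrite /restr finset.subsetT.
  by move=> g _; exists (f g); rewrite ?kill_all // conj.
exists d => g; apply: (mu_inj Esym); rewrite !muM.
have := conj g; rewrite -db => /(congr1 (fun z => z * mu d^-1%g)).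
by rewrite -mulrA (mu_mulV Esym) mulr1.
Qed.

End Normalizer.

(** * Finite p-groups of integral matrices *)

Section Nilpotent.
Local Open Scope ring_scope.

Lemma mxtrace_nilpotent (F : fieldType) n (A : 'M[F]_n.+1) k : A ^+ k = 0 -> \tr A = 0.
Proof.
move=> Ak; pose B := map_mx (@polyC F) A.
have Bk : B ^+ k = 0 by rewrite /B -rmorphXn Ak rmorph0.
have XB : GRing.comm ('X%:M : 'M[{poly F}]_n.+1) B.
  by rewrite /GRing.comm -!mulmxE scalar_mxC.
have := subrXX_comm k XB; rewrite Bk subr0 -rmorphXn /= => /(congr1 determinant).
rewrite det_scalar det_mulmx -exprM -/(char_poly A) => e.
have : char_poly A %| ('X - 0%:P) ^+ (k * n.+1) by rewrite subr0 e dvdp_mulIl.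
case/dvdp_exp_XsubCP => j _; rewrite subr0 eqp_monic ?monicXn ?char_poly_monic // => /eqP eA.
have := size_char_poly A; rewrite eA size_polyXn => -[ej].
have := char_poly_trace A (ltn0Sn n); rewrite eA ej coefXn /= ltn_eqF //= => /eqP.
by rewrite eq_sym oppr_eq0 => /eqP.
Qed.

(** An integral matrix of p-power order is unipotent modulo p. *)
Lemma trace_mod_p p n (A : 'M[int]_n.+1) a : prime p -> A ^+ (p ^ a) = 1 ->
  exists j, Posz n.+1 - \tr A = Posz p * j.
Proof.
move=> pp Ap; pose f := (intr : int -> 'F_p); pose B := map_mx f A.
have Bp : B ^+ (p ^ a) = 1 by rewrite /B -rmorphXn Ap rmorph1.
have chp : p \in [pchar 'M['F_p]_n.+1].
  rewrite inE /= pp -(rmorph_nat (@scalar_mx _ n.+1)) /=.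
  by rewrite pchar_Fp_0 // raddf0.
have frob k : (1 - B) ^+ (p ^ k) = 1 - B ^+ (p ^ k).
  elim: k => [|k IH]; first by rewrite !expr1.
  rewrite expnSr exprM IH [B ^+ (_ * _)]exprM -[LHS](pFrobenius_autE chp).
  by rewrite pFrobenius_autB_comm ?pFrobenius_aut1 //; apply: commr_sym; apply: commr1.
have := frob a; rewrite Bp subrr => /mxtrace_nilpotent; rewrite raddfB /= mxtrace1 => e.
have : f (Posz n.+1 - \tr A) = 0.
  by rewrite /f rmorphB /= -e; congr (_ - _); rewrite -trace_map_mx.
have dv k : k%:R = 0 :> 'F_p -> exists j, k = (p * j)%N.
  move=> /eqP; rewrite -(dvdn_pcharf (pchar_Fp pp)) => /dvdnP[j ->]; exists j; exact: mulnC.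
case: (_ - _) => m.
  by move=> /dv[j ->]; exists (Posz j); rewrite PoszM.
rewrite /f NegzE rmorphN /= => /eqP; rewrite oppr_eq0 => /eqP /dv[j ->].
by exists (- Posz j); rewrite PoszM mulrN.
Qed.

End Nilpotent.

Section SumsOverMultiples.
Local Open Scope ring_scope.

Lemma sum_multiples (R : nmodType) p q (F : nat -> R) : (0 < p)%N ->
  \sum_(0 <= k < p * q | (p %| k)%N) F k = \sum_(0 <= j < q) F (p * j)%N.
Proof.
move=> p0; rewrite -big_filter -(big_map (fun j => p * j)%N xpredT F).
apply: perm_big; apply: uniq_perm.
- by rewrite filter_uniq ?iota_uniq.
- by rewrite map_inj_uniq ?iota_uniq // => i j /eqP; rewrite eqn_pmul2l // => /eqP.
move=> k; rewrite mem_filter mem_index_iota; apply/idP/mapP => [/andP[/dvdnP[j ->]]|[j]].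
  rewrite mulnC ltn_pmul2l // => jq; exists j => //.
  by rewrite mem_index_iota.
by rewrite mem_index_iota => jq ->; rewrite dvdn_mulr // ltn_pmul2l.
Qed.

Lemma sum_root_of_unity (F : fieldType) (z : F) q : z ^+ q = 1 ->
  \sum_(0 <= k < q) z ^+ k = (z == 1)%:R * q%:R.
Proof.
move=> zq; have [->|z1] := eqVneq z 1.
  under eq_bigr => k _ do rewrite expr1n.
  by rewrite big_const_nat subn0 iter_addr_0 mul1r.
have /eqP := subrX1 z q; rewrite zq subrr eq_sym mulf_eq0 subr_eq0 (negPf z1) /=.
by rewrite big_mkord mul0r => /eqP.
Qed.

End SumsOverMultiples.

Section Schur.
Local Open Scope ring_scope.
Variables (gT : finGroupType) (p : nat).
Hypothesis p_pr : prime p.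
Let G := [set: gT]%G.

Definition int_repr n (r : gT -> 'M[int]_n) : Prop :=
  r 1%g = 1%:M /\ forall x y, r (x * y)%g = r x *m r y.

Section OneRepr.
Variables (n : nat) (r : gT -> 'M[int]_n).
Hypothesis rP : int_repr r.

Definition crepr (x : gT) : 'M[algC]_n := map_mx intr (r x).

Lemma crepr_mx_repr : mx_repr G crepr.
Proof.
case: rP => r1 rM; split; first by rewrite /crepr r1 map_mx1.
by move=> x y _ _; rewrite /crepr rM map_mxM.
Qed.

Definition chr : 'CF(G) := cfRepr (MxRepresentation crepr_mx_repr).

Lemma chrE x : chr x = (\tr (r x))%:~R.
Proof. by rewrite cfunE finset.in_setT mulr1n /= /crepr trace_map_mx. Qed.

Lemma chr_char : chr \is a character. Proof. exact: cfRepr_char. Qed.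

Lemma chr1 : chr 1%g = n%:R. Proof. exact: cfRepr1. Qed.

(** The eigenvalues of an element of p-power order give
    (p - 1) chi x = p d0 - d1, where d0 and d1 count the eigenvalues equal to 1
    and the p-th roots of unity among them. *)
Lemma trace_eigenvalues x a : (0 < a)%N -> (x ^+ (p ^ a) = 1)%g ->
  exists d0 d1 : nat, [/\ (d0 <= d1 <= n)%N,
    (Posz p - 1) * \tr (r x) = Posz p * Posz d0 - Posz d1 & d0 = n -> r x = 1%:M].
Proof.
case: a => // a _ xq; set q' := (p ^ a)%N; have qE : (p ^ a.+1 = p * q')%N by rewrite expnS.
have p0 : (0 < p)%N := prime_gt0 p_pr.
have q'0 : (0 < q')%N by rewrite expn_gt0 p0.
have Gx : x \in G by rewrite finset.in_setT.
have [e [[B uB xB] [ex _] [_ _] _]] := repr_rsim_diag (MxRepresentation crepr_mx_repr) Gx.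
have eq i : e 0 i ^+ (p * q') = 1.
  have /dvdnP[k ->] : (#[x]%g %| p * q')%N by rewrite -qE order_dvdn xq.
  by rewrite mulnC exprM ex expr1n.
have eqp i : (e 0 i ^+ p) ^+ q' = 1 by rewrite -exprM eq.
have xk k : crepr (x ^+ k)%g = invmx B *m diag_mx (\row_i e 0 i ^+ k) *m B.
  elim: k => [|k IH].
    rewrite expg0 (proj1 crepr_mx_repr) (_ : \row_i _ = const_mx 1).
      by rewrite diag_const_mx mulmx1 mulVmx.
    by apply/rowP => i; rewrite !mxE expr0.
  rewrite expgSr (proj2 crepr_mx_repr) ?finset.in_setT // IH [crepr x]xB !mulmxA mulmxK //.
  rewrite -[X in X *m B]mulmxA mulmx_diag; congr (_ *m diag_mx _ *m _).
  by apply/rowP => i; rewrite !mxE exprSr.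
have chk k : chr (x ^+ k)%g = \sum_i e 0 i ^+ k.
  rewrite chrE -[LHS]trace_map_mx -/(crepr _) xk -mulmxA mxtrace_mulC -mulmxA mulmxV // mulmx1.
  by rewrite mxtrace_diag; apply: eq_bigr => i _; rewrite mxE.
have chx : chr x = \sum_i e 0 i by rewrite -{1}[x]expg1 chk.
have chc k : ~~ (p %| k)%N -> chr (x ^+ k)%g = chr x.
  move=> pk; have co : coprime k (p * q').
    by rewrite -qE coprime_sym coprime_pexpl // prime_coprime.
  have [u uE] := Qn_aut_exists co.
  rewrite chk; under eq_bigr => i _ do rewrite -uE //.
  by rewrite -rmorph_sum -chx chrE rmorph_int.
pose d0 := #|[set i | e 0 i == 1]%SET|; pose d1 := #|[set i | e 0 i ^+ p == 1]%SET|.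
have key : (p * q')%:R * d0%:R = q'%:R * d1%:R + (\tr (r x))%:~R * ((p * q')%:R - q'%:R) :> algC.
  have card_sum (P : pred 'I_n) : #|[set i | P i]%SET|%:R = \sum_i (P i)%:R :> algC.
    rewrite -sum1_card natr_sum [LHS]big_mkcond; apply: eq_bigr => i _.
    by rewrite finset.in_set; case: (P i).
  transitivity (\sum_(0 <= k < p * q') chr (x ^+ k)%g).
    under eq_bigr => k _ do rewrite chk.
    rewrite exchange_big /= /d0 card_sum mulr_sumr; apply: eq_bigr => i _.
    by rewrite (sum_root_of_unity (eq i)) mulrC.
  rewrite (bigID (fun k => p %| k)%N) /= sum_multiples //; congr (_ + _).
    under eq_bigr => k _ do rewrite chk.
    rewrite exchange_big /= /d1 card_sum mulr_sumr; apply: eq_bigr => i _.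
    under eq_bigr => k _ do rewrite exprM.
    by rewrite (sum_root_of_unity (eqp i)) mulrC.
  rewrite (eq_bigr (fun=> chr x * 1)); last by move=> k pk; rewrite chc // mulr1.
  rewrite -mulr_sumr chrE; congr (_ * _).
  have : \sum_(0 <= k < p * q') (1 : algC) = (p * q')%:R.
    by rewrite big_const_nat subn0 iter_addr_0.
  rewrite (bigID (fun k => p %| k)%N) /= sum_multiples // big_const_nat subn0 iter_addr_0.
  by move=> <-; rewrite addrC addrK.
exists d0, d1; split.
- apply/andP; split; last by apply: leq_trans (max_card _) _; rewrite card_ord.
  apply: subset_leq_card; apply/fintype.subsetP => i; rewrite !finset.in_set => /eqP->.
  by rewrite expr1n.
- apply: (@intr_inj algC); rewrite rmorphM !rmorphB rmorphM /=.
  apply: (mulfI (_ : q'%:R != 0)); first by rewrite pnatr_eq0 -lt0n.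
  move: key; rewrite natrM -!pmulrn => /eqP; rewrite -subr_eq0 => /eqP e0.
  apply/eqP; rewrite -subr_eq0 -oppr_eq0; apply/eqP; rewrite -[RHS]e0; ring.
move=> d0n; have e1 i : e 0 i = 1.
  have : i \in [set i | e 0 i == 1]%SET.
    suff -> : [set i | e 0 i == 1]%SET = [set: 'I_n]%SET by rewrite finset.in_setT.
    by apply/eqP; rewrite eqEcard finset.subsetT cardsT card_ord -/d0 d0n leqnn.
  by rewrite finset.in_set => /eqP.
have : crepr x = 1%:M.
  rewrite -[x]expg1 xk (_ : \row_i _ = const_mx 1); last by apply/rowP => i; rewrite !mxE expr1 e1.
  by rewrite diag_const_mx mulmx1 mulVmx.
move=> /matrixP h; apply/matrixP => i j; have := h i j; rewrite !mxE.
by rewrite -[_%:R]/((Posz (i == j))%:~R) => /intr_inj ->; rewrite natz.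
Qed.

(** The trace is congruent to n modulo p, and the eigenvalue count bounds n - tr x
    by p n / (p - 1); this leaves few possible values. *)
Lemma trace_values x a : (x ^+ (p ^ a) = 1)%g ->
  exists j : nat, [/\ (j <= n %/ (p - 1))%N, \tr (r x) = Posz n - Posz (p * j)
    & j = 0%N -> r x = 1%:M].
Proof.
move=> xa; have p1 : (1 < p)%N := prime_gt1 p_pr.
have [j0 ej0] : exists j, Posz n - \tr (r x) = Posz p * j.
  move: (r) rP => r'; case: (n) r' => [|n'] r' [r1' rM'].
    by exists 0; rewrite mulr0 /mxtrace big_ord0.
  have r1 : r' 1%g = 1 := r1'; apply: (trace_mod_p (a := a)) => //; rewrite -r1 -xa.
  elim: (p ^ a)%N => [|k IH]; first by rewrite expr0 r1.
  by rewrite exprS IH expgS rM'.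
have xa' : (x ^+ (p ^ a.+1) = 1)%g by rewrite expnSr expgnA xa expg1n.
have [d0 [d1 [/andP[d01 d1n] e d0n]]] := trace_eigenvalues (ltn0Sn a) xa'.
have ep : Posz p - 1 = Posz (p - 1) by rewrite -subzn // ltnW.
have e' : Posz (p - 1) * (Posz p * j0) = Posz p * (Posz n - Posz d0) - (Posz n - Posz d1).
  by rewrite -ej0 mulrBr -ep e mulrBl mul1r mulrBr; ring.
have e2 : Posz p * (Posz (p - 1) * j0) = Posz p * (Posz n - Posz d0) - (Posz n - Posz d1).
  by rewrite -e' mulrCA.
have dn : (d0 <= n)%N := leq_trans d01 d1n.
rewrite (subzn dn) (subzn d1n) in e2.
have j0_ge : (0 <= j0).
  have : 0 <= Posz p * (Posz (p - 1) * j0).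
    rewrite e2 -PoszM subr_ge0 lez_nat; apply: leq_trans (leq_pmull _ (ltnW p1)).
    exact: leq_sub2l.
  by rewrite !pmulr_rge0 // ltz_nat ?subn_gt0 // ltnW.
case: j0 ej0 e e2 j0_ge {e'} => // j ej _ e2 _; exists j; split.
- rewrite leq_divRL ?subn_gt0 //; rewrite -(leq_pmul2l (ltnW p1)).
  rewrite -lez_nat !PoszM [Posz j * _]mulrC e2 -PoszM.
  apply: (Order.POrderTheory.le_trans (y := Posz (p * (n - d0)))); first by rewrite lerBlDr lerDl.
  by rewrite -PoszM lez_nat leq_mul2l leq_subr orbT.
- by rewrite PoszM -ej opprB addrCA subrr addr0.
- move=> j_0; apply: d0n; apply/eqP; rewrite eqn_leq dn /= -subn_eq0.
  move: e2; rewrite j_0 !mulr0 => /esym/eqP; rewrite subr_eq0 -PoszM => /eqP[epd].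
  have := leq_sub2l n d01; rewrite -epd; case: (n - d0)%N => // k.
  by rewrite leqNgt -{1}[k.+1]mul1n ltn_pmul2r ?p1.
Qed.

End OneRepr.
End Schur.

Section Bounds.
Local Open Scope ring_scope.
Variables (gT : finGroupType) (p : nat) (I : finType) (n : I -> nat).
Variable r : forall i, gT -> 'M[int]_(n i).
Hypothesis p_pr : prime p.
Hypothesis rP : forall i, int_repr (r i).
Hypothesis faithful : forall x, (forall i, r i x = 1%:M) -> x = 1%g.
Let G := [set: gT]%G.
Let m i := (n i %/ (p - 1))%N.
Let chi i := chr (rP i).

Lemma prim_root_prime (F : fieldType) (z : F) : z ^+ p = 1 -> z != 1 -> p.-primitive_root z.
Proof.
move=> zp z1; have [q prim_q qp] := prim_order_exists (prime_gt0 p_pr) zp.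
have /primeP[_ /(_ q qp)] := p_pr; case/pred2P => [q1|<- //].
by case/eqP: z1; rewrite -[z]expr1 -q1 (prim_expr_order prim_q).
Qed.

(** Schur: the product over i and 0 < j <= m i of the virtual characters
    chi i - (n i - p j) vanishes outside 1, so its value at 1 is a multiple of
    the order of the group. *)
Lemma schur_bound : (p.-group G)%g -> (#|G| %| \prod_i (p ^ m i * (m i)`!))%N.
Proof.
move=> pG; pose z i j := Posz (n i) - Posz (p * j).
pose phi := \prod_i \prod_(j < m i) (chi i - (z i j.+1)%:~R *: 1) : 'CF(G).
have phiE x : phi x = \prod_i \prod_(j < m i) (chi i x - (z i j.+1)%:~R).
  have Gx : x \in G by rewrite finset.in_setT.
  rewrite prod_cfunE //; apply: eq_bigr => i _; rewrite prod_cfunE //; apply: eq_bigr => j _.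
  have sub_cfunE (f g : 'CF(G)) : (f - g) x = f x - g x by rewrite !cfunE.
  have scale_cfunE (u : algC) (f : 'CF(G)) : (u *: f) x = u * f x by rewrite cfunE.
  by rewrite sub_cfunE scale_cfunE cfun1E Gx mulr1.
have phi_vchar : phi \in 'Z[irr G]%g.
  apply: rpred_prod => i _; apply: rpred_prod => j _; apply: rpredB.
    by apply: char_vchar; apply: chr_char.
  by apply: scale_zchar; [rewrite intr_int | apply: cfun1_vchar].
have phi0 x : x != 1%g -> phi x = 0.
  move=> x1; have [i xi] : exists i, r i x <> 1%:M.
    by apply: contrapT => h; case/eqP: x1; apply: faithful => i; apply: contrapT => h'; apply: h; exists i.
  have [a ox] := p_natP (mem_p_elt pG (finset.in_setT x)).
  have xa : (x ^+ (p ^ a) = 1)%g by rewrite -ox expg_order.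
  have [j [jm trx j0]] := trace_values p_pr (rP i) xa.
  case: j jm trx j0 => [_ _ /(_ erefl) //|j jm trx _].
  rewrite phiE (bigD1 i) //= (bigD1 (Ordinal jm)) //= chrE trx subrr.
  by rewrite !mul0r.
have phi1 : phi 1%g = (\prod_i (p ^ m i * (m i)`!))%N%:R.
  rewrite phiE natr_prod; apply: eq_bigr => i _; rewrite chr1.
  have -> : (p ^ m i = \prod_(j < m i) p)%N by rewrite prod_nat_const card_ord.
  rewrite fact_prod big_add1 /= big_mkord -big_split /=.
  rewrite natr_prod; apply: eq_bigr => j _; rewrite /z rmorphB /= opprB addrCA subrr addr0.
  by [].
have : '[phi, 1] \in Num.int by apply: Cint_cfdot_vchar => //; apply: cfun1_vchar.
rewrite cfdotE (bigD1 1%g) ?finset.in_setT //= big1 => [|x /andP[_ x1]]; last first.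
  by rewrite phi0 // mul0r.
rewrite addr0 cfun1E finset.in_setT conjC1 mulr1 phi1; set N := (\prod_i _)%N.
move=> /intrP[k ek]; have : Posz N = Posz #|G| * k.
  apply: (@intr_inj algC); rewrite rmorphM /= -!pmulrn -ek mulrA mulfV ?mul1r //.
  by rewrite pnatr_eq0 -lt0n cardG_gt0.
by move=> /(congr1 absz); rewrite abszM /= => ->; apply: dvdn_mulr.
Qed.

(** The nontrivial constituents of chi i come in families of p - 1 Galois
    conjugates sharing a kernel of index p, and the intersection of all these
    kernels is trivial. *)
Lemma abelem_bound : (forall x : gT, x ^+ p = 1)%g -> abelian G -> (p.-group G)%g ->
  (#|G| <= p ^ (\sum_i m i))%N.
Proof.
move=> xp cGG pG; have p1 := prime_gt1 p_pr; have p0 := prime_gt0 p_pr.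
have lin (i : Iirr G) : 'chi_i \is a linear_char by apply: char_abelianP.
pose S i := [set k in irr_constt (chi i) | k != 0]%SET.
pose K i := [set cfker 'chi_k | k in S i]%SET.
have lin_p (k : Iirr G) x : 'chi_k x ^+ p = 1.
  by rewrite -lin_charX ?finset.in_setT // xp lin_char1.
have ker1 (k : Iirr G) x : (x \in cfker 'chi_k) = ('chi_k x == 1).
  by rewrite cfkerEchar ?irr_char // finset.in_set finset.in_setT lin_char1.
have card_S i : (#|S i| <= n i)%N.
  have chiC := chr_char (rP i); rewrite -(ler_nat algC) -(chr1 (rP i)) -/(chi i).
  rewrite [chi i]cfun_sum_constt sum_cfunE.
  rewrite (eq_bigr (fun k => '[chi i, 'chi_k])); last first.
    by move=> k _; rewrite cfunE lin_char1 ?mulr1.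
  rewrite -sum1_card natr_sum (bigID (fun k => k != 0) (mem (irr_constt (chi i)))) /=.
  rewrite (eq_bigl (fun k => (k \in irr_constt (chi i)) && (k != 0))); last first.
    by move=> k; rewrite finset.in_set.
  apply: ler_wpDr.
    by apply: sumr_ge0 => k _; apply: natr_ge0; apply: Cnat_cfdot_char; rewrite ?irr_char.
  apply: ler_sum => k /andP[kc _].
  have /natrP[c ec] : '[chi i, 'chi_k] \in Num.nat by apply: Cnat_cfdot_char; rewrite ?irr_char.
  by move: kc; rewrite irr_consttE ec pnatr_eq0 ler1n lt0n.
(* the Galois conjugates of a constituent *)
have fiber i H : H \in K i -> (p - 1 <= #|[set k in S i | cfker 'chi_k == H]%SET|)%N.
  move=> /imsetP[k0 k0S ->]; move: (k0S); rewrite finset.in_set => /andP[k0c k00].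
  have [y y1] : exists y, 'chi_k0 y != 1.
    apply: contrapT => h; move: k00; rewrite -irr_eq1 => /eqP; apply.
    apply/cfun_inP => y _; rewrite cfun1E finset.in_setT; apply/eqP/negPn/negP => h'.
    by apply: h; exists y.
  have prim_q := prim_root_prime (lin_p k0 y) y1.
  have u_ex (j : 'I_(p - 1)) : {u : {rmorphism algC -> algC} | forall z, z ^+ p = 1 -> u z = z ^+ j.+1}.
    apply: Qn_aut_exists; rewrite coprime_sym prime_coprime // gtnNdvd //.
    by have := ltn_ord j; rewrite ltn_subRL add1n.
  pose h j := aut_Iirr (projT1 (u_ex j)) k0.
  have hE j x : 'chi_(h j) x = 'chi_k0 x ^+ j.+1.
    by rewrite aut_IirrE cfunE (projT2 (u_ex j)).
  have h_inj : injective h.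
    move=> j j' /(congr1 (fun k => 'chi_k y)); rewrite !hE => /eqP.
    rewrite (eq_prim_root_expr prim_q) !modn_small.
    - by rewrite eqSS => /eqP /val_inj.
    - by have := ltn_ord j'; rewrite ltn_subRL add1n.
    - by have := ltn_ord j; rewrite ltn_subRL add1n.
  rewrite -{1}[(p - 1)%N]card_ord -(card_imset _ h_inj); apply: subset_leq_card.
  apply/fintype.subsetP => _ /imsetP[j _ ->]; rewrite !finset.in_set aut_Iirr_eq0 k00 andbT.
  apply/andP; split.
    rewrite irr_consttE; have -> : chi i = cfAut (projT1 (u_ex j)) (chi i).
      by apply/cfunP => x; rewrite [RHS]cfunE /chi chrE rmorph_int.
    by rewrite /h aut_IirrE cfdot_aut_irr fmorph_eq0 -irr_consttE.
  apply/eqP/setP => x; rewrite !ker1 hE; apply/eqP/eqP => [xj|->]; last by rewrite expr1n.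
  apply/eqP/negPn/negP => x1; have := prim_order_dvd (prim_root_prime (lin_p k0 x) x1) j.+1.
  rewrite xj eqxx gtnNdvd //; have := ltn_ord j; by rewrite ltn_subRL add1n.
have card_K i : (#|K i| <= m i)%N.
  rewrite leq_divRL ?subn_gt0 //; apply: leq_trans (card_S i).
  rewrite -[#|S i|]sum1_card (partition_big_imset (fun k => cfker 'chi_k)) /= -/(K i).
  rewrite -sum_nat_const; apply: leq_sum => H HK; apply: leq_trans (fiber i H HK) _.
  rewrite -sum1_card; apply/eq_leq/eq_bigl => k; by rewrite !finset.in_set.
pose c H : Iirr G := odflt 0 [pick k | cfker 'chi_k == H].
have cK i H : H \in K i -> cfker 'chi_(c H) = H.
  move=> /imsetP[k _ ->]; rewrite /c; case: pickP => [k' /eqP //|/(_ k)].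
  by rewrite eqxx.
pose l := flatten [seq [seq c H | H <- enum (K i)] | i <- enum I].
have size_l : (size l <= \sum_i m i)%N.
  rewrite size_flatten /shape -map_comp sumnE big_map big_enum /=.
  by apply: leq_sum => i _; rewrite /= size_map -cardE.
have sep x : (forall k, k \in l -> 'chi_k x = 1) -> x = 1%g.
  move=> xl; apply: faithful => i; have [a ox] := p_natP (mem_p_elt pG (finset.in_setT x)).
  have xa : (x ^+ (p ^ a) = 1)%g by rewrite -ox expg_order.
  have [j [jm trx j0]] := trace_values p_pr (rP i) xa; apply: j0.
  have : x \in cfker (chi i).
    rewrite cfkerE ?chr_char // finset.in_setI finset.in_setT; apply/bigcapP => k kc.
    have [->|k0] := eqVneq k 0; first by rewrite cfker_irr0 finset.in_setT.
    have kK : cfker 'chi_k \in K i by apply: imset_f; rewrite finset.in_set kc.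
    rewrite -(cK _ _ kK) ker1; apply/eqP/xl/flatten_mapP; exists i; rewrite ?mem_enum //.
    by apply: map_f; rewrite mem_enum.
  rewrite cfkerEchar ?chr_char // finset.in_set finset.in_setT /= chr1 /chi chrE trx.
  rewrite -[_%:R]/((Posz (n i))%:~R) eqr_int -subr_eq0 addrAC subrr sub0r oppr_eq0.
  by rewrite eqz_nat muln_eq0 -leqn0 leqNgt p0 /= => /eqP.
have [z prim_z] := C_prim_root_exists p0.
pose g (x : gT) := [ffun j : 'I_(size l) => projT1 (prim_rootP prim_z (lin_p (l`_j) x))].
have gE x (j : 'I_(size l)) : 'chi_(l`_j) x = z ^+ (g x j).
  by rewrite ffunE; case: (prim_rootP _ _).
have g_inj : injective g.
  move=> x y e; apply/eqP; rewrite eq_mulgV1; apply/eqP/sep => k kl.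
  rewrite lin_charM ?finset.in_setT // lin_charV ?finset.in_setT //.
  rewrite -(nth_index 0 kl); have kj : (index k l < size l)%N by rewrite index_mem.
  rewrite -[index k l]/(nat_of_ord (Ordinal kj)) !gE e -gE divff //.
  by rewrite lin_char_neq0 ?finset.in_setT.
apply: leq_trans (_ : p ^ size l <= _)%N; last by rewrite leq_exp2l.
have -> : #|G| = #|gT| by apply: cardsT.
by apply: leq_trans (leq_card _ g_inj) _; rewrite card_ffun !card_ord.
Qed.

End Bounds.

(** * Finite subgroups of an arbitrary group *)

Section FiniteSubgroups.
Local Open Scope group_scope.

(** A finite subgroup with an enumeration of its elements, from which the indices
    inherit a finGroupType structure. *)
Record finsub (G : groupType) := FinSub {
  fs_n : nat;
  fs_f : 'I_fs_n -> G;
  fs_inj : injective fs_f;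
  fs_1 : exists i, fs_f i = 1;
  fs_M : forall i j, exists k, fs_f k = fs_f i * fs_f j;
  fs_V : forall i, exists j, fs_f j = (fs_f i)^-1
}.

Section Structure.
Variables (G : groupType) (S : finsub G).

Definition fsT : Type := 'I_(fs_n S).
HB.instance Definition _ := Finite.on fsT.
Definition fs_val : fsT -> G := @fs_f G S.

Definition fs_one : fsT := projT1 (cid (fs_1 S)).
Definition fs_mul (i j : fsT) : fsT := projT1 (cid (fs_M i j)).
Definition fs_inv (i : fsT) : fsT := projT1 (cid (fs_V i)).

Lemma fs_oneE : fs_val fs_one = 1. Proof. exact: projT2 (cid (fs_1 S)). Qed.
Lemma fs_mulE i j : fs_val (fs_mul i j) = fs_val i * fs_val j.
Proof. exact: projT2 (cid (fs_M i j)). Qed.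
Lemma fs_invE i : fs_val (fs_inv i) = (fs_val i)^-1.
Proof. exact: projT2 (cid (fs_V i)). Qed.
Lemma fs_val_inj : injective fs_val. Proof. exact: fs_inj. Qed.

Fact fs_mulA : associative fs_mul.
Proof. by move=> i j k; apply: fs_val_inj; rewrite !fs_mulE mulgA. Qed.
Fact fs_mul1 : left_id fs_one fs_mul.
Proof. by move=> i; apply: fs_val_inj; rewrite fs_mulE fs_oneE mul1g. Qed.
Fact fs_mulV : left_inverse fs_one fs_inv fs_mul.
Proof. by move=> i; apply: fs_val_inj; rewrite fs_mulE fs_invE fs_oneE mulVg. Qed.

HB.instance Definition _ := Finite_isGroup.Build fsT fs_mulA fs_mul1 fs_mulV.

Lemma fs_valM (i j : fsT) : fs_val (i * j) = fs_val i * fs_val j.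
Proof. exact: fs_mulE. Qed.
Lemma fs_val1 : fs_val 1 = 1. Proof. exact: fs_oneE. Qed.

End Structure.

Lemma finsub_of_pred (G : groupType) n :
  has_subgroup_of_order G n -> exists S : finsub G, fs_n S = n.
Proof.
move=> [H [clH /card_set_bijP[h [hI hinj hsurj]]]].
have ex (i : 'I_n) : exists x, x \in H /\ h x = i.
  by have [x xH hx] := hsurj i (ltn_ord i); exists x.
pose f i := projT1 (cid (ex i)).
have fH i : f i \in H by rewrite /f; case: (cid _) => x [].
have hf i : h (f i) = i :> nat by rewrite /f; case: (cid _) => x [].
have onto x : x \in H -> exists i, f i = x.
  move=> xH; have hx : (h x < n)%N by apply: hI.
  exists (Ordinal hx); apply: hinj; rewrite ?inE //= ?hf.
have finj : injective f by move=> i j e; apply: val_inj; rewrite /= -!hf e.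
unshelve eexists; first apply: (@FinSub G n f finj).
- by apply: onto; case: clH.
- by move=> i j; apply: onto; apply: (group_closedM clH).
- by move=> i; apply: onto; apply: (group_closedV clH).
by [].
Qed.

Lemma has_subgroup_of_finGroup (gT : finGroupType) (P : {group gT}) (G : groupType)
    (F : gT -> G) : {in P &, {morph F : x y / x * y}} -> {in P &, injective F} ->
  has_subgroup_of_order G #|P|.
Proof.
move=> FM Finj.
have F1 : F 1 = 1 by apply: (mulIg (F 1)); rewrite -FM ?group1 // !mul1g.
have FV x : x \in P -> F x^-1 = (F x)^-1.
  by move=> xP; apply: (mulIg (F x)); rewrite -FM ?groupV // !mulVg F1.
pose H : {pred G} := fun y => `[< exists2 x, x \in P & F x = y >].
exists H; split.
  split; first by apply/asboolP; exists 1; rewrite ?group1.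
  move=> _ _ /asboolP[x xP <-] /asboolP[y yP <-]; apply/asboolP.
  by exists (x * y^-1); rewrite ?groupM ?groupV // FM ?groupV // FV.
pose g y := match pselect (exists2 x, x \in P & F x = y) with
  | left h => index (s2val (cid2 h)) (enum P) | right _ => 0%N end.
have gF x : x \in P -> g (F x) = index x (enum P).
  move=> xP; rewrite /g; case: pselect => [h|[]]; last by exists x.
  by case: (cid2 h) => x' /= x'P e; rewrite (Finj _ _ x'P xP e).
apply/card_set_bijP; exists g; split.
- move=> y /asboolP[x xP <-]; rewrite /= gF // cardE index_mem mem_enum //.
- move=> y y'; rewrite !inE => /asboolP[x xP <-] /asboolP[x' xP' <-].
  by rewrite !gF // => e; congr F; rewrite -(nth_index 1 (s := enum P) (x := x)) ?mem_enum // e nth_index ?mem_enum.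
- move=> k /= kP; rewrite cardE in kP.
  have xP : nth 1 (enum P) k \in P by rewrite -mem_enum mem_nth.
  exists (F (nth 1 (enum P) k)); first by apply/asboolP; exists (nth 1 (enum P) k).
  by rewrite gF // index_uniq ?enum_uniq.
Qed.

End FiniteSubgroups.

Section UpperBounds.
Local Open Scope group_scope.
Variables (G : groupType) (p : nat) (I : finType) (n : I -> nat).
Variable r : forall i, G -> 'M[int]_(n i).
Hypothesis p_pr : prime p.
Hypothesis r1 : forall i, r i 1 = (1%:M)%R.
Hypothesis rM : forall i x y, r i (x * y) = (r i x *m r i y)%R.
Hypothesis p_torsion : forall g, g ^+ p = 1 -> (forall i, r i g = (1%:M)%R) -> g = 1.
Let m i := (n i %/ (p - 1))%N.

Section OneSubgroup.
Variables (S : finsub G) (t : nat).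
Hypothesis cardS : fs_n S = (p ^ t)%N.
Let rS i (x : fsT S) := r i (fs_val x).

Let fs_X (x : fsT S) k : fs_val (x ^+ k) = fs_val x ^+ k.
Proof. by elim: k => [|k IH]; rewrite ?expg0 ?fs_val1 // !expgS fs_valM IH. Qed.

Lemma fs_pgroup : p.-group [set: fsT S].
Proof. by rewrite /pgroup cardsT card_ord cardS pnatX pnat_id ?orbT. Qed.

Lemma fs_repr i : int_repr (rS i).
Proof. by split=> [|x y]; rewrite /rS ?fs_val1 ?fs_valM. Qed.

Lemma fs_faithful x : (forall i, rS i x = (1%:M)%R) -> x = 1.
Proof.
move=> rx; have [k ox] := p_natP (mem_p_elt fs_pgroup (finset.in_setT x)).
case: k ox => [/eqP|k ox]; first by rewrite order_eq1 => /eqP.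
have rX l i : rS i (x ^+ l) = (1%:M)%R.
  elim: l => [|l IH]; first by rewrite expg0 (proj1 (fs_repr i)).
  by rewrite expgS (proj2 (fs_repr i)) IH rx mulmx1.
have : x ^+ (p ^ k) = 1.
  apply: fs_val_inj; rewrite fs_val1; apply: p_torsion => [|i]; last exact: rX.
  by rewrite -fs_X -expgnA -expnSr -ox expg_order fs_val1.
move=> /eqP; rewrite -order_dvdn ox pfactor_dvdn ?expn_gt0 ?prime_gt0 //.
by rewrite pfactorK // ltnn.
Qed.

Lemma subgroup_bound : (t <= \sum_i (m i + logn p (m i)`!))%N.
Proof.
have := schur_bound p_pr fs_repr fs_faithful fs_pgroup.
have pos i : (0 < p ^ m i * (m i)`!)%N by rewrite muln_gt0 expn_gt0 prime_gt0 //= fact_gt0.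
rewrite /= cardsT card_ord cardS pfactor_dvdn //; last by apply: prodn_gt0.
move=> /leq_trans; apply; apply: eq_leq.
suff [_ ->] : (0 < \prod_i (p ^ m i * (m i)`!))%N /\
    (logn p (\prod_i (p ^ m i * (m i)`!)) = \sum_i (m i + logn p (m i)`!))%N.
  by [].
apply: (big_ind2 (fun x y => (0 < x)%N /\ logn p x = y)) => [|x1 x2 y1 y2 [x10 <-] [y10 <-]|i _].
- by rewrite logn1.
- by rewrite muln_gt0 x10 y10 lognM.
- rewrite pos; split=> //.
  by rewrite lognM ?fact_gt0 ?expn_gt0 ?(prime_gt0 p_pr) // (pfactorK _ p_pr).
Qed.

Lemma elementary_bound : (forall x : fsT S, x ^+ p = 1) ->
  abelian [set: fsT S] -> (t <= \sum_i m i)%N.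
Proof.
move=> xp ab; have := abelem_bound p_pr fs_repr fs_faithful xp ab fs_pgroup.
by rewrite /= cardsT card_ord cardS leq_exp2l // prime_gt1.
Qed.

End OneSubgroup.

Lemma nu_upper t : has_subgroup_of_order G (p ^ t) ->
  (t <= \sum_i (m i + logn p (m i)`!))%N.
Proof. by move=> /finsub_of_pred[S] /subgroup_bound. Qed.

Lemma rank_upper t : Zp_power_embeds p t G -> (t <= \sum_i m i)%N.
Proof.
move=> [f [finj fM]]; pose T := {ffun 'I_t -> 'Z_p}.
have cardT : #|T| = (p ^ t)%N by rewrite card_ffun card_ord Zp_cast ?prime_gt1 // card_ord.
have f1 : f 0%R = 1 by apply: (mulIg (f 0%R)); rewrite -fM addr0 mul1g.
pose e (i : 'I_#|T|) := f (enum_val i).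
have onto x : exists i, e i = f x by exists (enum_rank x); rewrite /e enum_rankK.
have einj : injective e by move=> i j /finj/enum_val_inj.
have e1 : exists i, e i = 1 by rewrite -f1.
have eM i j : exists k, e k = e i * e j by rewrite /e -fM.
have eV i : exists j, e j = (e i)^-1.
  have [j ej] := onto (- enum_val i)%R; exists j; rewrite ej.
  by apply: (mulIg (e i)); rewrite mulVg /e -fM addNr f1.
pose S := FinSub einj e1 eM eV.
apply: (@elementary_bound S t cardT) => [x|].
  apply: fs_val_inj; rewrite fs_val1.
  have eX k : fs_val (x ^+ k) = f (enum_val x *+ k)%R.
    elim: k => [|k IH]; first by rewrite expg0 fs_val1 mulr0n f1.
    by rewrite expgS fs_valM IH mulrS fM.
  rewrite eX -f1; congr f; apply/ffunP => i; rewrite ffunMnE ffunE.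
  by rewrite -mulr_natr pchar_Zp ?mulr0 // prime_gt1.
apply/centsP => x _ y _; apply: fs_val_inj; rewrite !fs_valM.
by rewrite -[LHS](fM (enum_val x)) addrC fM.
Qed.

End UpperBounds.

Section FloorSums.

(** Legendre's formula for m!. *)
Lemma sum_floor p n (m := (n %/ (p - 1))%N) : prime p ->
  \big[addn/0%N]_(k \in [set: nat]%classic) (n %/ (p ^ k * (p - 1)))%N = (m + logn p m`!)%N.
Proof.
move=> p_pr; have p1 := prime_gt1 p_pr.
have e k : (n %/ (p ^ k * (p - 1)) = m %/ p ^ k)%N by rewrite mulnC divnMA.
under eq_fsbigr => k _ do rewrite e.
have small k : (m < k)%N -> (m %/ p ^ k = 0)%N.
  by move=> mk; rewrite divn_small // (ltn_trans mk) // ltn_expl.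
rewrite -(fsbig_widen `I_m.+1) //; last first.
  by move=> k [_ /= /negP]; rewrite -leqNgt => /small.
rewrite -fsbig_ord big_ord_recl expn0 divn1; congr addn.
rewrite logn_fact // big_add1 big_mkord; exact: eq_bigr.
Qed.

End FloorSums.

(** * The action of pure automorphisms on homology *)

Section Homology.
Local Open Scope group_scope.
Variables (V : finType) (E : rel V).
Hypothesis Esym : symmetric E.
Local Notation A := (raag E).
Local Notation vtx := (vtx E).
Local Notation vle := (vle E).
Local Notation vsim := (vsim E).

Lemma vle_refl v : vle v v.
Proof. by apply/fintype.subsetP => w wv; rewrite finset.in_setU wv orbT. Qed.

Lemma vle_trans w v u : vle v w -> vle w u -> vle v u.
Proof.
move=> /fintype.subsetP vw /fintype.subsetP wu; apply/fintype.subsetP => z zv.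
have : z \in st E w by apply: vw.
rewrite finset.in_setU1 => /orP[/eqP zw|]; last exact: wu.
have : v \in st E u by apply: wu; rewrite -zw finset.in_set Esym; rewrite finset.in_set in zv.
rewrite finset.in_setU1 => /orP[/eqP <-|]; first by rewrite finset.in_setU zv orbT.
rewrite finset.in_set Esym => vu; have : u \in st E w by apply: vw; rewrite finset.in_set.
rewrite finset.in_setU1 => /orP[/eqP ->|]; first by rewrite zw finset.in_setU1 eqxx.
by rewrite finset.in_set Esym zw finset.in_setU1 finset.in_set orbC => ->.
Qed.

Lemma vsim_equiv : {in [set: V]%SET & &, equivalence_rel vsim}.
Proof.
move=> x y z _ _ _; split; first by rewrite /Defs.vsim vle_refl.
move=> /andP[xy yx]; apply/andP/andP => -[h1 h2]; split;
  by [apply: vle_trans h1 | apply: vle_trans h2 _ | apply: vle_trans _ h1 | apply: (vle_trans h2)].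
Qed.

Lemma vclass_sim C u v : C \in vclasses E -> u \in C -> (v \in C) = vsim u v.
Proof.
move=> CP uC; have /and3P[_ tP _] := equivalence_partitionP vsim_equiv.
rewrite -(def_pblock tP CP uC) pblock_equivalence_partition ?finset.in_setT //.
exact: vsim_equiv.
Qed.

Lemma eps_sum (f : A -> A) u g : {morph f : x y / x * y} ->
  eps u (f g) = (\sum_w eps u (f (vtx w)) * eps w g)%R.
Proof.
move=> fM; have vs v : eps u (f (vtx v)) = (\sum_w eps u (f (vtx w)) * eps w (vtx v))%R.
  rewrite (bigD1 v) //= big1 ?addr0 => [|w wv]; first by rewrite eps_vtx eqxx mulr1.
  by rewrite eps_vtx eq_sym (negPf wv) mulr0.
elim/raag_ind: g => [|v g IH|v g IH].
- by rewrite (hom_one fM) eps1 big1 // => w _; rewrite eps1 mulr0.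
- rewrite fM epsM IH [eps u (f _)]vs -big_split; apply: eq_bigr => w _.
  by rewrite /= epsM mulrDr.
- rewrite fM epsM (hom_inv fM) epsV IH [eps u (f _)]vs -sumrN -big_split.
  by apply: eq_bigr => w _; rewrite /= epsM epsV mulrDr mulrN.
Qed.

Lemma eps_inner (f : A -> A) u x a : {morph f : x y / x * y} ->
  eps u (f (a * x * a^-1)) = eps u (f x).
Proof.
by move=> fM; rewrite !fM !epsM (hom_inv fM) epsV addrAC subrr add0r.
Qed.

(** ** Pure automorphisms are triangular *)

Definition triangular (f : A -> A) : Prop :=
  forall u v, eps u (f (vtx v)) != 0%R -> vle v u.

Lemma triangular_comp (f g : A -> A) : {morph f : x y / x * y} ->
  triangular f -> triangular g -> triangular (f \o g).
Proof.
move=> fM tf tg u v; rewrite /= eps_sum //; apply: contraNT => vu.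
rewrite big1 // => w _; have [e|nz] := eqVneq (eps w (g (vtx v))) 0%R.
  by rewrite e mulr0.
have [->|nz'] := eqVneq (eps u (f (vtx w))) 0%R; first by rewrite mul0r.
by case/negP: vu; apply: vle_trans (tg _ _ nz) (tf _ _ nz').
Qed.

Lemma triangular_id u v : ((v == u)%:R%R : int) != 0%R -> vle v u.
Proof. by case: (v =P u) => [->|]; rewrite ?vle_refl ?eqxx. Qed.

Lemma comp_notin_st v C w : component_del_st E v C -> w \in C -> w \notin st E v.
Proof.
move=> [x xv ->]; rewrite finset.in_set => /connectP[s].
elim: s x xv => [|y s IH] x xv /=; first by move=> _ ->.
by move=> /andP[/and3P[_ yv _] ys] /(IH y yv ys).
Qed.

Lemma aut_invK (f : aut A) x : (f^-1%g : aut A) (f x) = x.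
Proof. exact: aut_inv_funK. Qed.

Lemma pure_triangular (f : aut A) : pure_generator f -> triangular f /\ triangular (f^-1%g : aut A).
Proof.
have inv1 (g : aut A) x : g x = x -> (g^-1%g : aut A) x = x.
  by move=> e; rewrite -{1}e aut_invK.
case=> [[v [fv fu]]|[v [w [wv vw fw fu]]]|[v [C [cC fC fN]]]].
- have gv : (f^-1%g : aut A) (vtx v) = (vtx v)^-1.
    have h := hom_inv (autM (f^-1%g : aut A)).
    by have := congr1 (f^-1%g : aut A) fv; rewrite aut_invK h => {2}->; rewrite invgK.
  by split=> u w; have [->|wv] := eqVneq w v;
    rewrite ?fv ?gv ?fu ?(inv1 _ _ (fu _ wv)) // ?epsV eps_vtx ?oppr_eq0;
    exact: triangular_id.
- have gw : (f^-1%g : aut A) (vtx w) = (vtx v)^-1 * vtx w.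
    by rewrite -(aut_invK f ((vtx v)^-1 * _)) autM (hom_inv (autM f)) fw fu // mulKg.
  split=> u x; have [->|xw] := eqVneq x w;
    rewrite ?fw ?gw ?fu ?(inv1 _ _ (fu _ xw)) // ?epsM ?epsV !eps_vtx.
  + by case: (eqVneq w u) => [-> _|_]; [rewrite vle_refl | case: (eqVneq v u) => [<-|]].
  + exact: triangular_id.
  + by case: (eqVneq w u) => [-> _|_]; [rewrite vle_refl | case: (eqVneq v u) => [<-|]].
  + exact: triangular_id.
- have vC : v \notin C.
    by apply/negP => /(comp_notin_st cC); rewrite finset.in_setU1 eqxx.
  have gC w : w \in C -> (f^-1%g : aut A) (vtx w) = (vtx v)^-1 * vtx w * vtx v.
    move=> wC; rewrite -(aut_invK f ((vtx v)^-1 * _ * _)) !(autM f) (hom_inv (autM f)) (fC w wC) (fN v vC).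
    by rewrite !mulgA mulVg mul1g mulgVK.
  have gN w : w \notin C -> (f^-1%g : aut A) (vtx w) = vtx w by move=> wC; apply/inv1/fN.
  split=> u w; have [wC|wC] := boolP (w \in C).
  + rewrite (fC w wC) !epsM epsV !eps_vtx addrAC subrr add0r; exact: triangular_id.
  + rewrite (fN w wC) eps_vtx; exact: triangular_id.
  + rewrite (gC w wC) !epsM epsV !eps_vtx addrAC addNr add0r; exact: triangular_id.
  + rewrite (gN w wC) eps_vtx; exact: triangular_id.
Qed.

Lemma Aut0_triangular (f : Aut0 E) : triangular (val f : aut A).
Proof.
pose H : {pred aut A} := fun f => `[< triangular f /\ triangular (f^-1%g : aut A) >].
suff : val f \in H by move=> /asboolP[].
have /asboolP := valP f; apply=> [|g gP]; last by apply/asboolP/pure_triangular.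
split=> [|g h /asboolP[g1 g2] /asboolP[h1 h2]]; apply/asboolP.
  have t1 : triangular (1 : aut A).
    by move=> u v; rewrite /= eps_vtx; apply: triangular_id.
  by rewrite invg1.
split; first exact: (triangular_comp (autM g) g1 h2).
by rewrite invgM invgK; apply: (triangular_comp (autM h) h1 g2).
Qed.

(** ** Diagonal blocks *)

(** Empty blocks for the sets that are not classes make {set V} the index type. *)
Definition vblock (C : {set V}) : {set V} := if C \in vclasses E then C else finset.set0.

Definition block (C : {set V}) (f : A -> A) : 'M[int]_#|vblock C| :=
  (\matrix_(i, j) eps (enum_val i) (f (vtx (enum_val j))))%R.

Lemma block1 C : block C id = (1%:M)%R.
Proof.
apply/matrixP => i j; rewrite !mxE eps_vtx (inj_eq enum_val_inj) eq_sym.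
by [].
Qed.

Lemma block_eq C (f g : A -> A) : (forall u v, eps u (f (vtx v)) = eps u (g (vtx v))) ->
  block C f = block C g.
Proof. by move=> e; apply/matrixP => i j; rewrite !mxE e. Qed.

Lemma blockM C (f g : A -> A) : {morph f : x y / x * y} ->
  triangular f -> triangular g -> block C (f \o g) = (block C f *m block C g)%R.
Proof.
move=> fM tf tg; apply/matrixP => i j; rewrite !mxE /= (@eps_sum f) //.
have CP : C \in vclasses E.
  have : exists x, x \in vblock C by exists (enum_val i); apply: enum_valP.
  by rewrite /vblock; case: ifP => // _ [x]; rewrite finset.in_set0.
have DE : vblock C = C by rewrite /vblock CP.
have iC : enum_val i \in C by rewrite -{2}DE; apply: enum_valP.
have jC : enum_val j \in C by rewrite -{2}DE; apply: enum_valP.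
rewrite (bigID (mem (vblock C))) /= [X in (_ + X)%R]big1 ?addr0 => [|w wC]; last first.
  have [e|nz] := eqVneq (eps (enum_val i) (f (vtx w))) 0%R; first by rewrite e mul0r.
  have [e|nz'] := eqVneq (eps w (g (vtx (enum_val j)))) 0%R; first by rewrite e mulr0.
  case/negP: wC; rewrite DE (vclass_sim _ CP jC).
  have := vclass_sim (enum_val i) CP jC; rewrite iC => /esym/andP[ji ij].
  apply/andP; split; first exact: tg nz'.
  exact: vle_trans (tf _ _ nz) ij.
by rewrite big_enum_val; apply: eq_bigr => k _; rewrite !mxE.
Qed.

(** Such an f is unipotent on homology, and a unipotent integral matrix of finite
    order is trivial. *)
Lemma unipotent_power (f : A -> A) p : {morph f : x y / x * y} -> triangular f ->
  (forall C, block C f = (1%:M)%R) -> (0 < p)%N ->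
  (forall u v, eps u (iter p f (vtx v)) = (v == u)%:R%R) ->
  forall u g, eps u (f g) = eps u g.
Proof.
move=> fM tf bf p0 fp.
have iM k : {morph iter k f : x y / x * y} by elim: k => // k IH x y; rewrite !iterS IH fM.
have it k : triangular (iter k f).
  elim: k => [|k IH]; last exact: (triangular_comp fM tf IH).
  by move=> u v; rewrite /= eps_vtx; apply: triangular_id.
have ib k C : block C (iter k f) = (1%:M)%R.
  elim: k => [|k IH]; first exact: block1.
  by rewrite (@blockM C f (iter k f)) // bf IH mulmx1.
have diag k u v : vsim v u -> eps u (iter k f (vtx v)) = (v == u)%:R%R.
  move=> vu; pose C := finset.pblock (vclasses E) v.
  have /and3P[/eqP cov tP _] := equivalence_partitionP vsim_equiv.
  have vcov : v \in finset.cover (vclasses E) by rewrite cov finset.in_setT.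
  have CP : C \in vclasses E by apply: finset.pblock_mem.
  have vC : v \in C by rewrite finset.mem_pblock.
  have uC : u \in C by rewrite (vclass_sim u CP vC).
  have DE : vblock C = C by rewrite /vblock CP.
  have vD : v \in vblock C by rewrite DE.
  have uD : u \in vblock C by rewrite DE.
  have := congr1 (fun M : 'M_ _ => M (enum_rank_in uD u) (enum_rank_in vD v)) (ib k C).
  rewrite !mxE !enum_rankK_in // => ->; congr (_%:R)%R.
  by rewrite -(inj_eq enum_val_inj) !enum_rankK_in // eq_sym.
suff main u v : eps u (f (vtx v)) = (v == u)%:R%R.
  move=> u g; rewrite eps_sum // (bigD1 u) //= big1 ?addr0 => [|w wu].
    by rewrite main eqxx mul1r.
  by rewrite main (negPf wu) mul0r.
have [n] := ubnP #|[set w | vle v w && vle w u]%SET|; elim: n u v => // n IH u v.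
rewrite ltnS => len; have [vu|nvu] := boolP (vsim v u); first exact: (diag 1%N u v vu).
have vu : (v == u) = false by apply: contraNF nvu => /eqP->; rewrite /Defs.vsim vle_refl.
rewrite vu; apply/eqP/negPn/negP => nz; have le_vu := tf _ _ nz.
have step k : eps u (iter k f (vtx v)) = (eps u (f (vtx v)) *+ k)%R.
  elim: k => [|k IHk]; first by rewrite /= eps_vtx vu mulr0n.
  rewrite iterSr eps_sum // mulrS (bigD1 u) //= (diag k u u) ?eqxx ?mul1r; last first.
    by rewrite /Defs.vsim vle_refl.
  congr (_ + _)%R; rewrite (bigD1 v) ?vu //= (diag 1%N v v) ?(eqxx v) ?mulr1; last first.
    by rewrite /Defs.vsim vle_refl.
  rewrite IHk big1 ?addr0 // => w /andP[wu wv].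
  have [e|nz1] := eqVneq (eps w (f (vtx v))) 0%R; first by rewrite e mulr0.
  have [e|nz2] := eqVneq (eps u (iter k f (vtx w))) 0%R; first by rewrite e mul0r.
  have vw := tf _ _ nz1; have wu' := it k _ _ nz2.
  have [uw|nuw] := boolP (vle u w).
    by move: nz2; rewrite diag ?(negPf wu) ?eqxx // /Defs.vsim wu'.
  case/eqP: nz1; rewrite IH ?(eq_sym v) ?(negPf wv) //.
  apply: leq_trans len; apply: fintype.proper_card; rewrite fintype.properE; apply/andP; split.
    apply/fintype.subsetP => x; rewrite !finset.in_set => /andP[-> /vle_trans]; exact.
  apply/fintype.subsetPn; exists u; rewrite !finset.in_set ?le_vu ?vle_refl //=.
by move: (step p); rewrite fp vu => /esym/eqP; rewrite mulrn_eq0 (negPf nz) orbF eqn0Ngt p0.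
Qed.

(** ** Torsion in the kernels *)

Lemma Aut0_expg (f : Aut0 E) k x : (val (f ^+ k) : aut A) x = iter k (val f : aut A) x.
Proof.
elim: k x => [|k IH] x; first by rewrite expg0 val1.
by rewrite expgS valM iterS -IH.
Qed.

Lemma Aut0_torsion (f : Aut0 E) p : prime p -> f ^+ p = 1 ->
  (forall C, block C (val f : aut A) = (1%:M)%R) -> f = 1.
Proof.
move=> pp fp bf; apply: val_inj; apply: autP => x.
have e k : iter p (val f : aut A) k = k by rewrite -Aut0_expg fp.
apply: (periodic_eq_id Esym (autM (val f)) _ (prime_gt0 pp) e).
apply: (unipotent_power (autM (val f)) (@Aut0_triangular f) bf (prime_gt0 pp)).
by move=> u v; rewrite e eps_vtx.
Qed.

Local Open Scope quotient_scope.
Local Notation Out0 := (Out0 E).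
Definition out_pi (f : Aut0 E) : Out0 := \pi_(quotg (Inn E)) f.

Lemma out_piP (f g : Aut0 E) : out_pi f = out_pi g <-> inner (val (f^-1 * g) : aut A).
Proof.
split=> [/quotg_piP/asboolP //|h]; apply/quotg_piP; exact/asboolP.
Qed.

Lemma out_piM f g : out_pi (f * g) = out_pi f * out_pi g.
Proof. by symmetry; apply: quotg_mulE. Qed.

Lemma out_piK (q : Out0) : out_pi (repr q) = q. Proof. exact: reprK. Qed.

Lemma out_piX f k : out_pi (f ^+ k) = out_pi f ^+ k.
Proof. by elim: k => [|k IH]; rewrite ?expg0 // !expgS out_piM IH. Qed.

Lemma block_out C (f g : Aut0 E) : out_pi f = out_pi g ->
  block C (val f : aut A) = block C (val g : aut A).
Proof.
move=> /out_piP[a ha]; apply: block_eq => u v.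
have -> : (val g : aut A) (vtx v) = (val f : aut A) ((val (f^-1 * g) : aut A) (vtx v)).
  by rewrite -[in LHS](mulVKg f g) valM.
by rewrite ha eps_inner //; apply: autM.
Qed.

Lemma Out0_torsion (q : Out0) p : prime p -> q ^+ p = 1 ->
  (forall C, block C (val (repr q) : aut A) = (1%:M)%R) -> q = 1.
Proof.
move=> pp qp bq; set f := repr q in bq; have fq : out_pi f = q := out_piK q.
have /out_piP[a ha] : out_pi 1 = out_pi (f ^+ p) by rewrite out_piX fq qp.
rewrite invg1 mul1g in ha.
have e k : iter p (val f : aut A) k = a * k * a^-1 by rewrite -Aut0_expg ha.
have fe := unipotent_power (autM (val f)) (@Aut0_triangular f) bq (prime_gt0 pp).
have {}fe u g : eps u ((val f : aut A) g) = eps u g.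
  apply: fe => v w; rewrite e.
  by rewrite (@eps_inner id) // eps_vtx.
have [d hd] := inner_of_inner_power Esym (autM (val f)) fe (prime_gt0 pp) e.
by rewrite -fq; symmetry; apply/out_piP; exists d => x; rewrite invg1 mul1g hd.
Qed.

Lemma sum_vblock (F : nat -> nat) : F 0%N = 0%N ->
  (\sum_C F #|vblock C| = \sum_(C in vclasses E) F #|C|)%N.
Proof.
move=> F0; rewrite [RHS]big_mkcond; apply: eq_bigr => C _.
by rewrite /vblock; case: ifP => // _; rewrite finset.cards0.
Qed.

Lemma sum_floor_vblock p : prime p ->
  (\sum_C (#|vblock C| %/ (p - 1) + logn p (#|vblock C| %/ (p - 1))`!) =
   \sum_(C in vclasses E)
    \big[addn/0]_(k \in [set: nat]%classic) (#|C| %/ (p ^ k * (p - 1))))%N.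
Proof.
move=> p_pr; rewrite (sum_vblock (F := fun n => n %/ (p - 1) + logn p (n %/ (p - 1))`!))%N; last first.
  by rewrite div0n fact0 logn1.
by apply: eq_bigr => C _; rewrite sum_floor.
Qed.

Section Bounds.
Variables (p t : nat).
Hypothesis p_pr : prime p.
Let n C := #|vblock C|.

Let rA C (f : Aut0 E) := block C (val f : aut A).
Let rO C (q : Out0) := block C (val (repr q) : aut A).

Let rA1 C : rA C 1 = (1%:M)%R. Proof. exact: block1. Qed.
Let rAM C f g : rA C (f * g) = (rA C f *m rA C g)%R.
Proof. by apply: blockM; [apply: autM|exact: Aut0_triangular|exact: Aut0_triangular]. Qed.
Let rO1 C : rO C 1 = (1%:M)%R.
Proof. by rewrite -(rA1 C); apply: block_out; rewrite out_piK. Qed.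
Let rOM C x y : rO C (x * y) = (rO C x *m rO C y)%R.
Proof. by rewrite -rAM; apply: block_out; rewrite out_piM !out_piK. Qed.

Lemma Aut0_nu_le : has_subgroup_of_order (Aut0 E) (p ^ t) ->
  (t <= \sum_(C in vclasses E)
    \big[addn/0]_(k \in [set: nat]%classic) (#|C| %/ (p ^ k * (p - 1))))%N.
Proof.
rewrite -sum_floor_vblock //; apply: (nu_upper p_pr rA1 rAM) => f fp; exact: Aut0_torsion fp.
Qed.

Lemma Out0_nu_le : has_subgroup_of_order Out0 (p ^ t) ->
  (t <= \sum_(C in vclasses E)
    \big[addn/0]_(k \in [set: nat]%classic) (#|C| %/ (p ^ k * (p - 1))))%N.
Proof.
rewrite -sum_floor_vblock //; apply: (nu_upper p_pr rO1 rOM) => f fp; exact: Out0_torsion fp.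
Qed.

Lemma Aut0_rank_le : Zp_power_embeds p t (Aut0 E) ->
  (t <= \sum_(C in vclasses E) #|C| %/ (p - 1))%N.
Proof.
rewrite -(sum_vblock (F := fun n => n %/ (p - 1))%N) ?div0n //.
apply: (rank_upper p_pr rA1 rAM) => f fp; exact: Aut0_torsion fp.
Qed.

Lemma Out0_rank_le : Zp_power_embeds p t Out0 ->
  (t <= \sum_(C in vclasses E) #|C| %/ (p - 1))%N.
Proof.
rewrite -(sum_vblock (F := fun n => n %/ (p - 1))%N) ?div0n //.
apply: (rank_upper p_pr rO1 rOM) => f fp; exact: Out0_torsion fp.
Qed.

End Bounds.
End Homology.

(** * Finite subgroups of the pure automorphism group *)

Section PureMaps.
Local Open Scope group_scope.
Variables (V : finType) (E : rel V).
Hypothesis Esym : symmetric E.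
Local Notation A := (raag E).
Local Notation vtx := (vtx E).
Local Notation vle := (vle E).
Local Notation vsim := (vsim E).
Local Notation pure := (gen (@pure_generator V E)).

Definition ispure (f : A -> A) : Prop := exists2 a : aut A, a =1 f & pure a.

Lemma pure_gen (a : aut A) : pure_generator a -> pure a.
Proof. by move=> pa; apply/asboolP => H _; apply. Qed.

Lemma ispure_id : ispure id.
Proof. by exists 1; rewrite //; case: (gen_closed (@pure_generator V E)). Qed.

Lemma ispure_ext f g : f =1 g -> ispure f -> ispure g.
Proof. by move=> fg [a af pa]; exists a => // x; rewrite af fg. Qed.

Lemma ispure_comp f g : ispure f -> ispure g -> ispure (f \o g).
Proof.
move=> [a af pa] [b bg pb]; exists (a * b).
  by move=> x; rewrite /= -bg -af.
exact: (group_closedM (gen_closed (@pure_generator V E))).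
Qed.

Lemma ispure_cancel f g : ispure f -> ispure (f \o g) -> ispure g.
Proof.
move=> [a af pa] [b bfg pb]; exists (a^-1 * b).
  move=> x; have e : b x = a (g x) by rewrite bfg /= af.
  by rewrite -[LHS]/((a^-1%g : aut A) (b x)) e aut_invK.
apply: (group_closedM (gen_closed (@pure_generator V E))) => //.
exact: (group_closedV (gen_closed (@pure_generator V E))).
Qed.

Lemma ispure_morph f : ispure f -> {morph f : x y / x * y}.
Proof. by move=> [a af _] x y; rewrite -!af autM. Qed.

Lemma aut_of_inverse (f g : A -> A) : {morph f : x y / x * y} -> {morph g : x y / x * y} ->
  (forall v, f (g (vtx v)) = vtx v) -> (forall v, g (f (vtx v)) = vtx v) ->
  exists a : aut A, a =1 f.
Proof.
move=> fM gM fg gf; have fa : is_aut f.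
  apply/asboolP; split=> //; exists g; apply: raag_hom_eq => // x y; first by rewrite fM gM.
  by rewrite gM fM.
by exists (Sub f fa).
Qed.

(** ** Inversions *)

Definition inv_at (v : V) : A -> A := ext (fun u => if u == v then (vtx u)^-1 else vtx u).

Lemma inv_atM v : {morph inv_at v : x y / x * y}.
Proof.
apply: extM => a b /vtxC ab; have h : commute (vtx a) (vtx b) := ab.
by do 2 case: eqP => _ //; [apply: commuteV; apply: commute_sym; apply: commuteV; apply: commute_sym
  | apply: commute_sym; apply: commuteV; apply: commute_sym | apply: commuteV].
Qed.

Lemma inv_at_vtx v u : inv_at v (vtx u) = if u == v then (vtx u)^-1 else vtx u.
Proof.
apply: ext_vtx => a b /vtxC ab; have h : commute (vtx a) (vtx b) := ab.
by do 2 case: eqP => _ //; [apply: commuteV; apply: commute_sym; apply: commuteV; apply: commute_sym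
  | apply: commute_sym; apply: commuteV; apply: commute_sym | apply: commuteV].
Qed.

Lemma ispure_inv v : ispure (inv_at v).
Proof.
have K u : inv_at v (inv_at v (vtx u)) = vtx u.
  rewrite inv_at_vtx; case: eqP => [->|/eqP/negPf uv]; last by rewrite inv_at_vtx uv.
  by rewrite (hom_inv (@inv_atM v)) inv_at_vtx eqxx invgK.
have [a aE] := aut_of_inverse (@inv_atM v) (@inv_atM v) K K; exists a => //.
apply/pure_gen; apply: Or31; exists v; split; first by rewrite aE inv_at_vtx eqxx.
by move=> u /negPf uv; rewrite aE inv_at_vtx uv.
Qed.

(** ** Transvections *)

Section Transvection.
Variables (v w : V).
Hypothesis wv : vle w v.
Hypothesis vw : v != w.

Let vlink b : E w b -> commute (vtx v) (vtx b).
Proof.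
move=> wb; have : b \in st E v by apply: (fintype.subsetP wv); rewrite finset.in_set.
by rewrite finset.in_setU1 finset.in_set => /orP[/eqP->//|/vtxC].
Qed.

Let tE (c : A) : (forall b, E w b -> commute c (vtx b)) ->
  forall a b, E a b -> (fun u => if u == w then c * vtx w else vtx u) a *
    (fun u => if u == w then c * vtx w else vtx u) b =
    (fun u => if u == w then c * vtx w else vtx u) b *
    (fun u => if u == w then c * vtx w else vtx u) a.
Proof.
move=> cb a b ab; case: (eqVneq a w) ab => [->|aw] ab; case: (eqVneq b w) ab => [->|bw] ab //.
- apply: commute_sym; apply: commuteM; apply: commute_sym; [exact: cb | exact: vtxC].
- by apply: commuteM; [apply: commute_sym; apply: cb; rewrite Esym | exact: vtxC].
- exact: vtxC.
Qed.

Definition trv : A -> A := ext (fun u => if u == w then vtx v * vtx w else vtx u).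
Let trvI : A -> A := ext (fun u => if u == w then (vtx v)^-1 * vtx w else vtx u).

Let vlinkV b : E w b -> commute (vtx v)^-1 (vtx b).
Proof. by move=> /vlink h; apply: commute_sym; apply: commuteV; apply: commute_sym. Qed.

Lemma trvM : {morph trv : x y / x * y}. Proof. exact: extM (tE vlink). Qed.
Lemma trv_vtx u : trv (vtx u) = if u == w then vtx v * vtx w else vtx u.
Proof. exact: ext_vtx (tE vlink) u. Qed.
Let trvIM : {morph trvI : x y / x * y}. Proof. exact: extM (tE vlinkV). Qed.
Let trvI_vtx u : trvI (vtx u) = if u == w then (vtx v)^-1 * vtx w else vtx u.
Proof. exact: ext_vtx (tE vlinkV) u. Qed.

Lemma ispure_trv : ispure trv.
Proof.
have [||a aE] := aut_of_inverse trvM trvIM.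
- move=> u; rewrite trvI_vtx; case: (eqVneq u w) => [->|uw]; last by rewrite trv_vtx (negPf uw).
  by rewrite trvM (hom_inv trvM) !trv_vtx eqxx (negPf vw) mulKg.
- move=> u; rewrite trv_vtx; case: (eqVneq u w) => [->|uw]; last by rewrite trvI_vtx (negPf uw).
  by rewrite trvIM !trvI_vtx eqxx (negPf vw) mulVKg.
exists a => //; apply/pure_gen; apply: Or32; exists v, w; split=> //.
  by rewrite aE trv_vtx eqxx.
by move=> u /negPf uw; rewrite aE trv_vtx uw.
Qed.

End Transvection.

Lemma ispure_multi_trv v (J : seq V) : uniq J -> (forall w, w \in J -> vle w v && (v != w)) ->
  exists2 f, ispure f & forall u, f (vtx u) = if u \in J then vtx v * vtx u else vtx u.
Proof.
elim: J => [|w J IH] /=; first by exists id => //; exact: ispure_id.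
move=> /andP[wJ uJ] h; have [u uJ'|f pf fE] := IH uJ; first by apply: h; rewrite inE uJ' orbT.
have /andP[wv vw] := h w (mem_head _ _).
exists (trv v w \o f); first by apply: ispure_comp => //; apply: ispure_trv.
move=> u; rewrite /= fE inE; have tM := trvM wv; have tv := trv_vtx wv.
case: (boolP (u \in J)) => uJ'.
  rewrite orbT tM !tv (negPf vw); case: eqP => // uw.
  by move: wJ; rewrite -uw uJ'.
by rewrite orbF tv; case: eqP => // ->.
Qed.

(** ** Permutations of vertices *)

Lemma vsim_adj v w u u' : E v w -> vsim v u -> vsim w u' -> (u == u') || E u u'.
Proof.
move=> vw /andP[/fintype.subsetP vu /fintype.subsetP uv] /andP[/fintype.subsetP wu' /fintype.subsetP u'w].
have : w \in st E u by apply: vu; rewrite finset.in_set.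
rewrite finset.in_setU1 finset.in_set => /orP[/eqP wu|uw].
  have : v \in st E u' by apply: wu'; rewrite finset.in_set Esym.
  rewrite finset.in_setU1 finset.in_set => /orP[/eqP vu'|u'v]; first by rewrite -vu' -wu Esym vw orbT.
  have : u' \in st E u by apply: vu; rewrite finset.in_set Esym.
  by rewrite finset.in_setU1 finset.in_set eq_sym.
have : u \in st E u' by apply: wu'; rewrite finset.in_set Esym.
by rewrite finset.in_setU1 finset.in_set [E u' u]Esym.
Qed.

Lemma vsim_commute v w u u' : E v w -> vsim v u -> vsim w u' -> commute (vtx u) (vtx u').
Proof. by move=> vw vu wu'; have /orP[/eqP->//|/vtxC] := vsim_adj vw vu wu'. Qed.

Lemma vsim_refl v : vsim v v. Proof. by rewrite /Defs.vsim vle_refl. Qed.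
Lemma vsim_sym v w : vsim v w = vsim w v. Proof. by rewrite /Defs.vsim andbC. Qed.
Lemma vsim_trans v w u : vsim v w -> vsim w u -> vsim v u.
Proof.
by move=> /andP[a b] /andP[c d]; rewrite /Defs.vsim (vle_trans Esym a c) (vle_trans Esym d b).
Qed.

Definition vmap (h : V -> V) : A -> A := ext (fun v => vtx (h v)).

Section VertexMap.
Variable h : V -> V.
Hypothesis h_sim : forall v, vsim v (h v).
Lemma vmapM : {morph vmap h : x y / x * y}.
Proof. by apply: extM => v w vw; apply: (vsim_commute vw). Qed.
Lemma vmap_vtx v : vmap h (vtx v) = vtx (h v).
Proof. by apply: (ext_vtx (k := fun v => vtx (h v))) => x y xy; apply: (vsim_commute xy). Qed.
End VertexMap.

(** The images of the pair (v, w) under the composites of the factors below,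
    innermost first, are (v, w^-1), (v, w^-1 v^-1), (v^-1, w^-1 v), (v^-1 w^-1, v),
    (v^-1 w, v), (w, v). *)
Lemma ispure_swap v w : v != w -> vsim v w -> ispure (vmap (tperm v w)).
Proof.
move=> vw /andP[lvw lwv].
have wv : w != v by rewrite eq_sym.
pose f := trv v w \o inv_at w \o trv w v \o inv_at v \o trv v w \o inv_at w.
have pf : ispure f.
  by do !apply: ispure_comp; solve [exact: ispure_inv | exact: ispure_trv].
apply: (ispure_ext _ pf); apply: raag_hom_eq; first exact: (ispure_morph pf).
  apply: vmapM => x; case: tpermP => [->|->|_ _]; rewrite /Defs.vsim ?vle_refl ?lvw ?lwv //.
move=> x; rewrite vmap_vtx; last first.
  by move=> y; case: tpermP => [->|->|_ _]; rewrite /Defs.vsim ?vle_refl ?lvw ?lwv.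
have aM := trvM lwv; have bM := trvM lvw.
have aE := trv_vtx lwv; have bE := trv_vtx lvw.
have iM u : {morph inv_at u : x y / x * y} := @inv_atM u.
have simp := (aM, bM, iM, hom_inv aM, hom_inv bM, (fun u => hom_inv (iM u)), aE, bE, inv_at_vtx).
rewrite /f /=; case: tpermP => [->|->|/eqP/negPf xv /eqP/negPf xw].
- by do 8 rewrite ?simp ?eqxx ?(negPf vw) ?(negPf wv) ?invgM ?invgK ?mulKg.
- by do 8 rewrite ?simp ?eqxx ?(negPf vw) ?(negPf wv) ?invgM ?invgK ?mulKg ?mulgVK.
- by do 8 rewrite ?simp ?xv ?xw.
Qed.

Lemma ispure_perm (s : {perm V}) : (forall v, vsim v (s v)) -> ispure (vmap s).
Proof.
have [n] := ubnP #|[set v | s v != v]%SET|; elim: n s => // n IH s; rewrite ltnS => sn hs.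
have [v sv|fix_s] := pickP (fun v => s v != v); last first.
  apply: ispure_ext ispure_id => x; symmetry; move: x; apply: raag_hom_eq => //.
    exact: vmapM.
  by move=> v; rewrite vmap_vtx //; have /negbFE/eqP-> := fix_s v.
pose w := s v; pose s' := (s * tperm v w)%g.
have vw : v != w by rewrite eq_sym.
have hvw : vsim v w := hs v.
have ht x : vsim x (tperm v w x).
  by case: tpermP => [->|->|_ _]; rewrite ?vsim_refl // vsim_sym.
have hs' x : vsim x (s' x) by rewrite permM; apply: vsim_trans (hs x) (ht _).
have : ispure (vmap (tperm v w) \o vmap s').
  apply: ispure_comp; first exact: ispure_swap.
  apply: IH => //; apply: leq_trans sn; apply: fintype.proper_card; rewrite fintype.properE.
  apply/andP; split.
    apply/fintype.subsetP => x; rewrite !finset.in_set; apply: contraNneq => sx.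
    rewrite permM sx tpermD //; first by apply: contraNneq sv => ->; rewrite sx.
    by apply: contraNneq vw => wx; apply/eqP/(@perm_inj _ s); rewrite wx sx -wx.
  apply/fintype.subsetPn; exists v; rewrite !finset.in_set // permM -/w tpermR eqxx //.
apply: ispure_ext; apply: raag_hom_eq.
- by move=> x y; rewrite /= !vmapM.
- exact: vmapM.
- by move=> x; rewrite /= !vmap_vtx // permM tpermK.
Qed.

End PureMaps.

(** ** Permutations of the points of the blocks *)

Section Wreath.
Local Open Scope group_scope.
Variables (V : finType) (E : rel V).
Hypothesis Esym : symmetric E.
Variable p : nat.
Hypothesis p_pr : prime p.
Local Notation A := (raag E).
Local Notation vtx := (vtx E).
Local Notation vle := (vle E).
Local Notation vsim := (vsim E).

(** Each class is cut into disjoint blocks of p - 1 vertices, indexed by the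
    nonzero elements of Z/p; a few vertices may be left over. *)
Definition nblocks (C : {set V}) : nat := #|vblock E C| %/ (p - 1).
Definition blk : finType := {C : {set V} & 'I_(nblocks C)}.

Lemma Zp_lt (i : 'Z_p) : (i < p)%N.
Proof. by rewrite -{2}(Zp_cast (prime_gt1 p_pr)). Qed.

Lemma zidx_lt (x : blk) (i : 'Z_p) : (tagged x * (p - 1) + i.-1 < #|vblock E (tag x)|)%N.
Proof.
have p1 := prime_gt1 p_pr; have xm : (tagged x < nblocks (tag x))%N := ltn_ord _.
apply: leq_trans (leq_divM _ (p - 1)); rewrite -/(nblocks _).
apply: leq_trans (_ : (tagged x).+1 * (p - 1) <= _)%N; last by rewrite leq_mul2r xm orbT.
rewrite mulSn addnC ltn_add2r; have := Zp_lt i; case: (i : nat) => [_|k]; first by rewrite subn_gt0.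
by rewrite /= ltn_subRL add1n.
Qed.

Definition zvert (x : blk) (i : 'Z_p) : V := enum_val (Ordinal (zidx_lt x i)).

Lemma zvert_class x i : zvert x i \in vblock E (tag x).
Proof. exact: enum_valP. Qed.

Lemma vblockP C v : v \in vblock E C -> C \in vclasses E /\ v \in C.
Proof. by rewrite /vblock; case: ifP => // _; rewrite finset.in_set0. Qed.

Lemma zvert_sim x y i j : tag x = tag y -> vsim (zvert x i) (zvert y j).
Proof.
move=> xy; have [CP iC] := vblockP (zvert_class x i).
have [_ jC] := vblockP (zvert_class y j); rewrite -(vclass_sim Esym _ CP iC).
by rewrite xy.
Qed.

Lemma zvert_inj x y i j : i != 0%R -> j != 0%R -> zvert x i = zvert y j -> x = y /\ i = j.
Proof.
move=> i0 j0 e; have [CP iC] := vblockP (zvert_class x i).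
have [CP' jC] := vblockP (zvert_class y j).
have exy : tag x = tag y.
  have /and3P[_ tP _] := equivalence_partitionP (vsim_equiv Esym).
  by rewrite -(def_pblock tP CP iC) -(def_pblock tP CP' jC) e.
have p1 := prime_gt1 p_pr; have i1 : (0 < i)%N by rewrite lt0n; exact: i0.
have j1 : (0 < j)%N by rewrite lt0n; exact: j0.
have small (k : 'Z_p) : (0 < k)%N -> (k.-1 < p - 1)%N.
  by move=> k0; rewrite ltn_subRL add1n prednK // Zp_lt.
have [nx ny] : tagged x = tagged y :> nat /\ i.-1 = j.-1 :> nat.
  have en : (tagged x * (p - 1) + i.-1 = tagged y * (p - 1) + j.-1)%N.
    case: x y exy e {CP iC CP' jC} => [C b] [C' b'] /= eC; case: _ / eC b' => b'.
    by move=> /enum_val_inj/(congr1 val).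
  have pp : (0 < p - 1)%N by rewrite subn_gt0.
  split.
    by have := congr1 (fun n => n %/ (p - 1))%N en; rewrite !divnMDl // !divn_small ?small // !addn0.
  by have := congr1 (fun n => n %% (p - 1))%N en; rewrite !modnMDl !modn_small ?small.
split; last by apply: val_inj; rewrite /= -(prednK i1) ny prednK.
case: x y exy nx {e CP iC CP' jC} => [C b] [C' b'] /= eC; case: _ / eC b' => b' bb.
by congr Tagged; apply: val_inj.
Qed.

Definition pt : finType := (blk * 'Z_p)%type.

(** The p points of a block become the elements 1, z_1, ..., z_(p-1); a
    permutation s of the points then acts by z_i |-> Z (s 0)^-1 * Z (s i), as on the
    fundamental group of a graph with two vertices and p edges. *)
Definition Z (a : pt) : A := if a.2 == 0%R then 1 else vtx (zvert a.1 a.2).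

Lemma Z0 x : Z (x, 0%R) = 1. Proof. by rewrite /Z eqxx. Qed.
Lemma Zn0 x i : i != 0%R -> Z (x, i) = vtx (zvert x i).
Proof. by rewrite /Z /= => /negPf->. Qed.

Definition blockperm (s : {perm pt}) : bool :=
  [forall a : pt, ((s a).1 == (s (a.1, 0%R)).1) && (tag (s a).1 == tag a.1)].

Lemma blockpermP (s : {perm pt}) :
  reflect (forall x i, (s (x, i)).1 = (s (x, 0%R)).1 /\ tag (s (x, i)).1 = tag x)
  (blockperm s).
Proof.
apply: (iffP forallP) => [h x i|h [x i]]; first by have /andP[/eqP -> /eqP ->] := h (x, i).
by have [-> ->] := h x i; rewrite !eqxx.
Qed.

Definition wval (s : {perm pt}) (v : V) : A :=
  if [pick a : pt | (a.2 != 0%R) && (zvert a.1 a.2 == v)] is Some a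
  then (Z (s (a.1, 0%R)))^-1 * Z (s a) else vtx v.

Lemma wval_zvert s x i : i != 0%R -> wval s (zvert x i) = (Z (s (x, 0%R)))^-1 * Z (s (x, i)).
Proof.
move=> i0; rewrite /wval; case: pickP => [[y j] /= /andP[j0 /eqP/(zvert_inj j0 i0)[-> ->]]//|].
by move=> /(_ (x, i)); rewrite /= i0 eqxx.
Qed.

Lemma wval_off s v : (forall a : pt, a.2 != 0%R -> zvert a.1 a.2 != v) -> wval s v = vtx v.
Proof.
move=> h; rewrite /wval; case: pickP => // a /andP[a0 /eqP e].
by have := h a a0; rewrite e eqxx.
Qed.

Lemma vtx_cases v : (exists x i, i != 0%R /\ v = zvert x i) \/
  (forall a : pt, a.2 != 0%R -> zvert a.1 a.2 != v).
Proof.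
have [/existsP[[x i] /= /andP[i0 /eqP <-]]|h] :=
    boolP [exists a : pt, (a.2 != 0%R) && (zvert a.1 a.2 == v)].
  by left; exists x, i.
by right=> a a0; apply/negP => e; move/existsPn: h => /(_ a); rewrite a0 e.
Qed.

(** Values at adjacent vertices commute because each value is a quotient of
    elements of the class of its vertex, or of 1. *)
Let near (v : V) (g : A) : Prop := g = 1 \/ exists2 u, vsim v u & g = vtx u.

Lemma wval_near s v : blockperm s -> exists a b, [/\ wval s v = a^-1 * b, near v a & near v b].
Proof.
move=> /blockpermP bs; have nearZ x i a : tag a.1 = tag x -> near (zvert x i) (Z a).
  case: a => y j /= yx; have [->|j0] := eqVneq j 0%R; first by left; rewrite Z0.
  by right; exists (zvert y j); rewrite ?Zn0 //; apply: zvert_sim.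
have [[x [i [i0 ->]]]|off] := vtx_cases v.
  exists (Z (s (x, 0%R))), (Z (s (x, i))); rewrite wval_zvert //.
  by split=> //; apply: nearZ; apply: (bs x _).2.
exists 1, (vtx v); rewrite wval_off // invg1 mul1g; split=> //; first by left.
by right; exists v => //; apply: vsim_refl.
Qed.

Lemma wvalE s v w : blockperm s -> E v w -> wval s v * wval s w = wval s w * wval s v.
Proof.
move=> bs vw; have [a [b [-> va vb]]] := wval_near v bs; have [c [d [-> wc wd]]] := wval_near w bs.
have com g h : near v g -> near w h -> commute g h.
  move=> [->|[u vu ->]]; first by move=> _; apply: commute_sym; apply: commute1.
  move=> [->|[u' wu' ->]]; first exact: commute1.
  exact: (vsim_commute Esym vw).
have comV (g h : A) : commute g h -> commute g^-1 h.
  by move=> gh; apply: commute_sym; apply: commuteV; apply: commute_sym.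
apply: commuteM; apply: commute_sym; apply: commuteM; apply: commute_sym.
- by apply: commuteV; apply: comV; apply: com.
- by apply: commuteV; apply: com.
- by apply: comV; apply: com.
- exact: com.
Qed.

Definition wmap (s : {perm pt}) : A -> A := ext (wval s).

Lemma wmapM s : blockperm s -> {morph wmap s : x y / x * y}.
Proof. by move=> bs; apply: extM => v w; apply: wvalE. Qed.
Lemma wmap_vtx s v : blockperm s -> wmap s (vtx v) = wval s v.
Proof. by move=> bs; apply: ext_vtx => x y; apply: wvalE. Qed.
Lemma wmap_Z s x i : blockperm s -> wmap s (Z (x, i)) = (Z (s (x, 0%R)))^-1 * Z (s (x, i)).
Proof.
move=> bs; have [->|i0] := eqVneq i 0%R; first by rewrite Z0 (hom_one (wmapM bs)) mulVg.
by rewrite Zn0 // wmap_vtx // wval_zvert.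
Qed.

Lemma blockpermM s t : blockperm s -> blockperm t -> blockperm (s * t).
Proof.
move=> /blockpermP bs /blockpermP bt; apply/blockpermP => x i; rewrite !permM.
have [e1 t1] := bs x i; move: e1 t1 (bs x 0%R).2.
case: (s (x, i)) => y j; case: (s (x, 0%R)) => y' j' /= -> t1 _; split.
  by rewrite (bt y' j).1 (bt y' j').1.
by rewrite (bt y' j).2.
Qed.
Lemma blockperm1 : blockperm 1.
Proof. by apply/blockpermP => x i; rewrite !perm1. Qed.

Lemma wmap_comp s t : blockperm s -> blockperm t -> wmap (s * t) =1 wmap t \o wmap s.
Proof.
move=> bs bt; have bst := blockpermM bs bt; apply: raag_hom_eq; first exact: wmapM.
  by move=> x y; rewrite /= !wmapM.
move=> v; rewrite /= !wmap_vtx //; have [[x [i [i0 ->]]]|off] := vtx_cases v; last first.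
  by rewrite !wval_off // wmap_vtx // wval_off.
rewrite !wval_zvert // wmapM // (hom_inv (wmapM bt)) !permM.
move/blockpermP: bs => /(_ x i)[]; case: (s (x, i)) => y j; case: (s (x, 0%R)) => y' j' /= -> _.
by rewrite !wmap_Z // invgM invgK mulgA mulgK.
Qed.

Lemma wmap1 : wmap 1 =1 id.
Proof.
apply: raag_hom_eq => //; first exact: (wmapM blockperm1).
move=> v; rewrite wmap_vtx ?blockperm1 //; have [[x [i [i0 ->]]]|off] := vtx_cases v.
  by rewrite wval_zvert // !perm1 Z0 invg1 mul1g Zn0.
by rewrite wval_off.
Qed.

(** If s moves (x, i), then z_i does not occur with exponent 1 in the image of z_i. *)
Lemma wmap_faithful s : blockperm s ->
  (forall u v, eps u (wmap s (vtx v)) = eps u (vtx v)) -> s = 1.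
Proof.
move=> bs h; have epsZ u a : eps u (Z a) = ((a.2 != 0%R) && (zvert a.1 a.2 == u))%:R%R.
  by rewrite /Z; case: ifP => _; rewrite ?eps1 ?eps_vtx.
have fix_i x i : i != 0%R -> s (x, i) = (x, i).
  move=> i0; have := h (zvert x i) (zvert x i).
  rewrite wmap_vtx // wval_zvert // epsM epsV !epsZ eps_vtx eqxx.
  case: (s (x, i)) => y j /=; case: (boolP ((j != 0%R) && (zvert y j == zvert x i))) => [/andP[j0 /eqP e]|_].
    by have [-> ->] := zvert_inj j0 i0 e.
  by case: (_ && _).
apply/perm.permP => -[x i]; rewrite perm1; have [->|/fix_i //] := eqVneq i 0%R.
have n1 : (1 : 'Z_p)%R != 0%R by exact: oner_neq0.
have e1 : (s (x, 0%R)).1 = x by rewrite -((blockpermP s bs) x 1%R).1 fix_i.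
have e : s (x, 0%R) = (x, (s (x, 0%R)).2) by rewrite [LHS]surjective_pairing e1.
have [j0|j0] := eqVneq (s (x, 0%R)).2 0%R; first by rewrite e j0.
by have /perm_inj[j1] := etrans (fix_i x _ j0) (esym e); rewrite {1}j1 eqxx in j0.
Qed.

(** ** Purity *)

Lemma ispure_wmap_comp s t : blockperm s -> blockperm t ->
  ispure (wmap s) -> ispure (wmap t) -> ispure (wmap (s * t)).
Proof.
move=> bs bt ps pt'; apply: ispure_ext (ispure_comp pt' ps) => x.
by rewrite wmap_comp.
Qed.

(** Permutations that keep each block are generated by transpositions. *)
Definition fiberwise (s : {perm pt}) : Prop := forall a, (s a).1 = a.1.

Lemma fiberwise_blockperm s : fiberwise s -> blockperm s.
Proof. by move=> h; apply/blockpermP => x i; rewrite !h. Qed.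

Lemma fiberwise_tperm x i j : fiberwise (tperm (x, i) (x, j)).
Proof. by move=> a; case: tpermP => [->|->|]. Qed.

(** The transposition of the base point with z_i inverts z_i and multiplies the
    other elements of the block by its inverse. *)
Lemma ispure_tperm0 x i : i != 0%R -> ispure (wmap (tperm (x, 0%R) (x, i))).
Proof.
move=> i0; set s := tperm _ _; set v := zvert x i.
have bs : blockperm s := fiberwise_blockperm (@fiberwise_tperm x 0%R i).
pose J := [seq zvert x j | j <- enum 'Z_p & (j != 0%R) && (j != i)].
have [||f pf fE] := @ispure_multi_trv V E Esym v J.
- rewrite map_inj_in_uniq => [|j k]; first by rewrite filter_uniq //; apply: enum_uniq.
  by rewrite !mem_filter => /andP[/andP[j0 _] _] /andP[/andP[k0 _] _] /(zvert_inj j0 k0)[].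
- move=> w /mapP[j]; rewrite mem_filter => /andP[/andP[j0 ji] _] ->.
  apply/andP; split; first by have /andP[] := @zvert_sim x x j i erefl.
  by apply: contraNneq ji => /(zvert_inj i0 j0)[_ ->].
have vJ : v \notin J.
  apply/mapP => -[j]; rewrite mem_filter => /andP[/andP[j0 ji] _] /(zvert_inj i0 j0)[_ ij].
  by rewrite ij eqxx in ji.
have fM := ispure_morph pf.
apply: (ispure_cancel pf); apply: ispure_ext (ispure_inv E v).
apply: raag_hom_eq; first exact: inv_atM.
  by move=> g h; rewrite /= wmapM // fM.
move=> u; rewrite /= inv_at_vtx wmap_vtx //.
have [[y [j [j0 ->]]]|off] := vtx_cases u; last first.
  rewrite wval_off // fE; case: eqP => [e|_].
    by have := off (x, i) i0; rewrite /= -/v e eqxx.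
  case: ifP => // /mapP[j]; rewrite mem_filter => /andP[/andP[j0 _] _] e.
  by have := off (x, j) j0; rewrite /= e eqxx.
rewrite wval_zvert //; have [yx|yx] := eqVneq y x; last first.
  have sy k : s (y, k) = (y, k).
    by apply: tpermD; apply: contraNneq yx => -[->].
  rewrite !sy Z0 invg1 mul1g Zn0 //.
  rewrite fE; case: eqP => [/(zvert_inj j0 i0)[yx' _]|_]; first by rewrite yx' eqxx in yx.
  case: ifP => // /mapP[k]; rewrite mem_filter => /andP[/andP[k0 _] _] /(zvert_inj j0 k0)[yx' _].
  by rewrite yx' eqxx in yx.
rewrite {y}yx tpermL; have [->|ji] := eqVneq j i.
  by rewrite tpermR Z0 mulg1 Zn0 // eqxx (hom_inv fM) fE (negPf vJ).
rewrite tpermD; last 2 first.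
- by apply: contraNneq j0 => -[->].
- by apply: contraNneq ji => -[->].
rewrite !Zn0 //; case: eqP => [/(zvert_inj j0 i0)[_ ij]|_]; first by rewrite ij eqxx in ji.
rewrite fM (hom_inv fM) !fE (negPf vJ) ifT ?mulKg //.
by apply: map_f; rewrite mem_filter j0 ji mem_enum.
Qed.

Lemma ispure_tperm x i j : ispure (wmap (tperm (x, i) (x, j))).
Proof.
have [->|ij] := eqVneq i j.
  by rewrite tperm1; apply: ispure_ext (ispure_id E) => g; rewrite wmap1.
have [i0|i0] := eqVneq i 0%R.
  by rewrite i0; apply: ispure_tperm0; rewrite -i0 eq_sym.
have [->|j0] := eqVneq j 0%R; first by rewrite tpermC; apply: ispure_tperm0.
have -> : tperm (x, i) (x, j) = tperm (x, 0%R) (x, i) * tperm (x, 0%R) (x, j) * tperm (x, 0%R) (x, i).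
  rewrite -{1}[tperm (x, 0%R) (x, i)]tpermV -mulgA -/(_ ^ _) tpermJ tpermL tpermD //.
    by apply: contraNneq j0 => -[<-].
  by apply: contraNneq ij => -[<-].
have b k := fiberwise_blockperm (@fiberwise_tperm x 0%R k).
apply: ispure_wmap_comp => //; [exact: blockpermM | | exact: ispure_tperm0].
by apply: ispure_wmap_comp => //; apply: ispure_tperm0.
Qed.

Lemma ispure_fiberwise s : fiberwise s -> ispure (wmap s).
Proof.
have [n] := ubnP #|[set a | s a != a]%SET|; elim: n s => // n IH s; rewrite ltnS => sn hs.
have [a sa|fix_s] := pickP (fun a => s a != a); last first.
  have -> : s = 1 by apply/perm.permP => a; rewrite perm1; have /negbFE/eqP := fix_s a.
  by apply: ispure_ext (ispure_id E) => g; rewrite wmap1.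
pose t := tperm a (s a); pose s' := s * t.
have ft : fiberwise t.
  have := hs a; rewrite /t; case: (a) (s a) => x i [y j] /= ->; exact: fiberwise_tperm.
have pt : ispure (wmap t).
  by have := hs a; rewrite /t; case: (a) (s a) => x i [y j] /= ->; apply: ispure_tperm.
have fs' : fiberwise s' by move=> b; rewrite permM ft hs.
have -> : s = s' * t by rewrite /s' -mulgA tperm2 mulg1.
apply: ispure_wmap_comp => //; try exact: fiberwise_blockperm.
apply: IH => //; apply: leq_trans sn; apply: fintype.proper_card; rewrite fintype.properE.
apply/andP; split.
  apply/fintype.subsetP => x; rewrite !finset.in_set; apply: contraNneq => sx.
  rewrite permM sx tpermD //; first by apply: contraNneq sa => ->; rewrite sx.
  apply: contraNneq sa => e; apply/eqP; apply: (@perm_inj _ s); rewrite e sx -e //.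
apply/fintype.subsetPn; exists a; rewrite !finset.in_set // permM tpermR eqxx //.
Qed.

(** Block permutations that keep the second coordinate come from permutations
    of the vertices. *)
Lemma ispure_horizontal s : blockperm s -> (forall a, (s a).2 = a.2) -> ispure (wmap s).
Proof.
move=> bs hs; pose pre v := [pick a : pt | (a.2 != 0%R) && (zvert a.1 a.2 == v)].
pose h v := if pre v is Some a then zvert (s a).1 (s a).2 else v.
have hz x i : i != 0%R -> h (zvert x i) = zvert (s (x, i)).1 i.
  move=> i0; rewrite /h /pre; case: pickP => [[y j] /= /andP[j0 /eqP/(zvert_inj j0 i0)[-> ->]]|].
    by rewrite hs.
  by move=> /(_ (x, i)); rewrite /= i0 eqxx.
have hoff v : (forall a : pt, a.2 != 0%R -> zvert a.1 a.2 != v) -> h v = v.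
  move=> off; rewrite /h /pre; case: pickP => // a /andP[a0 /eqP e].
  by have := off a a0; rewrite e eqxx.
have h_inj : injective h.
  move=> u v; have [[x [i [i0 ->]]]|offu] := vtx_cases u; have [[y [j [j0 ->]]]|offv] := vtx_cases v.
  - rewrite !hz // => /(zvert_inj i0 j0)[e ij]; rewrite -ij in e *.
    have /perm_inj[-> //] : s (x, i) = s (y, i).
    by rewrite [LHS]surjective_pairing [RHS]surjective_pairing !hs e.
  - rewrite hz // (hoff v) // => e; have := offv ((s (x, i)).1, i) i0.
    by rewrite /= e eqxx.
  - rewrite hz // (hoff u) // => e; have := offu ((s (y, j)).1, j) j0.
    by rewrite /= e eqxx.
  - by rewrite !hoff.
have h_sim v : vsim v (perm h_inj v).
  rewrite permE; have [[x [i [i0 ->]]]|off] := vtx_cases v; last by rewrite hoff // vsim_refl.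
  by rewrite hz //; apply: zvert_sim; rewrite ((blockpermP s bs) x i).2.
apply: (ispure_ext _ (ispure_perm Esym h_sim)); apply: raag_hom_eq.
- exact: vmapM.
- exact: wmapM.
move=> v; rewrite vmap_vtx // permE wmap_vtx //.
have [[x [i [i0 ->]]]|off] := vtx_cases v; last by rewrite hoff // wval_off.
rewrite hz // wval_zvert //; have := hs (x, i); have := hs (x, 0%R).
case: (s (x, 0%R)) => y j /= ->; case: (s (x, i)) => y' j' /= ->.
by rewrite Z0 invg1 mul1g Zn0.
Qed.

(** ** The finite subgroup *)

Definition shift_fun (f : {ffun blk -> 'Z_p}) (a : pt) : pt := (a.1, a.2 + f a.1)%R.
Lemma shift_inj f : injective (shift_fun f).
Proof.
move=> [x i] [y j] e; have exy : x = y := congr1 fst e.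
by rewrite -exy in e *; have /GRing.addIr -> := congr1 snd e : (i + f x = j + f x)%R.
Qed.
Definition shift f : {perm pt} := perm (@shift_inj f).

Lemma shiftE f a : shift f a = (a.1, a.2 + f a.1)%R. Proof. exact: permE. Qed.
Lemma shiftD f g : shift (f + g)%R = shift f * shift g.
Proof. by apply/perm.permP => a; rewrite permM !shiftE ffunE /= addrA. Qed.
Lemma shift_injective : injective shift.
Proof.
move=> f g e; apply/ffunP => x; have := congr1 (fun s : {perm pt} => (s (x, 0%R)).2) e.
by rewrite !shiftE /= !add0r.
Qed.
Lemma shift_fiberwise f : fiberwise (shift f). Proof. by move=> a; rewrite shiftE. Qed.

Definition bperm : finType := {dffun forall C : {set V}, 'S_(nblocks C)}.
Definition horiz_fun (k : bperm) (a : pt) : pt :=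
  (Tagged (fun C => 'I_(nblocks C)) (k (tag a.1) (tagged a.1)), a.2).
Lemma horiz_inj k : injective (horiz_fun k).
Proof.
move=> [[C b] i] [[C' b'] j] [] /= eC; case: _ / eC b' => b' /eqP + ->.
by rewrite -tag_eqE /tag_eq /= eqxx tagged_asE /= => /eqP/perm_inj->.
Qed.
Definition horiz k : {perm pt} := perm (@horiz_inj k).

Lemma horizE k a : horiz k a = horiz_fun k a. Proof. exact: permE. Qed.

(** The elements of the product, over the classes, of the wreath products of Z/p
    with the symmetric group on the blocks of the class. *)
Definition wperm (fk : {ffun blk -> 'Z_p} * bperm) : {perm pt} := shift fk.1 * horiz fk.2.

Lemma wpermE fk a : wperm fk a = horiz_fun fk.2 (a.1, a.2 + fk.1 a.1)%R.
Proof. by rewrite permM shiftE horizE. Qed.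

Lemma wperm_inj : injective wperm.
Proof.
move=> [f k] [g l] e.
have h x : horiz_fun k (x, f x) = horiz_fun l (x, g x).
  by have := congr1 (fun s : {perm pt} => s (x, 0%R)) e; rewrite !wpermE /= !add0r.
congr pair; first by apply/ffunP => x; apply: (congr1 snd (h x)).
apply/ffunP => C; apply/perm.permP => b.
have /eqP := congr1 fst (h (Tagged (fun C => 'I_(nblocks C)) b)).
by rewrite -tag_eqE /tag_eq /= eqxx tagged_asE => /eqP.
Qed.

(** A permutation of the blocks moves past rotations by permuting their amounts. *)
Lemma wreath_group_set : group_set [set wperm fk | fk in [set: {ffun blk -> 'Z_p} * bperm]].
Proof.
apply/group_setP; split.
  apply/imsetP; exists (0%R, [ffun C => 1] : bperm); first by rewrite finset.in_setT.
  apply/perm.permP => -[[C b] i]; rewrite perm1 wpermE /horiz_fun /= !ffunE perm1 addr0 //.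
move=> _ _ /imsetP[[f k] _ ->] /imsetP[[g l] _ ->]; apply/imsetP.
exists ([ffun x => f x + g (horiz_fun k (x, 0)).1]%R, [ffun C => k C * l C] : bperm).
  by rewrite finset.in_setT.
by apply/perm.permP => -[[C b] i]; rewrite permM !wpermE /horiz_fun /= !ffunE /= permM addrA.
Qed.
Definition wreath : {group {perm pt}} := group wreath_group_set.

Lemma card_blk : #|blk| = (\sum_C nblocks C)%N.
Proof. by rewrite card_tagged sumnE big_map big_enum; apply: eq_bigr => C _; rewrite card_ord. Qed.

Lemma card_wreath : #|wreath| = (p ^ (\sum_C nblocks C) * \prod_C (nblocks C)`!)%N.
Proof.
rewrite card_imset; last exact: wperm_inj.
rewrite cardsT card_prod card_ffun card_blk card_ord Zp_cast ?prime_gt1 //; congr (_ * _)%N.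
rewrite card_dep_ffun foldrE big_map big_enum; apply: eq_bigr => C _.
exact: card_Sn.
Qed.

Lemma shift_wreath f : shift f \in wreath.
Proof.
apply/imsetP; exists (f, [ffun C => 1] : bperm); first by rewrite finset.in_setT.
by apply/perm.permP => -[[C b] i]; rewrite wpermE shiftE /horiz_fun /= !ffunE perm1.
Qed.

Lemma wreath_blockperm s : s \in wreath -> blockperm s.
Proof.
move=> /imsetP[fk _ ->]; apply: blockpermM.
  exact/fiberwise_blockperm/shift_fiberwise.
by apply/blockpermP => x i; rewrite !horizE.
Qed.

Lemma wreath_pure s : s \in wreath -> ispure (wmap s).
Proof.
move=> /imsetP[fk _ ->].
have b1 := fiberwise_blockperm (@shift_fiberwise fk.1).
have b2 : blockperm (horiz fk.2) by apply/blockpermP => x i; rewrite !horizE.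
apply: ispure_wmap_comp => //; first exact/ispure_fiberwise/shift_fiberwise.
by apply: ispure_horizontal => // a; rewrite horizE.
Qed.

(** Two elements of the group that differ by an inner automorphism act alike on
    homology, so the group still embeds into the outer automorphism group. *)
Lemma wreath_embeds : exists F : {perm pt} -> Aut0 E,
  [/\ {in wreath &, {morph F : s t / s * t}}
    & {in wreath &, injective (@out_pi V E \o F)}].
Proof.
(* permutations compose from left to right, automorphisms from right to left *)
have ex s : exists a : Aut0 E, s \in wreath -> (val a : aut A) =1 wmap s^-1.
  have [sW|_] := boolP (s \in wreath); last by exists 1.
  have [a aE pa] := wreath_pure (groupVr sW).
  by exists (Sub a pa) => _ x; rewrite SubK.
have [F FE] := choice ex.
have FM : {in wreath &, {morph F : s t / s * t}}.
  move=> s t sW tW; apply/val_inj/autP => x; rewrite FE ?groupM // invMg.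
  have bs := wreath_blockperm (groupVr sW); have bt := wreath_blockperm (groupVr tW).
  rewrite wmap_comp //= -(FE s) //; congr (_ _); by rewrite -FE.
exists F; split=> // s t sW tW /= /out_piP[a ha].
have F1 : F 1 = 1.
  by apply/val_inj/autP => x; rewrite FE ?group1 // invg1 wmap1.
have FV : (F s)^-1 = F s^-1.
  by apply: (mulgI (F s)); rewrite mulgV -FM ?groupV // mulgV F1.
have stW : s^-1 * t \in wreath by rewrite groupM ?groupV.
move: ha; rewrite FV -FM ?groupV // => ha.
have e : (s^-1 * t)^-1 = 1.
  apply: wmap_faithful => [|u v]; first by apply/wreath_blockperm/groupVr.
  by rewrite -FE // ha (@eps_inner V E id).
have e1 : s^-1 * t = 1 by rewrite -[LHS]invgK e invg1.
by rewrite -[t]mul1g -(mulgV s) -mulgA e1 mulg1.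
Qed.

End Wreath.

(** * Lower bounds and conclusion *)

Section LowerBounds.
Local Open Scope group_scope.
Variables (V : finType) (E : rel V).
Hypothesis Esym : symmetric E.
Variable p : nat.
Hypothesis p_pr : prime p.
Local Notation nu := (\sum_(C in vclasses E)
    \big[addn/0]_(k \in [set: nat]%classic) (#|C| %/ (p ^ k * (p - 1))))%N.
Local Notation rank := (\sum_(C in vclasses E) #|C| %/ (p - 1))%N.

Lemma logn_card_wreath : logn p #|wreath E p| = nu.
Proof.
rewrite -(sum_floor_vblock E p_pr) big_split /= card_wreath //.
have pos : (0 < \prod_C (nblocks E p C)`!)%N by apply: prodn_gt0 => C; apply: fact_gt0.
rewrite lognM // ?expn_gt0 ?prime_gt0 //.
rewrite pfactorK //; congr addn.
suff [] : (0 < \prod_C (nblocks E p C)`!)%N /\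
    logn p (\prod_C (nblocks E p C)`!) = (\sum_C logn p (nblocks E p C)`!)%N by [].
elim/big_rec2: _ => [|C n m _ [m0 <-]]; first by rewrite logn1.
by rewrite muln_gt0 fact_gt0 m0 lognM ?fact_gt0.
Qed.

Lemma wreath_sylow (G : groupType) (F : {perm pt E p} -> G) :
  {in wreath E p &, {morph F : s t / s * t}} -> {in wreath E p &, injective F} ->
  has_subgroup_of_order G (p ^ nu).
Proof.
move=> FM Finj; have [P sylP] := Sylow_exists p (wreath E p).
have sP := fintype.subsetP (pHall_sub sylP).
rewrite -logn_card_wreath -p_part -(card_Hall sylP); apply: (has_subgroup_of_finGroup (F := F)).
  by move=> s t sP' tP'; apply: FM; apply: sP.
by move=> s t /sP sW /sP tW; apply: Finj.
Qed.

(** The rotations alone already have the required rank. *)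
Lemma wreath_rank (G : groupType) (F : {perm pt E p} -> G) :
  {in wreath E p &, {morph F : s t / s * t}} -> {in wreath E p &, injective F} ->
  Zp_power_embeds p rank G.
Proof.
move=> FM Finj.
have e : #|blk E p| = rank by rewrite card_blk (sum_vblock E (F := fun n => n %/ (p - 1))%N) ?div0n.
rewrite -e; pose h (f : {ffun 'I_#|blk E p| -> 'Z_p}) := shift [ffun x => f (enum_rank x)].
exists (F \o h); split=> [f g /= fg|f g /=].
  have /shift_injective/ffunP hfg : h f = h g by apply: Finj; rewrite // ?shift_wreath.
  by apply/ffunP => i; have := hfg (enum_val i); rewrite !ffunE enum_valK.
rewrite -FM ?shift_wreath // -shiftD; congr (F (shift _)).
by apply/ffunP => x; rewrite !ffunE.
Qed.

Lemma Aut0_lower : has_subgroup_of_order (Aut0 E) (p ^ nu) /\ Zp_power_embeds p rank (Aut0 E).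
Proof.
have [F [FM Finj]] := wreath_embeds Esym p_pr.
have inj : {in wreath E p &, injective F}.
  by move=> s t sW tW st; apply: Finj; rewrite /= ?st.
by split; [apply: wreath_sylow inj | apply: wreath_rank inj].
Qed.

Lemma Out0_lower : has_subgroup_of_order (Out0 E) (p ^ nu) /\ Zp_power_embeds p rank (Out0 E).
Proof.
have [F [FM Finj]] := wreath_embeds Esym p_pr.
have oM : {in wreath E p &, {morph @out_pi V E \o F : s t / s * t}}.
  by move=> s t sW tW; rewrite /= FM // out_piM.
by split; [apply: wreath_sylow Finj | apply: wreath_rank Finj].
Qed.

End LowerBounds.

Theorem theorem5p11 (V : finType) (E : rel V) (Esym : symmetric E)
    (Eirr : irreflexive E) (p : nat) (pp : prime p) :
  let nu := (\sum_(C in vclasses E)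
    \big[addn/0]_(k \in [set: nat]%classic) (#|C| %/ (p ^ k * (p - 1))))%N in
  let rank := (\sum_(C in vclasses E) #|C| %/ (p - 1))%N in
  (is_nu p (Aut0 E) nu /\ is_nu p (Out0 E) nu) /\
  (is_rank p (Aut0 E) rank /\ is_rank p (Out0 E) rank).
Proof.
move=> nu rank.
have [an ar] := Aut0_lower Esym pp; have [on or] := Out0_lower Esym pp.
split; split; split=> // t.
- exact: Aut0_nu_le.
- exact: Out0_nu_le.
- exact: Aut0_rank_le.
- exact: Out0_rank_le.
Qed.
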